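(* Let $d\in\mathbb N$, $p,\mu\in(1,\infty)$ and define $$\frac1q:=\frac{1}{4d+2}\left(\frac{3d+1}{p}+\frac{d+1}{\mu}-1\right).$$ Assume $q>\max\{2,p,\mu\}$. Then there exists $C=C(d,p,\mu)>0$ such that for every $f\in \mathrm L^2(\mathbb R^{1+2d})$ with $\nabla_v f\in \mathrm L^p(\mathbb R^{1+2d})$ and satisfying $$(\partial_t+v\cdot\nabla_x)f=\nabla_v\cdot S_0$$ in the sense of distributions for some $S_0\in \mathrm L^\mu(\mathbb R^{1+2d};\mathbb R^d)$, it holds that $$\|f\|_{\mathrm L^q(\mathbb R^{1+2d})}\le C\,\|\nabla_v f\|_{\mathrm L^p(\mathbb R^{1+2d})}^{\frac{3d+1}{4d+2}}\,\|S_0\|_{\mathrm L^\mu(\mathbb R^{1+2d})}^{\frac{d+1}{4d+2}}.$$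
   Context: Points of $\mathbb R^{1+2d}$ are written $(t,x,v)$ with $t\in\mathbb R$, $x,v\in\mathbb R^d$; $\nabla_x,\nabla_v$ denote the gradients in $x$ and $v$ (in the distributional sense). *)

(* Defs.v *)
From HB Require Import structures.
From mathcomp Require Import all_boot all_order all_algebra.
From mathcomp Require Import all_classical all_reals all_analysis.
Set Implicit Arguments. Unset Strict Implicit. Unset Printing Implicit Defensive.
Import Order.TTheory GRing.Theory Num.Theory.
Import numFieldNormedType.Exports.
Local Open Scope classical_set_scope.
Local Open Scope ring_scope.

Section kinetic_defs.
Variable R : realType.

(* Points of R^n are n-tuples of reals; n.-tuple R carries (from
   mathcomp-analysis) the product sigma-algebra of the Borel sets of R,
   i.e. the Borel sigma-algebra of R^n. *)

(* Lebesgue integral over R^n of a nonnegative function, computed as the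
   iterated one-dimensional Lebesgue integral (Tonelli). *)
Fixpoint iint (n : nat) : (n.-tuple R -> \bar R) -> \bar R :=
  match n return (n.-tuple R -> \bar R) -> \bar R with
  | 0%N => fun f => f [tuple]
  | m.+1 => fun f =>
      (\int[@lebesgue_measure R]_x iint (fun t : m.-tuple R => f [tuple of x :: t]))%E
  end.

Definition iintS n (f : n.-tuple R -> R) : \bar R :=
  (iint (fun z => (Num.max (f z) 0)%:E) - iint (fun z => (Num.max (- f z) 0)%:E))%E.

Definition Lnormn n (p : R) (f : n.-tuple R -> R) : \bar R :=
  (iint (fun z => (`|f z| `^ p)%:E) `^ p^-1)%E.

Definition memLp n (p : R) (f : n.-tuple R -> R) : Prop :=
  measurable_fun [set: n.-tuple R] f /\ (Lnormn p f < +oo)%E.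

Definition shift n (z : n.-tuple R) (k : nat) (s : R) : n.-tuple R :=
  [tuple (if val j == k then tnth z j + s else tnth z j) | j < n].

Definition partial n (k : nat) (phi : n.-tuple R -> R) (z : n.-tuple R) : R :=
  derive1 (fun s => phi (shift z k s)) 0.

Fixpoint dpart n (ks : seq nat) (phi : n.-tuple R -> R) : n.-tuple R -> R :=
  match ks with
  | [::] => phi
  | k :: ks' => partial k (dpart ks' phi)
  end.

Definition tcont n (g : n.-tuple R -> R) : Prop :=
  forall z (e : R), 0 < e -> exists2 del : R, 0 < del &
    forall w, (forall j, `|tnth w j - tnth z j| < del) -> `|g w - g z| < e.

Definition test_fun n (phi : n.-tuple R -> R) : Prop :=
  (exists M : R, forall z, (exists j, M < `|tnth z j|) -> phi z = 0) /\
  forall ks : seq nat, tcont (dpart ks phi) /\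
    forall (k : nat) z, (k < n)%N -> derivable (fun s => dpart ks phi (shift z k s)) 0 1.

(* phase space R^{1+2d}: coordinate 0 is t, coordinates 1..d are x,
   coordinates d+1..2d are v *)
Definition pt (d : nat) := (1 + 2 * d)%N.-tuple R.
Definition tidx : nat := 0%N.
Definition xidx (i : nat) : nat := (1 + i)%N.
Definition vidx (d i : nat) : nat := (1 + d + i)%N.
Definition vcoord d (z : pt d) (i : nat) : R := nth 0 z (vidx d i).

Definition vnorm d (G : 'I_d -> pt d -> R) (z : pt d) : R :=
  Num.sqrt (\sum_(i < d) G i z ^+ 2).

Definition is_weak_vgrad d (f : pt d -> R) (G : 'I_d -> pt d -> R) : Prop :=
  forall phi : pt d -> R, test_fun phi -> forall i : 'I_d,
    iintS (fun z => f z * partial (vidx d i) phi z) =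
    (- iintS (fun z => (G i z * phi z)%R))%E.

Definition kinetic_eq d (f : pt d -> R) (S0 : 'I_d -> pt d -> R) : Prop :=
  forall phi : pt d -> R, test_fun phi ->
    iintS (fun z => f z * (partial tidx phi z +
                           \sum_(i < d) vcoord z i * partial (xidx i) phi z)) =
    iintS (fun z => \sum_(i < d) S0 i z * partial (vidx d i) phi z).

End kinetic_defs.

(* Main.v *)
Require Import Defs.
From HB Require Import structures.
From mathcomp Require Import all_boot all_order all_algebra.
From mathcomp Require Import all_classical all_reals all_analysis.
From mathcomp Require Import measurable_realfun ring lra zify.
Import Order.TTheory GRing.Theory Num.Theory.
Import numFieldNormedType.Exports.
Set Implicit Arguments. Unset Strict Implicit. Unset Printing Implicit Defensive.
Local Open Scope classical_set_scope.
Local Open Scope ring_scope.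

(** The function [f] is compared with its averages over balls adapted to the kinetic group law, and
    these averages are followed through all scales. Scales are indexed by volume: at parameter [r] a
    ball has size [lam r = sig * r ^ a] in time, [eta r = tau * r ^ b] in velocity and
    [lam r * eta r] in space. The relations [a (1 + d) + 2 b d = 1] and
    [sig ^ (1 + d) * tau ^ (2 d) = 1] make the product of these sizes over all coordinates equal to
    [r].

    Let [f_r] be the mollification of [f] with kernel [r^-1 * phi0 (kinr z r w)]. Differentiating
    the kernel in [r] gives [- r^-2] times the generator of the dilations applied to [phi0]. This is
    a divergence; the commutator identity [d_x = [d_v, d_t + v . d_x]] removes its space derivatives
    and leaves a transport derivative of one potential plus a velocity divergence of another
    ([generatorE]). The kinetic equation handles the former and the weak gradient the latter, so
    [|f_r - f_(r/2)|] is at most a constant times [r^(a-b-1)] times the integral of [|S0|] over the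
    ball plus [r^(b-1)] times that of [|grad_v f|] ([mollify_increment]). Square integrability of
    [f] forces [f_r] to vanish as [r] tends to infinity ([mollify_decay]). Summing over dyadic
    scales therefore bounds the small-scale mollifications by discretized Riesz potentials of [|S0|]
    and [|grad_v f|], of orders [a - b] and [b] ([mollify_le_telesup]).

    Take [b = 1/p - 1/q] and [a - b = 1/mu - 1/q]. A Hardy-Littlewood-Sobolev inequality for ball
    families ([integral_fsum_le]) then maps both potentials to [L^q], and the volume relation
    between [a] and [b] is exactly the definition of [q].

    To return to [f], the mollifications converge to [f] weakly on boxes ([mollify_weak_cvg]) and
    share a locally integrable majorant. Domination extends the weak convergence to all measurable
    subsets of a box, and testing on the set where [|f|] exceeds the majorant shows that this set is
    null ([le_of_mollify_le]).

    The result is a bound of the [L^q] norm by [(sig / tau) * |S0|_mu + tau * |grad_v f|_p] with a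
    constant independent of [sig] and [tau] ([kinetic_integral_le]). Choosing the two scales so that
    both terms agree ([optimal_scales]) turns the sum into the stated product. *)

Section tuple_measure.
Context {R : realType}.
Local Notation leb := (@lebesgue_measure R).

(** * Lebesgue measure on tuples, and its agreement with iterated integrals *)

Definition pcons n (z : measurableTypeR R * n.-tuple R) : n.+1.-tuple R :=
  [tuple of z.1 :: z.2].

Lemma measurable_pcons n : measurable_fun setT (@pcons n).
Proof.
by apply: (@measurable_cons _ _ _ _ (fst : measurableTypeR R * n.-tuple R -> R)).
Qed.

Definition puncons n (z : n.+1.-tuple R) : measurableTypeR R * n.-tuple R :=
  (thead z, [tuple of behead z]).

Lemma measurable_puncons n : measurable_fun setT (@puncons n).
Proof.
apply: (@measurable_fun_pair _ _ _ _ (measurableTypeR R)); last exact: measurable_behead.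
exact: (@measurable_tnth _ _ n.+1 ord0).
Qed.

Lemma pconsK n : cancel (@pcons n) (@puncons n).
Proof.
by move=> [x t]; rewrite /puncons theadE; congr pair; apply/val_inj.
Qed.

Lemma punconsK n : cancel (@puncons n) (@pcons n).
Proof. by move=> z; rewrite /pcons [RHS]tuple_eta; exact/val_inj. Qed.

Section step.
Context n (mu : {sigma_finite_measure set (n.-tuple R) -> \bar R}).

Definition mcons : set (n.+1.-tuple R) -> \bar R :=
  pushforward (leb \x mu)%E (@pcons n).
HB.instance Definition _ := Measure.copy mcons
  (measure_function_pushforward__canonical__measure_function_Measure
    (leb \x mu)%E (@measurable_pcons n)).

Let sf : sigma_finite setT mcons.
Proof.
have [F1 [F1T F1n F1f]] := (sigma_finiteP _ _).1 (sigma_finiteT leb).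
have [F2 [F2T F2n F2f]] := (sigma_finiteP _ _).1 (sigma_finiteT mu).
exists (fun i => @puncons n @^-1` (F1 i `*` F2 i)).
  apply/esym/seteqP; split => // z _.
  have [i _ Hi] : (\bigcup_i F1 i) (puncons z).1 by rewrite -F1T.
  have [k _ Hk] : (\bigcup_i F2 i) (puncons z).2 by rewrite -F2T.
  exists (maxn i k) => //; split.
    by move: (F1n _ _ (leq_maxl i k)); rewrite subsetEset; apply.
  by move: (F2n _ _ (leq_maxr i k)); rewrite subsetEset; apply.
move=> i; have [m1 f1] := F1f i; have [m2 f2] := F2f i; split.
  rewrite -[X in measurable X]setTI; apply: measurable_puncons => //.
  exact: measurableX.
rewrite /mcons /pushforward -comp_preimage.
rewrite (_ : _ \o _ = id); last by rewrite funeqE => z /=; rewrite pconsK.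
by rewrite preimage_id product_measure1E // lte_mul_pinfty // ge0_fin_numE.
Qed.
HB.instance Definition _ := @Measure_isSigmaFinite.Build _ _ _ mcons sf.
End step.

(** Lebesgue measure on [R^n], built by the same recursion as [iint]. Having a sigma-finite measure
    at hand makes Tonelli, Fubini, Fatou and dominated convergence applicable to the iterated
    integrals of the statement. *)
Fixpoint mun n : {sigma_finite_measure set (n.-tuple R) -> \bar R} :=
  match n return {sigma_finite_measure set (n.-tuple R) -> \bar R} with
  | 0 => [the {sigma_finite_measure set _ -> \bar R} of dirac [tuple]]
  | m.+1 => [the {sigma_finite_measure set _ -> \bar R} of mcons (mun m)]
  end.

Lemma ge0_integral_munS n (f : n.+1.-tuple R -> \bar R) :
  measurable_fun setT f -> (forall z, 0 <= f z)%E ->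
  (\int[mun n.+1]_z f z = \int[leb]_x \int[mun n]_t f [tuple of x :: t])%E.
Proof.
move=> mf f0; rewrite ge0_integral_pushforward //; first last.
  exact: measurable_pcons.
rewrite preimage_setT fubini_tonelli1 //=.
by apply: measurableT_comp => //; exact: measurable_pcons.
Qed.

Lemma iintE n (f : n.-tuple R -> \bar R) : measurable_fun setT f ->
  (forall z, 0 <= f z)%E -> iint f = (\int[mun n]_z f z)%E.
Proof.
elim: n f => [|n IH] f mf f0.
  by rewrite /= integral_dirac // diracT mul1e.
rewrite ge0_integral_munS //; apply: eq_integral => x _.
apply: IH => //; apply: measurableT_comp => //.
exact: measurable_cons.
Qed.

Lemma iintSE n (f : n.-tuple R -> R) : measurable_fun setT f ->
  iintS f = (\int[mun n]_z (f z)%:E)%E.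
Proof.
move=> mf; rewrite integralE /iintS !iintE.
- congr (_ - _)%E; apply: eq_integral => z _; first by rewrite funeposE EFin_max.
  by rewrite funenegE EFin_max.
- apply/measurable_EFinP; apply: measurable_maxr => //.
  exact: measurableT_comp.
- by move=> z; rewrite lee_fin le_max lexx orbT.
- by apply/measurable_EFinP; exact: measurable_maxr.
- by move=> z; rewrite lee_fin le_max lexx orbT.
Qed.

Lemma LnormnE n (p : R) (f : n.-tuple R -> R) : measurable_fun setT f ->
  Lnormn p f = ((\int[mun n]_z (`|f z| `^ p)%:E) `^ p^-1)%E.
Proof.
move=> mf; rewrite /Lnormn iintE; [by []| |by move=> z; rewrite lee_fin powR_ge0].
apply/measurable_EFinP.
apply: (measurableT_comp (measurable_powR _)); exact: measurableT_comp.
Qed.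

Lemma measurable_nth n i :
  measurable_fun setT (fun z : n.-tuple R => nth 0 z i).
Proof.
case: (ltnP i n) => [im|ni].
  rewrite (_ : (fun _ => _) = fun z : n.-tuple R => tnth z (Ordinal im)).
    exact: measurable_tnth.
  by apply/funext => z; rewrite (tnth_nth 0).
rewrite (_ : (fun _ => _) = cst 0) //.
by apply/funext => z; rewrite nth_default ?size_tuple.
Qed.

Lemma integral_mun_prod n (u : nat -> R -> R) :
  (forall j, measurable_fun setT (u j)) -> (forall j x, 0 <= u j x) ->
  (\int[mun n]_z (\prod_(j < n) u j (nth 0 z j))%:E =
   \prod_(j < n) \int[leb]_x (u j x)%:E)%E.
Proof.
elim: n u => [|n IH] u mu u0.
  rewrite big_ord0 /=.
  under eq_integral do rewrite big_ord0.
  by rewrite integral_dirac // diracT mul1e.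
rewrite ge0_integral_munS; last 2 first.
- apply/measurable_EFinP; apply: measurable_prod => i _.
  by apply: measurableT_comp => //; exact: measurable_nth.
- by move=> z; rewrite lee_fin prodr_ge0.
rewrite big_ord_recl.
transitivity (\int[leb]_x ((u 0%N x)%:E * \prod_(j < n) \int[leb]_x (u j.+1 x)%:E)%E)%E.
  apply: eq_integral => x _; rewrite -(IH (fun j => u j.+1)) // -ge0_integralZl ?lee_fin //.
  - by apply: eq_integral => z _; rewrite big_ord_recl EFinM.
  - apply/measurable_EFinP; apply: measurable_prod => i _.
    by apply: measurableT_comp => //; exact: measurable_nth.
  - by move=> z _; rewrite lee_fin prodr_ge0.
rewrite ge0_integralZr //.
- exact: (measurableT_comp (@EFin_measurable R _) (mu 0%N)).
- by move=> x _; rewrite lee_fin.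
- by rewrite prode_ge0 // => i _; apply: integral_ge0 => x _; rewrite lee_fin.
Qed.

End tuple_measure.

(** * Truncated geometric and dyadic sums *)

Section geometric.
Context {R : realFieldType}.
Implicit Types (e : nat -> R) (k y : R).

Lemma sum_geom_le_increasing e k y m : 1 < k -> (forall i, 0 < e i) -> 0 <= y ->
  (forall i, e i.+1 = k * e i) ->
  \sum_(i < m) (if e i <= y then e i else 0) <= k / (k - 1) * y.
Proof.
move=> k1 e0 y0 eS; have k10 : 0 < k - 1 by rewrite subr_gt0.
have kE : k = (k - 1) + 1 by ring.
(* The induction carries a second bound, by the full geometric sum [e m / (k - 1)]: it is what
   remains to be used once the terms have passed the threshold [y]. *)
suff [] : \sum_(i < m) (if e i <= y then e i else 0) <= k / (k - 1) * y /\
    \sum_(i < m) (if e i <= y then e i else 0) <= e m / (k - 1) by [].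
have c0 : 0 <= k / (k - 1) by rewrite divr_ge0 ?ltW // (lt_trans _ k1).
elim: m => [|m [IH1 IH2]].
  by rewrite big_ord0 mulr_ge0 // divr_ge0 ?ltW.
have e1 : e m / (k - 1) + e m = k / (k - 1) * e m by field; rewrite gt_eqF.
have e2 : e m.+1 / (k - 1) = k / (k - 1) * e m by rewrite eS; ring.
rewrite big_ord_recr /=; case: ifPn => [emy|_].
  suff : \sum_(i < m) (if e i <= y then e i else 0) + e m <= k / (k - 1) * e m.
    move=> h; split; last by rewrite e2.
    by apply: (le_trans h); rewrite ler_wpM2l.
  by rewrite -e1 lerD2r.
rewrite addr0; split => //; apply: (le_trans IH2).
by rewrite e2 -e1 lerDl ltW.
Qed.

Lemma sum_geom_lt_decreasing e k y m : 1 < k -> (forall i, 0 < e i) -> 0 <= y ->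
  (forall i, e i.+1 = e i / k) ->
  \sum_(i < m) (if e i < y then e i else 0) <= k / (k - 1) * y.
Proof.
move=> k1 e0 y0 eS; have k10 : 0 < k - 1 by rewrite subr_gt0.
have k0 : 0 < k by rewrite (lt_trans _ k1).
have c0 : 0 < k / (k - 1) by rewrite divr_gt0.
have eE i : e i = k / (k - 1) * (e i - e i.+1).
  by rewrite eS; field; rewrite !gt_eqF.
(* Each term is [k / (k - 1)] times the difference of two consecutive ones, so the sum telescopes
   from the first term below [y]; as long as the terms are at least [y] the sum is empty. *)
suff [h1 h2] : (e m < y -> \sum_(i < m) (if e i < y then e i else 0)
      <= k / (k - 1) * (y - e m)) /\
    (y <= e m -> \sum_(i < m) (if e i < y then e i else 0) <= 0).
  have [/h1|/h2] := ltP (e m) y => /le_trans; apply; last by rewrite mulr_ge0 // ltW.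
  by rewrite ler_pM2l // lerBlDr lerDl ltW.
elim: m => [|m [IH1 IH2]].
  rewrite big_ord0; split=> // h; by rewrite mulr_ge0 ?(ltW c0) // subr_ge0 ltW.
rewrite big_ord_recr /=; case: (ltP (e m) y) => [emy|yem].
  have em1 : e m.+1 < y.
    have ek : e m.+1 <= e m by rewrite eS ler_pdivrMr; [exact: (ler_peMr (ltW (e0 m)) (ltW k1))|].
    exact: le_lt_trans ek emy.
  split=> [_|/(lt_le_trans em1)]; last by rewrite ltxx.
  apply: (le_trans (lerD (IH1 emy) (lexx _))).
  by rewrite {2}eE -mulrDr addrA subrK.
rewrite addr0; split=> [em1|_]; last exact: IH2.
by apply: (le_trans (IH2 yem)); rewrite mulr_ge0 ?(ltW c0) // subr_ge0 ltW.
Qed.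

End geometric.

Section dyadic.
Context {R : realType}.

Lemma powR_le (b x y : R) : 0 < b -> 0 <= x -> 0 <= y ->
  (x `^ b <= y `^ b) = (x <= y).
Proof.
move=> b0 x0 y0; apply/idP/idP => [|xy]; last by apply: ge0_ler_powR; rewrite // ltW.
by apply: contraTT; rewrite -!ltNge => yx; apply: gt0_ltr_powR.
Qed.

Lemma powR_lt (b x y : R) : 0 < b -> 0 <= x -> 0 <= y ->
  (x `^ b < y `^ b) = (x < y).
Proof. by move=> b0 x0 y0; rewrite !ltNge powR_le. Qed.

Lemma powR2_gt1 (b : R) : 0 < b -> 1 < 2 `^ b.
Proof. by move=> b0; rewrite -[ltLHS](_ : 1 `^ b = 1) ?powR_lt ?ltr1n // powR1. Qed.

(** Used for [i < 2 * N], this lists the powers of two from [2^-N] to [2^(N-1)]. Letting [N] grow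
    exhausts all dyadic scales while every sum stays finite. *)
Definition dyad N i : R := 2 ^+ i / 2 ^+ N.

Lemma dyad_gt0 N i : 0 < dyad N i.
Proof. by rewrite divr_gt0 // exprn_gt0. Qed.

Lemma dyadS N i : dyad N i.+1 = 2 * dyad N i.
Proof. by rewrite /dyad exprS mulrA. Qed.

Lemma sum_dyad_le b (x : R) N m : 0 < b -> 0 <= x ->
  \sum_(i < m) (if dyad N i <= x then dyad N i `^ b else 0)
  <= 2 `^ b / (2 `^ b - 1) * x `^ b.
Proof.
move=> b0 x0; under eq_bigr => i _ do
  rewrite -(powR_le b0 (ltW (dyad_gt0 N i)) x0).
apply: (sum_geom_le_increasing (e := fun i => dyad N i `^ b)).
- exact: powR2_gt1.
- by move=> i; rewrite powR_gt0 // dyad_gt0.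
- exact: powR_ge0.
- by move=> i; rewrite dyadS powRM // ltW // dyad_gt0.
Qed.

Lemma sum_dyad_gt b (x : R) N m : 0 < b -> 0 < x ->
  \sum_(i < m) (if x < dyad N i then dyad N i `^ (- b) else 0)
  <= 2 `^ b / (2 `^ b - 1) * x `^ (- b).
Proof.
move=> b0 x0.
have E i : (x < dyad N i) = (dyad N i `^ (- b) < x `^ (- b)).
  rewrite !powRN ltf_pV2 ?posrE ?powR_gt0 ?dyad_gt0 //.
  by rewrite powR_lt // ltW // dyad_gt0.
under eq_bigr => i _ do rewrite E.
apply: (sum_geom_lt_decreasing (e := fun i => dyad N i `^ (- b))).
- exact: powR2_gt1.
- by move=> i; rewrite powR_gt0 // dyad_gt0.
- exact: powR_ge0.
- by move=> i; rewrite dyadS powRM // ?(ltW (dyad_gt0 N i)) // mulrC [2 `^ _]powRN.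
Qed.

Lemma dyad_between (y : R) : 0 < y ->
  exists N0, forall N, (N0 <= N)%N ->
    exists2 i, (i < 2 * N)%N & dyad N i < y <= 2 * dyad N i.
Proof.
move=> y0; pose N0 := (Num.truncn (Num.max y y^-1)).+1.
have hN0 : Num.max y y^-1 < N0%:R by rewrite truncnS_gt.
exists N0 => N N0N.
have N2 : (N0%:R : R) <= 2 ^+ N.
  by rewrite -natrX ler_nat (leq_trans N0N) // ltnW // ltn_expl.
have y1 : y <= 2 ^+ N.
  by apply: le_trans N2; apply: ltW; apply: le_lt_trans hN0; rewrite le_max lexx.
have y2 : (2 ^+ N)^-1 < y.
  rewrite -(invrK y) ltf_pV2 ?posrE ?exprn_gt0 ?invr_gt0 //.
  by apply: lt_le_trans N2; apply: le_lt_trans hN0; rewrite le_max lexx orbT.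
have ex : exists i, y <= dyad N i.
  by exists (N + N)%N; rewrite /dyad exprD mulfK // expf_neq0.
case: (ex_minnP ex) => -[|m] hm mmin.
  by move: hm; rewrite /dyad expr0 div1r leNgt y2.
exists m; last first.
  rewrite -dyadS hm andbT ltNge; apply/negP => /mmin; by rewrite ltnn.
rewrite mul2n -addnn; apply: mmin.
by rewrite /dyad exprD mulfK // expf_neq0.
Qed.

End dyadic.

(** * Integrals over a family of balls *)

Section averages.
Context d (T : measurableType d) (R : realType).
Variable mu : {sigma_finite_measure set T -> \bar R}.
Implicit Types (g h : T -> R) (B : set (T * T)).

(** Not divided by the volume of the ball: the normalization is put in the powers of [r] that
    multiply it later. *)
Definition avg B g (z : T) : \bar R := (\int[mu]_y (g y * \1_B (z, y))%:E)%E.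

(** The parameter [r] plays the role of a volume. Both families of sections are controlled: the
    first gives pointwise bounds on [avg], the second gives its [L^1] bound by Tonelli. *)
Definition ball_family (C0 : R) (B : R -> set (T * T)) := forall r, 0 < r ->
  [/\ measurable (B r),
      forall z, (\int[mu]_y (\1_(B r) (z, y))%:E <= (C0 * r)%:E)%E &
      forall y, (\int[mu]_z (\1_(B r) (z, y))%:E <= (C0 * r)%:E)%E].

Lemma measurable_avg_integrand B g : measurable B -> measurable_fun setT g ->
  measurable_fun setT (fun x : T * T => (g x.2 * \1_B x)%:E).
Proof.
move=> mB mg; apply/measurable_EFinP; apply: measurable_funM => //.
exact: measurableT_comp.
Qed.

Lemma measurable_avg_integrand1 B g z : measurable B -> measurable_fun setT g ->
  measurable_fun setT (fun y => (g y * \1_B (z, y))%:E).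
Proof.
move=> mB mg.
exact: (measurableT_comp (measurable_avg_integrand mB mg) (pair1_measurable z)).
Qed.

Lemma avg_ge0 B g z : (forall y, 0 <= g y) -> (0 <= avg B g z)%E.
Proof. by move=> g0; apply: integral_ge0 => y _; rewrite lee_fin mulr_ge0. Qed.

Lemma measurable_avg B g : measurable B -> measurable_fun setT g ->
  (forall y, 0 <= g y) -> measurable_fun setT (avg B g).
Proof.
move=> mB mg g0.
apply: (measurable_fun_fubini_tonelli_F (fun x : T * T => (g x.2 * \1_B x)%:E)).
  exact: measurable_avg_integrand.
by move=> x; rewrite lee_fin mulr_ge0.
Qed.

Lemma le_avg B g h z : measurable B -> measurable_fun setT g ->
  measurable_fun setT h -> (forall y, 0 <= g y) -> (forall y, g y <= h y) ->
  (avg B g z <= avg B h z)%E.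
Proof.
move=> mB mg mh g0 gh; apply: ge0_le_integral => //.
- by move=> y _; rewrite lee_fin mulr_ge0.
- exact: measurable_avg_integrand1.
- exact: measurable_avg_integrand1.
- by move=> y _; rewrite lee_fin ler_wpM2r.
Qed.

Lemma avgZ B g z c : measurable B -> measurable_fun setT g ->
  (forall y, 0 <= g y) -> 0 <= c ->
  avg B (fun y => c * g y) z = (c%:E * avg B g z)%E.
Proof.
move=> mB mg g0 c0; rewrite /avg -ge0_integralZl_EFin //.
- by apply: eq_integral => y _; rewrite -EFinM mulrA.
- by move=> y _; rewrite lee_fin mulr_ge0.
- exact: measurable_avg_integrand1.
Qed.

Lemma avgD B g h z : measurable B -> measurable_fun setT g ->
  measurable_fun setT h -> (forall y, 0 <= g y) -> (forall y, 0 <= h y) ->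
  avg B (fun y => g y + h y) z = (avg B g z + avg B h z)%E.
Proof.
move=> mB mg mh g0 h0; rewrite /avg -ge0_integralD //.
- by apply: eq_integral => y _; rewrite -EFinD mulrDl.
- by move=> y _; rewrite lee_fin mulr_ge0.
- exact: measurable_avg_integrand1.
- by move=> y _; rewrite lee_fin mulr_ge0.
- exact: measurable_avg_integrand1.
Qed.

Context (C0 : R) (B : R -> set (T * T)).
Hypothesis BC : ball_family C0 B.

Lemma avg_cst r z c : 0 < r -> 0 <= c -> (avg (B r) (cst c) z <= (c * (C0 * r))%:E)%E.
Proof.
move=> r0 c0; have [mB B1 _] := BC r0.
have := @avgZ (B r) (cst 1) z c mB (measurable_cst _) (fun=> ler01) c0.
rewrite (_ : (fun y => _) = cst c); last by apply/funext => y /=; rewrite mulr1.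
move=> ->; rewrite EFinM lee_wpmul2l ?lee_fin //; apply: le_trans (B1 z).
by rewrite /avg; under eq_integral do rewrite /= mul1r.
Qed.

Definition cut (w : R) g y : R := if w <= g y then g y else 0.

Lemma cut_ge0 w g y : (forall y, 0 <= g y) -> 0 <= cut w g y.
Proof. by move=> g0; rewrite /cut; case: ifP. Qed.

Lemma measurable_cut w g : measurable_fun setT g -> measurable_fun setT (cut w g).
Proof.
move=> mg; apply: measurable_fun_ifT => //.
exact: measurable_fun_ler.
Qed.

Lemma avg_le_cut r g z w : 0 < r -> 0 < w -> measurable_fun setT g ->
  (forall y, 0 <= g y) ->
  (avg (B r) g z <= (w * (C0 * r))%:E + avg (B r) (cut w g) z)%E.
Proof.
move=> r0 w0 mg g0; have [mB _ _] := BC r0.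
have mc := measurable_cut w mg.
apply: le_trans (leeD (avg_cst z r0 (ltW w0)) (lexx _)).
rewrite -avgD // => [|y|y]; [|exact: ltW|exact: cut_ge0].
apply: le_avg => //; first exact: measurable_funD.
by move=> y; rewrite /cut /=; case: (leP w (g y)) => [_|/ltW]; rewrite ?addr0 // lerDr ltW.
Qed.

(** Hölder in elementary form: pointwise [g <= M + M^(1-p) g^p], and the height [M = r^(-1/p)] makes
    both contributions of size [r^(1-1/p)]. *)
Lemma avg_le_Lp r g z p : 0 < r -> 1 < p -> measurable_fun setT g ->
  (forall y, 0 <= g y) -> (\int[mu]_y (g y `^ p)%:E <= 1)%E ->
  (avg (B r) g z <= ((C0 + 1) * r `^ (1 - p^-1))%:E)%E.
Proof.
move=> r0 p1 mg g0 gp; have [mB _ _] := BC r0.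
have p0 : 0 < p by rewrite (lt_trans _ p1).
set M := r `^ (- p^-1).
have M0 : 0 < M by rewrite powR_gt0.
have Mp : M `^ (1 - p) = r `^ (1 - p^-1).
  by rewrite /M -powRrM; congr (_ `^ _); field; rewrite gt_eqF.
have Mr : M * r = r `^ (1 - p^-1).
  by rewrite /M -[X in _ * X]powRr1 ?ltW // -powRD 1?addrC // (gt_eqF r0) implybT.
have mgp : measurable_fun setT (fun y => g y `^ p).
  exact: (measurableT_comp (measurable_powR _)).
have mgM : measurable_fun setT (fun y => M `^ (1 - p) * g y `^ p).
  exact: measurable_funM.
have gp0 y : 0 <= M `^ (1 - p) * g y `^ p by rewrite mulr_ge0 // powR_ge0.
apply: (@le_trans _ _ (avg (B r) (fun y => M + M `^ (1 - p) * g y `^ p) z)).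
  apply: le_avg => //; first exact: measurable_funD.
  move=> y; have [gM|Mg] := leP (g y) M; first by rewrite (le_trans gM) // lerDl.
  apply: le_trans (_ : M `^ (1 - p) * g y `^ p <= _); last by rewrite lerDr ltW.
  rewrite -(mulr_powRB1 (g0 y) p0) mulrCA ler_peMr //.
  have -> : 1 - p = - (p - 1) by rewrite opprB.
  rewrite powRN ler_pdivlMl ?powR_gt0 // mulr1.
  by apply: ge0_ler_powR; rewrite ?subr_ge0 ?nnegrE // ltW.
rewrite avgD // => [|y]; last exact: ltW.
rewrite mulrDl mul1r EFinD leeD //.
  apply: le_trans (avg_cst z r0 (ltW M0)) _.
  by rewrite lee_fin mulrCA Mr.
rewrite avgZ ?powR_ge0 //; last by move=> y; rewrite powR_ge0.
rewrite Mp -[leRHS]mule1 lee_wpmul2l ?lee_fin ?powR_ge0 //.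
apply: le_trans gp; apply: ge0_le_integral => //.
- by move=> y _; rewrite lee_fin mulr_ge0 // powR_ge0.
- exact: measurable_avg_integrand1.
- exact/measurable_EFinP.
- by move=> y _; rewrite lee_fin ler_piMr ?powR_ge0 // indicE lern1 leq_b1.
Qed.

Lemma integral_avg_le r g : 0 < r -> measurable_fun setT g ->
  (forall y, 0 <= g y) ->
  (\int[mu]_z avg (B r) g z <= (C0 * r)%:E * \int[mu]_y (g y)%:E)%E.
Proof.
move=> r0 mg g0; have [mB _ B2] := BC r0.
have Cr0 : 0 <= C0 * r.
  rewrite -lee_fin; apply: le_trans (B2 point).
  by apply: integral_ge0 => y _; rewrite lee_fin.
rewrite (fubini_tonelli (fun x : T * T => (g x.2 * \1_(B r) x)%:E)); first last.
- by move=> x; rewrite lee_fin mulr_ge0.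
- exact: measurable_avg_integrand.
rewrite -ge0_integralZl_EFin //; first last.
- exact/measurable_EFinP.
- by move=> y _; rewrite lee_fin.
apply: ge0_le_integral => //.
- by move=> y _; apply: integral_ge0 => z _; rewrite lee_fin mulr_ge0.
- apply: (measurable_fun_fubini_tonelli_G (fun x : T * T => (g x.2 * \1_(B r) x)%:E)).
    exact: measurable_avg_integrand.
  by move=> x; rewrite lee_fin mulr_ge0.
- by apply: measurable_funeM; exact/measurable_EFinP.
- move=> y _; rewrite muleC.
  under eq_integral do rewrite /= EFinM.
  rewrite ge0_integralZl_EFin //.
  + by rewrite lee_wpmul2l // lee_fin.
  + apply/measurable_EFinP.
    exact: (measurableT_comp (measurable_indic mB) (pair2_measurable y)).
Qed.

End averages.

Section fatou_bound.
Context d (T : measurableType d) (R : realType).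
Variable mu : {measure set T -> \bar R}.

(** Fatou: the hypothesis puts [h] below the lower limit of the [U n]. *)
Lemma integral_le_of_eventually (h : T -> \bar R) (U : nat -> T -> \bar R) (C : \bar R) :
  measurable_fun setT h -> (forall n, measurable_fun setT (U n)) ->
  (forall z, 0 <= h z)%E -> (forall n z, 0 <= U n z)%E ->
  (forall z, exists n0, forall n, (n0 <= n)%N -> (h z <= U n z)%E) ->
  (forall n, \int[mu]_z U n z <= C)%E -> (\int[mu]_z h z <= C)%E.
Proof.
move=> mh mU h0 U0 hU UC.
have := @fatou _ _ _ mu setT measurableT U mU (fun n x _ => U0 n x).
move=> fat; apply: (@le_trans _ _ (\int[mu]_z limn_einf (U ^~ z))%E).
  apply: ge0_le_integral => //.
  - apply: (@emeasurable_fun_cvg _ _ _ _ (fun n z => einfs (U ^~ z) n)) => [n|z _].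
      exact: measurable_fun_einfs.
    by rewrite limn_einf_lim; exact: is_cvg_einfs.
  - move=> z _; have [n0 hn0] := hU z.
    rewrite limn_einf_lim; apply: lime_ge; first exact: is_cvg_einfs.
    exists n0 => // n /= n0n; apply/ereal_infP => _ [k nk <-].
    by apply: hn0; exact: leq_trans nk.
apply: (le_trans fat); rewrite limn_einf_lim.
apply: lime_le; first exact: is_cvg_einfs.
apply: nearW => n; apply: le_trans (UC n); apply: ereal_inf_lbound.
by exists n => /=.
Qed.

End fatou_bound.

Lemma lee_EFin_mul2l (R : realType) (c : R) (x y : \bar R) :
  0 <= c -> (x <= y)%E -> (c%:E * x <= c%:E * y)%E.
Proof. by move=> c0; apply: lee_wpmul2l; rewrite lee_fin. Qed.

(** * A Hardy-Littlewood-Sobolev inequality for ball families *)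

Section hls.
Context d (T : measurableType d) (R : realType).
Variable mu : {sigma_finite_measure set T -> \bar R}.
Implicit Types (g h : T -> R).
Context (C0 p q : R) (B : R -> set (T * T)).
Hypotheses (C00 : 0 < C0) (p1 : 1 < p) (pq : p < q) (BC : ball_family mu C0 B).

Let b := p^-1 - q^-1.
Let p0 : 0 < p. Proof. by rewrite (lt_trans _ p1). Qed.
Let q0 : 0 < q. Proof. by rewrite (lt_trans p0). Qed.
Let iq0 : 0 < q^-1. Proof. by rewrite invr_gt0. Qed.
Let b0 : 0 < b. Proof. by rewrite subr_gt0 ltf_pV2. Qed.

(** A dyadic Riesz potential of order [b] with respect to volume: in the continuous analogue the
    kernel is (volume of the ball through both points) to the power [b - 1]. *)
Definition fsum (b : R) N g z : \bar R :=
  (\sum_(i < 2 * N) (dyad N i `^ (b - 1))%:E * avg mu (B (dyad N i)) g z)%E.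

Let geo (x : R) := 2 `^ x / (2 `^ x - 1).
Let geo_gt0 x : 0 < x -> 0 < geo x.
Proof.
by move=> x0; rewrite divr_gt0 ?powR_gt0 // subr_gt0 powR2_gt1.
Qed.

Let K := C0 * geo b + (C0 + 1) * geo q^-1.
Let K0 : 0 < K.
Proof. by rewrite addr_gt0 // mulr_gt0 ?geo_gt0 // addr_gt0. Qed.

Let c := (2 * K) `^ q * 2 `^ p / K.
Let c0 : 0 < c.
Proof. by rewrite divr_gt0 // mulr_gt0 ?powR_gt0 // mulr_gt0. Qed.

(* The part of the sum at scales below the height-dependent threshold [w ^ -p],
   applied to the part of [g] above height [w]. *)
Let hsum N w g z : \bar R := (\sum_(i < 2 * N)
  (if (dyad N i <= w `^ (- p))%R then dyad N i `^ (b - 1) else 0)%:E *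
  avg mu (B (dyad N i)) (cut w g) z)%E.

Let mB r : 0 < r -> measurable (B r). Proof. by case/BC. Qed.

Lemma fsum_ge0 b' N g z : (forall y, 0 <= g y) -> (0 <= fsum b' N g z)%E.
Proof.
move=> g0; apply: sume_ge0 => i _.
by rewrite mule_ge0 ?avg_ge0 // lee_fin powR_ge0.
Qed.

Lemma measurable_fsum b' N g : measurable_fun setT g -> (forall y, 0 <= g y) ->
  measurable_fun setT (fsum b' N g).
Proof.
move=> mg g0; apply: emeasurable_sum => i; apply: measurable_funeM.
by apply: measurable_avg => //; apply: mB; exact: dyad_gt0.
Qed.

Let hsum_ge0 N w g z : (forall y, 0 <= g y) -> (0 <= hsum N w g z)%E.
Proof.
move=> g0; apply: sume_ge0 => i _; rewrite mule_ge0 //.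
  by rewrite lee_fin; case: ifP => // _; rewrite powR_ge0.
by apply: avg_ge0 => y; exact: cut_ge0.
Qed.

Let measurable_hsum N w g : measurable_fun setT g -> (forall y, 0 <= g y) ->
  measurable_fun setT (hsum N w g).
Proof.
move=> mg g0; apply: emeasurable_sum => i; apply: measurable_funeM.
apply: measurable_avg => //; first by apply: mB; exact: dyad_gt0.
  exact: measurable_cut.
by move=> y; exact: cut_ge0.
Qed.

Definition hls_cst := c * (C0 * geo b * geo (p - 1)).

Section normalized.
Variable g : T -> R.
Hypotheses (mg : measurable_fun setT g) (g0 : forall y, 0 <= g y)
  (gp : (\int[mu]_y (g y `^ p)%:E <= 1)%E).

Let fsum_fin N z : fsum b N g z \is a fin_num.
Proof.
rewrite /fsum sum_fin_num; apply/allP => /= x /mapP[i _ ->].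
rewrite fin_numM // ge0_fin_numE; last exact: avg_ge0.
apply: le_lt_trans (ltry _); apply: (avg_le_Lp BC _ _ p1) => //; exact: dyad_gt0.
Qed.

(** At scales up to [w^-p] the part of [g] below height [w] contributes [w r^b], while the part
    above is kept in [hsum]. At larger scales the [L^p] bound contributes [r^(-1/q)]. Both geometric
    sums are dominated by the threshold scale, where each equals [w^(p/q)] because
    [1 - p b = p / q]. *)
Let fsum_le N z w : 0 < w ->
  (fsum b N g z <= (K * w `^ (p / q))%:E + hsum N w g z)%E.
Proof.
move=> w0.
have wp0 : 0 < w `^ (- p) by rewrite powR_gt0.
pose lo i : R := if dyad N i <= w `^ (- p) then dyad N i `^ b else 0.
pose hi i : R := if w `^ (- p) < dyad N i then dyad N i `^ (- q^-1) else 0.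
have S1 : \sum_(i < 2 * N) (C0 * w * lo i + (C0 + 1) * hi i) <= K * w `^ (p / q).
  rewrite big_split /= -!mulr_sumr.
  have -> : K * w `^ (p / q) = C0 * w * (geo b * (w `^ (- p)) `^ b)
      + (C0 + 1) * (geo q^-1 * (w `^ (- p)) `^ (- q^-1)).
    have -> : (w `^ (- p)) `^ (- q^-1) = w `^ (p / q) by rewrite -powRrM mulrNN.
    have -> : (w `^ (- p)) `^ b = w `^ (p / q - 1).
      by rewrite -powRrM /b; congr (_ `^ _); field; rewrite !gt_eqF.
    rewrite -(mulr_powRB1 (ltW w0) (divr_gt0 p0 q0)) /K.
    by rewrite mulrDl; congr (_ + _); ring.
  rewrite lerD // ler_wpM2l ?mulr_ge0 ?addr_ge0 ?(ltW C00) ?(ltW w0) //.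
    by apply: sum_dyad_le => //; exact: ltW.
  exact: sum_dyad_gt.
apply: (@le_trans _ _ (\sum_(i < 2 * N) (C0 * w * lo i + (C0 + 1) * hi i)%:E
    + hsum N w g z)%E); last first.
  by rewrite leeD // sumEFin lee_fin.
rewrite /fsum /hsum -big_split /=; apply: lee_sum => i _.
have r0 := @dyad_gt0 R N i; rewrite /lo /hi; case: leP => h.
  rewrite mulr0 addr0.
  have := avg_le_cut BC z r0 w0 mg g0.
  move=> /(lee_EFin_mul2l (powR_ge0 (dyad N i) (b - 1))) /le_trans; apply.
  rewrite ge0_muleDr //; first last.
  - by apply: avg_ge0 => y; exact: cut_ge0.
  - by rewrite lee_fin !mulr_ge0 // ltW.
  rewrite leeD // -EFinM lee_fin -(mulr_powRB1 (ltW r0) b0).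
  by rewrite le_eqVlt; apply/orP; left; apply/eqP; ring.
rewrite mul0e adde0 mulr0 add0r.
have := avg_le_Lp BC z r0 p1 mg g0 gp.
move=> /(lee_EFin_mul2l (powR_ge0 (dyad N i) (b - 1))) /le_trans; apply.
rewrite -EFinM lee_fin mulrCA -powRD; last by rewrite (gt_eqF r0) implybT.
by rewrite (_ : b - 1 + _ = - q^-1) // /b; ring.
Qed.

(** If the potential has value [y], take a dyadic height [w] with [2 K w^(p/q)] comparable to [y]
    from below. Then [fsum_le] leaves [hsum >= K w^(p/q)], hence [y^q <= (2K)^q 2^p w^p <= c
    w^(p-p/q) hsum], which is where [c] comes from. Since [w] depends on the point, the right side
    sums over all dyadic heights. *)
Let fsum_powR_le N z : exists n0, forall J, (n0 <= J)%N ->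
  (fsum b N g z `^ q <= \sum_(j < 2 * J)
     (c * dyad J j `^ (p - p / q))%:E * hsum N (dyad J j) g z)%E.
Proof.
have term0 J j : (0 <= (c * dyad J j `^ (p - p / q))%:E * hsum N (dyad J j) g z)%E.
  by rewrite mule_ge0 ?hsum_ge0 // lee_fin mulr_ge0 ?powR_ge0 // ltW.
case: (boolP (fsum b N g z == 0%E)) => [/eqP ->|fn0].
  exists 0%N => J _; rewrite poweR0r ?(gt_eqF q0) //.
  by apply: sume_ge0 => j _.
have [y y0 Fy] : exists2 y : R, 0 < y & fsum b N g z = y%:E.
  exists (fine (fsum b N g z)); last by rewrite fineK.
  by rewrite fine_gt0 // -ge0_fin_numE ?fsum_ge0 // fsum_fin andbT lt0e fn0 fsum_ge0.
have K20 : 0 < 2 * K by rewrite mulr_gt0.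
have [n0 hn0] : exists n0, forall J, (n0 <= J)%N -> exists2 i, (i < 2 * J)%N &
    dyad J i < (y / (2 * K)) `^ (q / p) <= 2 * dyad J i.
  by apply: dyad_between; rewrite powR_gt0 // divr_gt0.
exists n0 => J /hn0[i iJ /andP[w1 w2]].
have w0 := @dyad_gt0 R J i; set w := dyad J i in w0 w1 w2 *.
have yE : y = 2 * K * ((y / (2 * K)) `^ (q / p)) `^ (p / q).
  rewrite -powRrM (_ : q / p * (p / q) = 1); last by field; rewrite !gt_eqF.
  by rewrite powRr1 ?divr_ge0 // ?ltW // mulrC divfK // gt_eqF.
have pq0 : 0 < p / q by rewrite divr_gt0.
have y1 : 2 * K * w `^ (p / q) <= y.
  by rewrite {1}yE ler_pM2l // powR_le ?powR_ge0 // ltW.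
have y2 : y `^ q <= (2 * K) `^ q * 2 `^ p * w `^ p.
  rewrite -mulrA -powRM // ?(ltW w0) //.
  have -> : (2 * w) `^ p = ((2 * w) `^ (p / q)) `^ q.
    by rewrite -powRrM divfK // gt_eqF.
  rewrite -powRM ?(ltW K20) ?powR_ge0 // powR_le ?(ltW y0) ?mulr_ge0 ?powR_ge0 ?(ltW K0) //.
  by rewrite {1}yE ler_pM2l // powR_le ?powR_ge0 // mulr_ge0 // ltW.
have Hw : ((K * w `^ (p / q))%:E <= hsum N w g z)%E.
  have := fsum_le N z w0; rewrite Fy -leeBlDl // -EFinB.
  apply: le_trans; rewrite lee_fin lerBrDl; apply: le_trans y1.
  by rewrite le_eqVlt; apply/orP; left; apply/eqP; ring.
rewrite (bigD1 (Ordinal iJ)) //= -/w.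
apply: (@le_trans _ _ ((c * w `^ (p - p / q))%:E * hsum N w g z)%E); last first.
  by rewrite leeDl // sume_ge0.
apply: (@le_trans _ _ ((c * w `^ (p - p / q))%:E * (K * w `^ (p / q))%:E)%E); last first.
  by rewrite lee_wpmul2l // lee_fin mulr_ge0 ?powR_ge0 // ltW.
rewrite Fy poweR_EFin -EFinM lee_fin; apply: (le_trans y2).
rewrite mulrACA -powRD; last by rewrite (gt_eqF w0) implybT.
by rewrite subrK /c divfK // gt_eqF.
Qed.

(** Tonelli replaces the ball integral at scale [r] by a factor [C0 r], and the sum of [r^b] up to
    the threshold [w^-p] is of order [w^(-p b)]. *)
Let integral_hsum_le N w : 0 < w ->
  (\int[mu]_z hsum N w g z <= (C0 * geo b * w `^ (- p * b))%:E *
     \int[mu]_y (cut w g y)%:E)%E.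
Proof.
move=> w0; have mc := measurable_cut w mg.
have cg0 y : 0 <= cut w g y by exact: cut_ge0.
have I0 : (0 <= \int[mu]_y (cut w g y)%:E)%E.
  by apply: integral_ge0 => y _; rewrite lee_fin.
rewrite /hsum ge0_integral_sum //; first last.
- move=> i z _; rewrite mule_ge0 ?avg_ge0 // lee_fin; case: ifP => // _.
  by rewrite powR_ge0.
- move=> i; apply: measurable_funeM.
  by apply: measurable_avg => //; apply: mB; exact: dyad_gt0.
apply: (@le_trans _ _ (\sum_(i < 2 * N) (C0 * (if (dyad N i <= w `^ (- p))%R
    then dyad N i `^ b else 0))%:E * \int[mu]_y (cut w g y)%:E)%E).
  apply: lee_sum => i _; have r0 := @dyad_gt0 R N i.
  rewrite ge0_integralZl_EFin //; first last.
  - by case: ifP => // _; rewrite powR_ge0.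
  - by apply: measurable_avg => //; apply: mB.
  - by move=> z _; exact: avg_ge0.
  case: ifP => _; last by rewrite mulr0 !mul0e.
  have := integral_avg_le BC r0 mc cg0.
  move=> /(lee_EFin_mul2l (powR_ge0 (dyad N i) (b - 1))) /le_trans; apply.
  rewrite muleA -EFinM.
  have -> // : dyad N i `^ (b - 1) * (C0 * dyad N i) = C0 * dyad N i `^ b.
  by rewrite -(mulr_powRB1 (ltW r0) b0); ring.
rewrite -ge0_sume_distrl; last first.
  move=> i _; rewrite lee_fin mulr_ge0 ?(ltW C00) //.
  by case: ifP => // _; rewrite powR_ge0.
rewrite lee_wpmul2r // sumEFin lee_fin -mulr_sumr -mulrA ler_pM2l //.
rewrite powRrM; apply: sum_dyad_le => //; exact: powR_ge0.
Qed.

(** The powers of the height combine to [w^(p - p/q - p b) = w^(p-1)]. Exchanging the sum over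
    heights with the integral, the sum of [w^(p-1)] over dyadic [w <= g y] is of order
    [(g y)^(p-1)], and the remaining factor [g y] restores [g^p]. This is a Marcinkiewicz argument
    with explicit truncations. *)
Lemma integral_fsum_normalized N : (\int[mu]_z (fsum b N g z `^ q) <= hls_cst%:E)%E.
Proof.
have p10 : 0 < p - 1 by rewrite subr_gt0.
have coef0 J j : 0 <= c * @dyad R J j `^ (p - p / q) by rewrite mulr_ge0 ?powR_ge0 // ltW.
apply: (integral_le_of_eventually _ _ _ _ (fsum_powR_le N)).
- exact: (measurableT_comp (measurable_poweR _)) (measurable_fsum _ _ mg g0).
- move=> J; apply: emeasurable_sum => j; apply: measurable_funeM.
  exact: measurable_hsum.
- by move=> z; exact: poweR_ge0.
- by move=> J z; apply: sume_ge0 => j _; rewrite mule_ge0 ?hsum_ge0 // lee_fin.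
move=> J; rewrite ge0_integral_sum //; first last.
- by move=> j z _; rewrite mule_ge0 ?hsum_ge0 // lee_fin.
- by move=> j; apply: measurable_funeM; exact: measurable_hsum.
pose k := c * (C0 * geo b).
have k0 : 0 <= k by rewrite mulr_ge0 ?(ltW c0) // mulr_ge0 ?(ltW C00) // ltW // geo_gt0.
apply: (@le_trans _ _ (\sum_(j < 2 * J) \int[mu]_y
    ((k * dyad J j `^ (p - 1)) * cut (dyad J j) g y)%:E)%E).
  apply: lee_sum => j _; have w0 := @dyad_gt0 R J j.
  rewrite ge0_integralZl_EFin //; first last.
  - exact: measurable_hsum.
  - by move=> z _; exact: hsum_ge0.
  apply: (le_trans (lee_EFin_mul2l (coef0 J j) (integral_hsum_le N w0))).
  under [leRHS]eq_integral do rewrite EFinM.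
  rewrite ge0_integralZl_EFin //; first last.
  - by rewrite mulr_ge0 ?powR_ge0.
  - by apply/measurable_EFinP; exact: measurable_cut.
  - by move=> y _; rewrite lee_fin cut_ge0.
  rewrite muleA -EFinM.
  have pE : p - 1 = (p - p / q) + (- p * b) by rewrite /b; field; rewrite !gt_eqF.
  have -> // : c * dyad J j `^ (p - p / q) * (C0 * geo b * dyad J j `^ (- p * b)) =
      k * dyad J j `^ (p - 1).
  rewrite pE [in RHS]powRD; last by rewrite (gt_eqF w0) implybT.
  by rewrite /k; ring.
rewrite -ge0_integral_sum //; first last.
- by move=> j y _; rewrite lee_fin mulr_ge0 ?cut_ge0 // mulr_ge0 ?powR_ge0.
- by move=> j; apply/measurable_EFinP; apply: measurable_funM => //; exact: measurable_cut.
rewrite /hls_cst mulrA -/k; have geo0 := ltW (geo_gt0 p10).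
apply: (@le_trans _ _ (\int[mu]_y ((k * geo (p - 1))%:E * (g y `^ p)%:E))%E).
  apply: ge0_le_integral => //.
  - by move=> y _; apply: sume_ge0 => j _; rewrite lee_fin mulr_ge0 ?cut_ge0 // mulr_ge0 ?powR_ge0.
  - apply: emeasurable_sum => j; apply/measurable_EFinP; apply: measurable_funM => //.
    exact: measurable_cut.
  - apply: measurable_funeM; apply/measurable_EFinP.
    exact: (measurableT_comp (measurable_powR _)).
  - move=> y _; rewrite sumEFin -EFinM lee_fin.
    have -> : \sum_(j < 2 * J) k * dyad J j `^ (p - 1) * cut (dyad J j) g y =
        k * g y * \sum_(j < 2 * J) (if dyad J j <= g y then dyad J j `^ (p - 1) else 0).
      rewrite mulr_sumr; apply: eq_bigr => j _; rewrite /cut; case: ifP => _.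
        by ring.
      by rewrite !mulr0.
    rewrite -(mulr_powRB1 (g0 y) p0) -mulrA -[leRHS]mulrA ler_wpM2l //.
    by rewrite mulrCA ler_wpM2l //; exact: sum_dyad_le.
rewrite ge0_integralZl_EFin //; first last.
- by rewrite mulr_ge0.
- by apply/measurable_EFinP; exact: (measurableT_comp (measurable_powR _)).
- by move=> y _; rewrite lee_fin powR_ge0.
by rewrite -[leRHS]mule1 lee_EFin_mul2l // mulr_ge0.
Qed.

End normalized.

Lemma hls_cst_ge0 : 0 <= hls_cst.
Proof.
apply/ltW/mulr_gt0 => //; apply: mulr_gt0; first exact: mulr_gt0 C00 (geo_gt0 b0).
by rewrite geo_gt0 // subr_gt0.
Qed.

Lemma integral_fsum_le N g X : 0 < X -> measurable_fun setT g ->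
  (forall y, 0 <= g y) -> (\int[mu]_y (g y `^ p)%:E <= (X `^ p)%:E)%E ->
  (\int[mu]_z (fsum b N g z `^ q) <= (hls_cst * X `^ q)%:E)%E.
Proof.
move=> X0 mg g0 gX.
pose h y := X^-1 * g y.
have iX0 : 0 <= X^-1 by rewrite invr_ge0 ltW.
have h0 y : 0 <= h y by rewrite mulr_ge0.
have mh : measurable_fun setT h by exact: measurable_funM.
have hp : (\int[mu]_y (h y `^ p)%:E <= 1)%E.
  under eq_integral do rewrite /h powRM // EFinM.
  rewrite ge0_integralZl_EFin ?powR_ge0 //; first last.
  - by apply/measurable_EFinP; exact: (measurableT_comp (measurable_powR _)).
  - by move=> y _; rewrite lee_fin powR_ge0.
  apply: (le_trans (lee_EFin_mul2l (powR_ge0 _ _) gX)).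
  by rewrite -EFinM -powRM ?(ltW X0) // mulVf ?gt_eqF // powR1.
have FE z : fsum b N g z = (X%:E * fsum b N h z)%E.
  rewrite /fsum ge0_sume_distrr => [|i _]; last first.
    by rewrite mule_ge0 ?avg_ge0 // lee_fin powR_ge0.
  apply: eq_bigr => i _; rewrite muleCA.
  rewrite -(avgZ _ _ (mB (dyad_gt0 _ _)) mh h0 (ltW X0)).
  congr (_ * avg _ _ _ _)%E; apply/funext => y.
  by rewrite /h mulrA mulfV ?mul1r // gt_eqF.
under eq_integral => z _ do rewrite FE poweRM ?lee_fin ?(ltW X0) ?fsum_ge0 //.
rewrite ge0_integralZl_EFin ?powR_ge0 //; first last.
- exact: (measurableT_comp (measurable_poweR _)) (measurable_fsum _ _ mh h0).
- by move=> z _; exact: poweR_ge0.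
rewrite mulrC EFinM lee_EFin_mul2l ?powR_ge0 //.
exact: integral_fsum_normalized.
Qed.

End hls.

(** * One-variable derivatives and flat functions *)

Section derive_wrappers.
Context {R : realType}.
Implicit Types (f g : R -> R) (s a b : R).

Lemma is_derive_add f g s a b : is_derive s 1 f a -> is_derive s 1 g b ->
  is_derive s 1 (fun t => f t + g t) (a + b).
Proof. by move=> fa gb; exact: is_deriveD. Qed.

Lemma is_derive_mul f g s a b : is_derive s 1 f a -> is_derive s 1 g b ->
  is_derive s 1 (fun t => f t * g t) (a * g s + f s * b).
Proof.
move=> fa gb; have h := is_deriveM fa gb.
rewrite (_ : (fun t => f t * g t) = f * g) //; apply: (is_derive_eq h).
by rewrite /GRing.scale /=; ring.
Qed.

Lemma is_derive_compose f g s a b : is_derive (g s) 1 f a -> is_derive s 1 g b ->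
  is_derive s 1 (fun t => f (g t)) (a * b).
Proof. by move=> fa gb; exact: is_derive1_comp. Qed.

Lemma is_derive_derivable f s a : is_derive s 1 f a -> derivable f s 1.
Proof. by case. Qed.

Lemma is_derive_derive1 f s a : is_derive s 1 f a -> f^`()%classic s = a.
Proof. by case=> _; rewrite derive1E. Qed.

Lemma is_derive_unique f s a b : is_derive s 1 f a -> is_derive s 1 f b -> a = b.
Proof. by move=> /is_derive_derive1 <- /is_derive_derive1 <-. Qed.

Lemma is_derive_continuous f s a : is_derive s 1 f a -> {for s, continuous f}.
Proof. by move=> /is_derive_derivable /derivable1_diffP /differentiable_continuous. Qed.

Lemma is_derive_0_of_square_bound f c : f 0 = 0 -> (forall h, `|f h| <= c * h ^+ 2) ->
  is_derive (0 : R) (1 : R) f 0.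
Proof.
move=> f0 fc.
have c0 : 0 <= c by have := fc 1; rewrite expr1n mulr1; exact: le_trans.
have L : h^-1 *: ((f \o shift 0) (h *: (1 : R)) - f 0) @[h --> 0^'] --> (0 : R).
  apply/cvgr0Pnorm_lt => e e0; near=> h.
  have h0 : h != 0 by near: h; exact: nbhs_dnbhs_neq.
  rewrite /= f0 subr0 addr0 /GRing.scale /= mulr1 normrM normfV.
  rewrite mulrC ltr_pdivrMr ?normr_gt0 //; apply: (le_lt_trans (fc h)).
  rewrite -(real_normK (num_real h)) expr2 mulrA ltr_pM2r ?normr_gt0 //.
  apply: le_lt_trans (_ : (c + 1) * `|h| < e); first by rewrite ler_wpM2r // lerDl.
  rewrite mulrC -ltr_pdivlMr; last by rewrite ltr_wpDl.
  near: h; apply: dnbhs0_lt; by rewrite divr_gt0 // ltr_wpDl.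
by apply: DeriveDef; [apply/cvg_ex; exists 0|exact/cvg_lim].
Unshelve. all: by end_near. Qed.

End derive_wrappers.

Section flat_functions.
Context {R : realType}.

(** The functions [x^-m exp(-1/x)], extended by zero. The whole family in [m] is kept because
    derivatives of its members are combinations of its members, also at the origin. *)
Definition flat (m : nat) (x : R) : R :=
  if 0 < x then x^-1 ^+ m * expR (- x^-1) else 0.

Lemma flat_ge0 m x : 0 <= flat m x.
Proof.
by rewrite /flat; case: ifP => // x0; rewrite mulr_ge0 ?expR_ge0 // exprn_ge0 // invr_ge0 ltW.
Qed.

Lemma flat_gt0 m x : 0 < x -> 0 < flat m x.
Proof. by move=> x0; rewrite /flat x0 mulr_gt0 ?expR_gt0 // exprn_gt0 // invr_gt0. Qed.

Lemma flat_le0 m x : x <= 0 -> flat m x = 0.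
Proof. by rewrite /flat leNgt => /negPf ->. Qed.

Lemma exprn_expRN_le m (y : R) : 0 <= y -> y ^+ m * expR (- y) <= (m ^ m)%:R.
Proof.
move=> y0; case: m => [|m].
  by rewrite expr0 mul1r expn0 -[leRHS]expR0 ler_expR oppr_le0.
have m0 : 0 < m.+1%:R :> R by [].
rewrite expRN ler_pdivrMr ?expR_gt0 //.
have -> : y = m.+1%:R * (y / m.+1%:R) by field; rewrite gt_eqF.
(* This is the [m]-th power of the inequality [y / m <= exp (y / m)]. *)
rewrite expRM_natl exprMn natrX ler_wpM2l ?exprn_ge0 //.
apply: lerXn2r; rewrite ?nnegrE ?expR_ge0 ?divr_ge0 //.
by apply: le_trans (expR_ge1Dx _); rewrite lerDr.
Qed.

Lemma flat_bounded m x : `|flat m x| <= (m ^ m)%:R.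
Proof.
rewrite ger0_norm ?flat_ge0 // /flat; case: ifP => [x0|_]; last by rewrite ler0n.
by apply: exprn_expRN_le; rewrite invr_ge0 ltW.
Qed.

Lemma is_derive_flat m (x : R) : is_derive x 1 (flat m) (flat m.+2 x - m%:R * flat m.+1 x).
Proof.
have [x0|x0|->] := ltgtP x 0.
- rewrite !flat_le0 ?ltW // mulr0 subr0.
  have h : is_derive x 1 (cst 0 : R -> R) 0 by exact: is_derive_cst.
  apply: near_eq_is_derive h.
  near=> t; rewrite flat_le0 //; apply: ltW; near: t; exact: lt_nbhsl.
- have D : is_derive x 1 (fun t : R => t^-1 ^+ m * expR (- t^-1))
      (flat m.+2 x - m%:R * flat m.+1 x).
    have xn0 : x != 0 by rewrite gt_eqF.
    have iD : is_derive x 1 (fun t : R => t^-1) (- x ^- 2).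
      by apply: is_derive_eq; [exact: is_deriveV|rewrite /GRing.scale /= mulr1].
    have eD : is_derive x 1 (fun t : R => expR (- t^-1)) (expR (- x^-1) * - - x ^- 2).
      by apply: is_derive_compose => //; exact: is_deriveN.
    have pD : is_derive x 1 (fun t : R => t^-1 ^+ m) ((m%:R * x^-1 ^+ m.-1) * - x ^- 2).
      have h := is_deriveX m iD.
      have E : (fun t : R => t^-1 ^+ m) = (fun t => t^-1) ^+ m by rewrite exprfctE.
      by rewrite E; exact: (is_derive_eq h).
    apply: (is_derive_eq (is_derive_mul pD eD)).
    rewrite /flat x0; case: m {pD} => [|m] /=; first by rewrite !mul0r; field.
    by rewrite !exprS; field.
  apply: near_eq_is_derive D.
  near=> t; rewrite /flat ifT //; near: t; exact: lt_nbhsr.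
- rewrite !flat_le0 // mulr0 subr0.
  (* At the origin, [flat m h = h^2 * flat m.+2 h] and [flat m.+2] is bounded, so [flat m] vanishes
     quadratically there. *)
  apply: (@is_derive_0_of_square_bound _ _ (m.+2 ^ m.+2)%:R); first by rewrite flat_le0.
  move=> h; have [h0|h0] := leP h 0; first by rewrite flat_le0 // normr0 mulr_ge0 // sqr_ge0.
  have := flat_bounded m.+2 h; rewrite -(ler_pM2r (exprn_gt0 2 h0)); apply: le_trans.
  rewrite !ger0_norm ?flat_ge0 // /flat h0 !exprS le_eqVlt; apply/orP; left; apply/eqP.
  by field; rewrite gt_eqF.
Unshelve. all: by end_near. Qed.

End flat_functions.

(** * A syntactic class of smooth functions and its calculus *)

Section smooth_class.
Context {R : realType}.

(* A class of smooth functions that is visibly closed under differentiation: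
   [flat m] differentiates into a combination of [flat m.+1] and [flat m.+2]. *)
Inductive sm n : (n.-tuple R -> R) -> Prop :=
| sm_cst c : sm (fun=> c)
| sm_coord k : sm (fun z => nth 0 z k)
| sm_add f g : sm f -> sm g -> sm (fun z => f z + g z)
| sm_mul f g : sm f -> sm g -> sm (fun z => f z * g z)
| sm_flat m f : sm f -> sm (fun z => flat m (f z)).

Lemma sm_eq n (f g : n.-tuple R -> R) : f =1 g -> sm f -> sm g.
Proof. by move=> /funext ->. Qed.

Lemma sm_opp n (f : n.-tuple R -> R) : sm f -> sm (fun z => - f z).
Proof.
by move=> sf; apply: (sm_eq _ (sm_mul (sm_cst _ (-1)) sf)) => z; rewrite mulN1r.
Qed.

Lemma sm_sub n (f g : n.-tuple R -> R) : sm f -> sm g -> sm (fun z => f z - g z).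
Proof. by move=> sf sg; apply: sm_add => //; exact: sm_opp. Qed.

Lemma sm_sum n (I : Type) (r : seq I) (f : I -> n.-tuple R -> R) :
  (forall i, sm (f i)) -> sm (fun z => \sum_(i <- r) f i z).
Proof.
move=> sf; elim: r => [|i r IH].
  by apply: (sm_eq _ (sm_cst _ 0)) => z; rewrite big_nil.
by apply: (sm_eq _ (sm_add (sf i) IH)) => z; rewrite big_cons.
Qed.

Lemma sm_prod n (I : Type) (r : seq I) (f : I -> n.-tuple R -> R) :
  (forall i, sm (f i)) -> sm (fun z => \prod_(i <- r) f i z).
Proof.
move=> sf; elim: r => [|i r IH].
  by apply: (sm_eq _ (sm_cst _ 1)) => z; rewrite big_nil.
by apply: (sm_eq _ (sm_mul (sf i) IH)) => z; rewrite big_cons.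
Qed.

Lemma sm_comp m n (L : m.-tuple R -> n.-tuple R) f :
  (forall k, sm (fun z => nth 0 (L z) k)) -> sm f -> sm (fun z => f (L z)).
Proof.
move=> sL; elim=> [c|k|{}f g _ IHf _ IHg|{}f g _ IHf _ IHg|k {}f _ IHf].
- exact: sm_cst.
- exact: sL.
- exact: sm_add.
- exact: sm_mul.
- exact: sm_flat.
Qed.

Lemma measurable_flat m : measurable_fun setT (@flat R m).
Proof.
apply: continuous_measurable_fun => x.
exact: is_derive_continuous (is_derive_flat m x).
Qed.

Lemma measurable_sm n (f : n.-tuple R -> R) : sm f -> measurable_fun setT f.
Proof.
elim=> [c|k|{}f g _ IHf _ IHg|{}f g _ IHf _ IHg|k {}f _ IHf].
- exact: measurable_cst.
- exact: measurable_nth.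
- exact: measurable_funD.
- exact: measurable_funM.
- exact: (measurableT_comp (measurable_flat k)).
Qed.

Lemma sm_bounded n (f : n.-tuple R -> R) (M : R) : sm f ->
  exists2 C, 0 <= C & forall z : n.-tuple R,
    (forall j, `|tnth z j| <= M) -> `|f z| <= C.
Proof.
elim=> [c|k|{}f g _ [C C0 fC] _ [D D0 gD]|{}f g _ [C C0 fC] _ [D D0 gD]|k {}f _ _].
- by exists `|c|.
- exists (Num.max 0 M) => [|z zM]; first by rewrite le_max lexx.
  case: (ltnP k n) => [kn|nk]; last by rewrite nth_default ?size_tuple // normr0 le_max lexx.
  by rewrite -(tnth_nth 0 z (Ordinal kn)) le_max zM orbT.
- exists (C + D) => [|z zM]; first exact: addr_ge0.
  by apply: (le_trans (ler_normD _ _)); rewrite lerD ?fC ?gD.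
- exists (C * D) => [|z zM]; first exact: mulr_ge0.
  by rewrite normrM ler_pM ?fC ?gD.
- by exists (k ^ k)%:R => // z _; exact: flat_bounded.
Qed.

Lemma nth_shift n (z : n.-tuple R) k (s : R) j : (j < n)%N ->
  nth 0 (Defs.shift z k s) j = nth 0 z j + (if j == k then s else 0).
Proof.
move=> jn; rewrite -(tnth_nth 0 (Defs.shift z k s) (Ordinal jn)) tnth_mktuple.
by rewrite (tnth_nth 0) /=; case: ifP => //; rewrite addr0.
Qed.

Lemma tuple_eq_nth n (z w : n.-tuple R) :
  (forall j, (j < n)%N -> nth 0 z j = nth 0 w j) -> z = w.
Proof. by move=> zw; apply: eq_from_tnth => i; rewrite !(tnth_nth 0) zw. Qed.

Lemma shift0 n (z : n.-tuple R) k : Defs.shift z k 0 = z.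
Proof. by apply: tuple_eq_nth => j jn; rewrite nth_shift // if_same addr0. Qed.

Lemma shift_out n (z : n.-tuple R) k s : (n <= k)%N -> Defs.shift z k s = z.
Proof.
move=> nk; apply: tuple_eq_nth => j jn; rewrite nth_shift //.
by rewrite ltn_eqF ?addr0 // (leq_trans jn).
Qed.

Lemma is_derive_const (c s : R) : is_derive s 1 (fun _ : R => c) 0.
Proof. exact: is_derive_cst. Qed.

(** The chain rule along arbitrary curves is proved together with the existence of the partial
    derivatives inside the class. Quantifying over curves lets the induction pass through sums,
    products and [flat] by one-variable calculus alone; coordinate lines then identify [D] with
    [partial], and the dilation flow uses the general form. *)
Let chain n (f : n.-tuple R -> R) : sm f ->
  exists2 D : nat -> n.-tuple R -> R, forall k, sm (D k) &
    forall (c : R -> n.-tuple R) (s : R) (c' : nat -> R),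
      (forall k, (k < n)%N -> is_derive s 1 (fun t => nth 0 (c t) k) (c' k)) ->
      is_derive s 1 (fun t => f (c t)) (\sum_(k < n) c' k * D k (c s)).
Proof.
elim=> [a|k|{}f g _ [D sD fD] _ [E sE gE]|{}f g sf [D sD fD] sg [E sE gE]|m {}f sf [D sD fD]].
- exists (fun _ _ => 0) => [k|c s c' _]; first exact: sm_cst.
  have -> : \sum_(k < n) c' k * 0 = 0 by rewrite big1 // => i _; rewrite mulr0.
  exact: is_derive_const.
- exists (fun j _ => (j == k)%:R) => [j|c s c' cc']; first exact: sm_cst.
  case: (ltnP k n) => [kn|nk].
    rewrite (bigD1 (Ordinal kn)) //= eqxx mulr1 big1 ?addr0; first exact: cc'.
    by move=> i; rewrite -val_eqE /= => /negPf ->; rewrite mulr0.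
  rewrite (_ : (fun t => _) = fun=> 0); last first.
    by apply/funext => t; rewrite nth_default ?size_tuple.
  have -> : \sum_(j < n) c' j * ((j : nat) == k)%:R = 0.
    by rewrite big1 // => i _; rewrite ltn_eqF ?mulr0 // (leq_trans _ nk).
  exact: is_derive_const.
- exists (fun k z => D k z + E k z) => [k|c s c' cc']; first exact: sm_add.
  under eq_bigr do rewrite mulrDr.
  rewrite big_split; exact: (is_derive_add (fD _ _ _ cc') (gE _ _ _ cc')).
- exists (fun k z => D k z * g z + f z * E k z) => [k|c s c' cc'].
    by apply: sm_add; apply: sm_mul.
  apply: (is_derive_eq (is_derive_mul (fD _ _ _ cc') (gE _ _ _ cc'))).
  rewrite mulr_suml mulr_sumr -big_split /=; apply: eq_bigr => i _; ring.
- exists (fun k z => (flat m.+2 (f z) - m%:R * flat m.+1 (f z)) * D k z) => [k|c s c' cc'].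
    apply: sm_mul => //; apply: sm_sub; first exact: sm_flat.
    by apply: sm_mul; [exact: sm_cst|exact: sm_flat].
  apply: (is_derive_eq (is_derive_compose (is_derive_flat m _) (fD _ _ _ cc'))).
  by rewrite mulr_sumr; apply: eq_bigr => i _; ring.
Qed.

Let shift_curve n (z : n.-tuple R) k (s : R) j : (j < n)%N ->
  is_derive s 1 (fun t => nth 0 (Defs.shift z k t) j) ((j == k)%:R).
Proof.
move=> jn; under eq_fun do rewrite nth_shift //.
have h : is_derive s 1 (fun t : R => if j == k then t else 0) (j == k)%:R.
  by case: eqP => _; [exact: is_derive_id|exact: is_derive_const].
by apply: (is_derive_eq (is_derive_add (is_derive_const _ _) h)); rewrite add0r.
Qed.

Let chain_shift n (f : n.-tuple R -> R) (D : nat -> n.-tuple R -> R) k z (s : R) :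
  (forall (c : R -> n.-tuple R) (s : R) (c' : nat -> R),
      (forall k, (k < n)%N -> is_derive s 1 (fun t => nth 0 (c t) k) (c' k)) ->
      is_derive s 1 (fun t => f (c t)) (\sum_(k < n) c' k * D k (c s))) ->
  (k < n)%N ->
  is_derive s 1 (fun t => f (Defs.shift z k t)) (D k (Defs.shift z k s)).
Proof.
move=> fD kn.
have := fD _ s _ (fun j => @shift_curve n z k s j).
rewrite (bigD1 (Ordinal kn)) //= eqxx mul1r big1 ?addr0 //.
by move=> i; rewrite -val_eqE /= => /negPf ->; rewrite mul0r.
Qed.

Let partial_out n (f : n.-tuple R -> R) k z : (n <= k)%N -> partial k f z = 0.
Proof.
move=> nk; apply: is_derive_derive1; under eq_fun do rewrite shift_out //.
exact: is_derive_const.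
Qed.

Let sm_partial_chain n (f : n.-tuple R -> R) : sm f ->
  (forall k, sm (partial k f)) /\
  forall (c : R -> n.-tuple R) (s : R) (c' : nat -> R),
    (forall k, (k < n)%N -> is_derive s 1 (fun t => nth 0 (c t) k) (c' k)) ->
    is_derive s 1 (fun t => f (c t)) (\sum_(k < n) c' k * partial k f (c s)).
Proof.
move=> /chain[D sD fD].
have DE k z : (k < n)%N -> partial k f z = D k z.
  move=> kn; rewrite -[in RHS](shift0 z k); apply: is_derive_derive1.
  exact: chain_shift.
split=> [k|c s c' cc'].
  case: (ltnP k n) => [kn|nk].
    by apply: (sm_eq _ (sD k)) => z; rewrite DE.
  by apply: (sm_eq _ (sm_cst _ 0)) => z; rewrite partial_out.
by under eq_bigr do rewrite DE //; exact: fD.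
Qed.

Lemma sm_partial n k (f : n.-tuple R -> R) : sm f -> sm (partial k f).
Proof. by move=> /sm_partial_chain[]. Qed.

Lemma sm_chain n (f : n.-tuple R -> R) (c : R -> n.-tuple R) (s : R) (c' : nat -> R) :
  sm f ->
  (forall k, (k < n)%N -> is_derive s 1 (fun t => nth 0 (c t) k) (c' k)) ->
  is_derive s 1 (fun t => f (c t)) (\sum_(k < n) c' k * partial k f (c s)).
Proof. by move=> /sm_partial_chain[_]; apply. Qed.

Lemma is_derive_shift_sm n k (f : n.-tuple R -> R) z (s : R) : sm f ->
  is_derive s 1 (fun t => f (Defs.shift z k t)) (partial k f (Defs.shift z k s)).
Proof.
move=> sf; case: (ltnP k n) => [kn|nk]; last first.
  rewrite partial_out //; under eq_fun do rewrite shift_out //.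
  exact: is_derive_const.
apply: (@chain_shift n f (fun k => partial k f) k z s) => // c t c' cc'.
exact: sm_chain.
Qed.

Lemma is_derive_partial n k (f : n.-tuple R -> R) z : sm f ->
  is_derive (0 : R) (1 : R) (fun t => f (Defs.shift z k t)) (partial k f z).
Proof. by move=> /(is_derive_shift_sm k z 0); rewrite shift0. Qed.

Lemma partial_cst n k c (z : n.-tuple R) : partial k (fun=> c) z = 0.
Proof. exact: is_derive_derive1 (is_derive_const _ _). Qed.

Lemma partial_coord n k j (z : n.-tuple R) : (j < n)%N ->
  partial k (fun z => nth 0 z j) z = (j == k)%:R.
Proof. by move=> jn; exact: is_derive_derive1 (shift_curve z k 0 jn). Qed.

Lemma partialD n k (f g : n.-tuple R -> R) z : sm f -> sm g ->
  partial k (fun z => f z + g z) z = partial k f z + partial k g z.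
Proof.
move=> sf sg; apply: is_derive_derive1.
exact: (is_derive_add (is_derive_partial k z sf) (is_derive_partial k z sg)).
Qed.

Lemma partialM n k (f g : n.-tuple R -> R) z : sm f -> sm g ->
  partial k (fun z => f z * g z) z = partial k f z * g z + f z * partial k g z.
Proof.
move=> sf sg; apply: is_derive_derive1.
by have := is_derive_mul (is_derive_partial k z sf) (is_derive_partial k z sg);
  rewrite !shift0.
Qed.

Lemma partialB n k (f g : n.-tuple R -> R) z : sm f -> sm g ->
  partial k (fun z => f z - g z) z = partial k f z - partial k g z.
Proof.
move=> sf sg; rewrite partialD //; last exact: sm_opp.
congr (_ + _); rewrite (_ : (fun z => - g z) = fun z => -1 * g z).
  by rewrite partialM ?partial_cst //; [ring|exact: sm_cst].
by apply/funext => w; rewrite mulN1r.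
Qed.

Lemma partial_sum n k (I : Type) (r : seq I) (f : I -> n.-tuple R -> R) z :
  (forall i, sm (f i)) ->
  partial k (fun z => \sum_(i <- r) f i z) z = \sum_(i <- r) partial k (f i) z.
Proof.
move=> sf; elim: r => [|i r IH].
  rewrite big_nil -[RHS](@partial_cst n k 0 z); congr (partial _ _ z).
  by apply/funext => w; rewrite big_nil.
rewrite big_cons -IH -partialD //; last exact: sm_sum.
by congr (partial _ _ z); apply/funext => w; rewrite big_cons.
Qed.

Lemma partial_flat n k m (f : n.-tuple R -> R) z : sm f ->
  partial k (fun z => flat m (f z)) z =
  (flat m.+2 (f z) - m%:R * flat m.+1 (f z)) * partial k f z.
Proof.
move=> sf; apply: is_derive_derive1.
by have := is_derive_compose (is_derive_flat m _) (is_derive_partial k z sf);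
  rewrite !shift0.
Qed.

(** Equality of mixed derivatives by induction on the class; for [flat] the second derivative is
    computed explicitly and is visibly symmetric in the two directions. *)
Lemma partialC n i j (f : n.-tuple R -> R) z : sm f ->
  partial i (partial j f) z = partial j (partial i f) z.
Proof.
move=> sf; elim: sf z => {f} [c|k|f g sf IHf sg IHg|f g sf IHf sg IHg|m f sf IHf] z.
- have E l : partial l (fun _ : n.-tuple R => c) = fun=> 0.
    by apply/funext => w; exact: partial_cst.
  by rewrite !E !partial_cst.
- have E l : exists a, partial l (fun z : n.-tuple R => nth 0 z k) = fun=> a.
    case: (ltnP k n) => [kn|nk].
      by exists (k == l)%:R; apply/funext => w; rewrite partial_coord.
    exists 0; apply/funext => w; rewrite -[RHS](@partial_cst n l 0 w).
    by congr (partial _ _ w); apply/funext => u; rewrite nth_default ?size_tuple.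
  have [a ->] := E i; have [b ->] := E j; by rewrite !partial_cst.
- have E l : partial l (fun z => f z + g z) = fun z => partial l f z + partial l g z.
    by apply/funext => w; rewrite partialD.
  by rewrite !E !partialD ?IHf ?IHg //; exact: sm_partial.
- have E l : partial l (fun z => f z * g z) =
      fun z => partial l f z * g z + f z * partial l g z.
    by apply/funext => w; rewrite partialM.
  rewrite !E !partialD; try by apply: sm_mul => //; exact: sm_partial.
  rewrite (partialM i z (sm_partial j sf) sg) (partialM i z sf (sm_partial j sg)).
  rewrite (partialM j z (sm_partial i sf) sg) (partialM j z sf (sm_partial i sg)).
  by rewrite IHf IHg addrACA.
- have E l : partial l (fun z => flat m (f z)) =
      fun z => (flat m.+2 (f z) - m%:R * flat m.+1 (f z)) * partial l f z.
    by apply/funext => w; rewrite partial_flat.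
  have sB : sm (fun z => flat m.+2 (f z) - m%:R * flat m.+1 (f z)).
    apply: sm_sub; first exact: sm_flat.
    by apply: sm_mul; [exact: sm_cst|exact: sm_flat].
  have BE l w : partial l (fun z => flat m.+2 (f z) - m%:R * flat m.+1 (f z)) w =
      (flat m.+4 (f w) - m.+2%:R * flat m.+3 (f w) -
       m%:R * (flat m.+3 (f w) - m.+1%:R * flat m.+2 (f w))) * partial l f w.
    rewrite partialB; [|exact: sm_flat|by apply: sm_mul; [exact: sm_cst|exact: sm_flat]].
    rewrite (partialM l w (sm_cst n m%:R) (sm_flat m.+1 sf)) partial_cst.
    by rewrite (partial_flat l m.+2 w sf) (partial_flat l m.+1 w sf); move: (partial l f w) => a; ring.
  rewrite !E (partialM i z sB (sm_partial j sf)) (partialM j z sB (sm_partial i sf)).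
  rewrite !BE IHf; move: (partial i f z) (partial j f z) => a b.
  by move: (partial j (partial i f) z) => c; ring.
Qed.

End smooth_class.

(** * Members of the class with bounded support are test functions *)

Section test_functions.
Context {R : realType}.

(** The neighbourhood filter hidden in [tcont], made explicit so that limit rules for sums, products
    and compositions apply. *)
Definition tnbhs n (z : n.-tuple R) : set_system (n.-tuple R) :=
  [set A | exists2 del : R, 0 < del &
    forall w, (forall j, `|tnth w j - tnth z j| < del) -> A w].

Lemma tnbhs_filter n (z : n.-tuple R) : Filter (tnbhs z).
Proof.
split=> [|A B [d d0 dA] [e e0 eB]|A B AB [d d0 dA]].
- by exists 1.
- exists (Num.min d e); first by rewrite lt_min d0.
  move=> w wz; split; [apply: dA => j|apply: eB => j];
    by apply: (lt_le_trans (wz j)); rewrite ge_min lexx ?orbT.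
- by exists d => // w /dA /AB.
Qed.
#[local] Existing Instance tnbhs_filter.

Lemma tcontP n (f : n.-tuple R -> R) : tcont f <-> forall z, f @ tnbhs z --> f z.
Proof.
split=> [fc z|fc z e e0].
  apply/cvgrPdist_lt => e e0; have [d d0 dz] := fc z e e0.
  by exists d => // w wz; rewrite distrC; exact: dz.
have /cvgrPdist_lt /(_ e e0) [d d0 dz] := fc z.
by exists d => // w wz; rewrite distrC; exact: dz.
Qed.

Lemma tcont_sm n (f : n.-tuple R -> R) : sm f -> tcont f.
Proof.
move=> sf; apply/tcontP => z.
elim: sf => [c|k|{}f g _ IHf _ IHg|{}f g _ IHf _ IHg|m {}f _ IHf].
- exact: cvg_cst.
- apply/cvgrPdist_lt => e e0; exists e => // w wz.
  case: (ltnP k n) => [kn|nk]; last by rewrite !nth_default ?size_tuple // subrr normr0.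
  by have := wz (Ordinal kn); rewrite !(tnth_nth 0) distrC.
- exact: cvgD.
- exact: cvgM.
- apply: cvg_comp IHf _.
  exact: (is_derive_continuous (is_derive_flat m (f z))).
Qed.

Definition supported n (M : R) (f : n.-tuple R -> R) :=
  forall z, (exists j, M < `|tnth z j|) -> f z = 0.

Lemma supported_partial n M k (f : n.-tuple R -> R) :
  supported M f -> supported M (partial k f).
Proof.
move=> sf z [j Mj]; apply: is_derive_derive1.
have h : is_derive (0 : R) (1 : R) (cst 0 : R -> R) 0 by exact: is_derive_cst.
apply: near_eq_is_derive h; near=> s.
rewrite sf //; exists j.
rewrite (tnth_nth 0) nth_shift //.
have sM : `|s| < `|tnth z j| - M.
  near: s; apply/nbhs_ballP; exists (`|tnth z j| - M); rewrite /= ?subr_gt0 //.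
  by move=> x; rewrite /ball /= sub0r normrN.
rewrite -(tnth_nth 0 z j); case: ifP => _; last by rewrite addr0.
have := lerB_normD (tnth z j) s.
by apply: lt_le_trans; rewrite ltrBrDr -ltrBrDl.
Unshelve. all: by end_near. Qed.

Lemma sm_test_fun n M (f : n.-tuple R -> R) : sm f -> supported M f -> test_fun f.
Proof.
move=> sf Mf; split; first by exists M.
have sd ks : sm (dpart ks f) by elim: ks => //= k ks IH; exact: sm_partial.
move=> ks; split=> [|k z _]; first exact: tcont_sm.
exact: is_derive_derivable (is_derive_partial k z (sd ks)).
Qed.

Lemma supported_bounded n M (f : n.-tuple R -> R) : sm f -> supported M f ->
  exists2 C, 0 <= C & forall z, `|f z| <= C.
Proof.
move=> sf Mf; have [C C0 fC] := sm_bounded M sf; exists C => // z.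
case: (pselect (exists j, M < `|tnth z j|)) => [/Mf ->|nM]; first by rewrite normr0.
by apply: fC => j; rewrite leNgt; apply/negP => Mj; apply: nM; exists j.
Qed.

End test_functions.

(** * A normalized one-dimensional bump *)

Section bump.
Context {R : realType}.
Local Notation leb := (@lebesgue_measure R).

Lemma measurable_EFin_line (f : R -> R) : measurable_fun setT f ->
  measurable_fun [set: measurableTypeR R] (fun x => (f x)%:E).
Proof. exact: (measurableT_comp (@EFin_measurable R _)). Qed.

Lemma integral_indic_itv (a b : R) : a <= b ->
  (\int[leb]_x (\1_`[a, b] x)%:E = (b - a)%:E)%E.
Proof.
move=> ab; rewrite integral_indic // setIT.
apply: (etrans (lebesgue_measure_itv `[a, b])); rewrite /= lte_fin -EFinB.
by case: ltP => // ba; rewrite (@le_anti _ _ a b) ?subrr // ab ba.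
Qed.

Let bump0 (x : R) : R := flat 0 (1 + x) * flat 0 (1 - x).

Let bump0_ge0 x : 0 <= bump0 x.
Proof. by rewrite mulr_ge0 // flat_ge0. Qed.

Let bump0_out x : 1 < `|x| -> bump0 x = 0.
Proof.
rewrite /bump0 lter_normr => /orP[] h; last by rewrite flat_le0 ?mul0r //; lra.
by rewrite [X in _ * X]flat_le0 ?mulr0 //; lra.
Qed.

Let bump0_le1 x : bump0 x <= 1.
Proof.
have f1 (y : R) : 0 <= flat 0 y <= 1.
  by rewrite flat_ge0 /=; have := flat_bounded 0 y; rewrite ger0_norm ?flat_ge0.
have /andP[a0 a1] := f1 (1 + x); have /andP[b0 b1] := f1 (1 - x).
by rewrite -[leRHS]mulr1 ler_pM.
Qed.

Let bump0_ge x : `|x| <= 2^-1 -> expR (- 2) ^+ 2 <= bump0 x.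
Proof.
have f2 (y : R) : 2^-1 <= y -> expR (- 2) <= flat 0 y.
  move=> y2; have y0 : 0 < y by apply: lt_le_trans y2.
  rewrite /flat y0 expr0 mul1r ler_expR lerN2 -[leRHS]invrK.
  by rewrite lef_pV2 ?posrE ?invr_gt0.
rewrite ler_norml => /andP[x1 x2]; rewrite expr2 /bump0.
by rewrite ler_pM ?expR_ge0 // f2 //; lra.
Qed.

Let continuous_bump0 : continuous bump0.
Proof.
move=> x; have D1 : is_derive x 1 (fun t : R => 1 + t) (0 + 1).
  exact: (is_derive_add (is_derive_const 1 x) (is_derive_id x 1)).
have D2 : is_derive x 1 (fun t : R => 1 - t) (0 + -1).
  exact: (is_derive_add (is_derive_const 1 x) (is_deriveNid x 1)).
have := is_derive_mul (is_derive_compose (is_derive_flat 0 _) D1)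
  (is_derive_compose (is_derive_flat 0 _) D2).
exact: is_derive_continuous.
Qed.

Let measurable_bump0 : measurable_fun setT bump0.
Proof. exact: continuous_measurable_fun. Qed.

Let I0 := (\int[leb]_x (bump0 x)%:E)%E.

Let I0_gt0 : (0 < I0)%E.
Proof.
have e0 : 0 < expR (- 2) ^+ 2 :> R by rewrite exprn_gt0 // expR_gt0.
apply: (@lt_le_trans _ _ (\int[leb]_x ((expR (- 2) ^+ 2)%:E * (\1_`[- 2^-1, 2^-1] x)%:E))%E).
  rewrite ge0_integralZl_EFin ?(ltW e0) //; first last.
    by apply: measurable_EFin_line; exact: measurable_indic.
  rewrite integral_indic_itv; last by lra.
  by rewrite -EFinM lte_fin mulr_gt0 //; lra.
apply: ge0_le_integral => //.
- by apply: measurable_funeM; apply: measurable_EFin_line; exact: measurable_indic.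
- exact: measurable_EFin_line.
- move=> x _; rewrite -EFinM lee_fin indicE; case: (boolP (_ \in _)) => [|_]; last first.
    by rewrite mulr0.
  by rewrite inE /= in_itv /= mulr1 => h; apply: bump0_ge; rewrite ler_norml.
Qed.

Let I0_lty : (I0 < +oo)%E.
Proof.
apply: (@le_lt_trans _ _ (\int[leb]_x (\1_`[- 1, 1] x)%:E)%E).
  apply: ge0_le_integral => //.
  - by move=> x _; rewrite lee_fin.
  - exact: measurable_EFin_line.
  - by apply: measurable_EFin_line; exact: measurable_indic.
  - move=> x _; rewrite lee_fin indicE; case: (boolP (_ \in _)) => [_|]; first exact: bump0_le1.
    rewrite notin_setE /= in_itv /= -ler_norml => /negP; rewrite -ltNge => h.
    by rewrite bump0_out.
by rewrite integral_indic_itv ?ltry //; lra.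
Qed.

Definition bump (x : R) : R := (fine I0)^-1 * bump0 x.

Let fI0_gt0 : 0 < fine I0.
Proof. by rewrite fine_gt0 // I0_gt0. Qed.

Lemma bump_ge0 x : 0 <= bump x.
Proof. by rewrite mulr_ge0 // invr_ge0 ltW. Qed.

Lemma bump_out x : 1 < `|x| -> bump x = 0.
Proof. by move=> x1; rewrite /bump bump0_out // mulr0. Qed.

Lemma continuous_bump : continuous bump.
Proof. by move=> x; apply: cvgM; [exact: cvg_cst|exact: continuous_bump0]. Qed.

Lemma measurable_bump : measurable_fun setT bump.
Proof. exact: continuous_measurable_fun continuous_bump. Qed.

Lemma sm_bump n (f : n.-tuple R -> R) : sm f -> sm (fun z => bump (f z)).
Proof.
move=> sf; apply: sm_mul; first exact: sm_cst.
apply: sm_mul; apply: sm_flat; first by apply: sm_add => //; exact: sm_cst.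
by apply: sm_sub => //; exact: sm_cst.
Qed.

Lemma integral_bump : (\int[leb]_x (bump x)%:E = 1)%E.
Proof.
under eq_integral do rewrite EFinM.
rewrite ge0_integralZl_EFin //; first last.
- by rewrite invr_ge0 ltW.
- exact: measurable_EFin_line.
- by move=> x _; rewrite lee_fin.
rewrite -/I0 -{2}(@fineK _ I0); last by rewrite ge0_fin_numE // ltW.
by rewrite -EFinM mulVf // gt_eqF.
Qed.

Lemma integral_bump_affine (c s : R) : 0 < s ->
  (\int[leb]_x (s^-1 * bump ((x - c) / s))%:E = 1)%E.
Proof.
move=> s0; rewrite -integral_bump.
have D (x : R) : is_derive x 1 (fun t : R => (t - c) / s) s^-1.
  have h := is_derive_add (is_derive_id x (1 : R)) (is_derive_const (- c) x).
  apply: (is_derive_eq (is_derive_mul h (is_derive_const s^-1 x))).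
  by rewrite addr0 mul1r mulr0 addr0.
have DE : (fun t : R => (t - c) / s)^`()%classic = cst s^-1.
  by apply/funext => x; exact: is_derive_derive1 (D x).
have i0 : 0 < s^-1 by rewrite invr_gt0.
rewrite (@increasing_ge0_integration_by_substitutionT _ (fun t : R => (t - c) / s) bump).
- by apply: eq_integral => x _; rewrite DE /= mulrC.
- by move=> x y xy; rewrite ltr_pM2r // ltrD2r.
- by rewrite DE => x; exact: cvg_cst.
- by rewrite DE; exact: is_cvg_cst.
- by rewrite DE; exact: is_cvg_cst.
- by move=> x; exact: is_derive_derivable (D x).
- apply/cvgrNyPle => A; exists (A * s + c); split; first exact: num_real.
  by move=> x /ltW h; rewrite ler_pdivrMr // lerBlDr.
- apply/cvgryPge => A; exists (A * s + c); split; first exact: num_real.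
  by move=> x /ltW h; rewrite ler_pdivlMr // lerBrDr.
- exact: continuous_bump.
- exact: bump_ge0.
Qed.

End bump.

(** * Kinetic translations and dilations, and the transport operator *)

Section kinetic_geometry.
Context {R : realType} (d : nat).
Local Notation N := (1 + 2 * d)%N.
Implicit Types (z w : pt R d) (phi : pt R d -> R) (lam eta : R).

Definition tco z : R := nth 0 z tidx.
Definition xco z i : R := nth 0 z (xidx i).

Lemma sum_phase (F : nat -> R) :
  \sum_(k < N) F k = F tidx + \sum_(i < d) F (xidx i) + \sum_(i < d) F (vidx d i).
Proof.
have -> : N = (1 + (d + d))%N by lia.
rewrite big_split_ord big_ord1 /= -addrA; congr (_ + _).
rewrite big_split_ord /=; congr (_ + _); apply: eq_bigr => i _; rewrite /vidx ?addnA //.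
Qed.

Lemma phase_index (P : nat -> Prop) :
  P tidx -> (forall i, (i < d)%N -> P (xidx i)) -> (forall i, (i < d)%N -> P (vidx d i)) ->
  forall k, (k < N)%N -> P k.
Proof.
move=> Pt Px Pv [|k] kN //; have [kd|dk] := ltnP k d.
  by rewrite -[k.+1]/(xidx k); exact: Px.
by rewrite (_ : k.+1 = vidx d (k - d)%N); [apply: Pv; lia|rewrite /vidx; lia].
Qed.

(* The left translation by [z^-1] for the kinetic group law, followed by the
   dilation by [lam] in time, [eta] in velocity and [lam * eta] in space. *)
Definition kin z lam eta w : pt R d := [tuple
  (if val j == 0%N then (tco w - tco z) / lam
   else if (val j <= d)%N
   then (tnth w j - tnth z j - (tco w - tco z) * nth 0 z (val j + d)%N) / (lam * eta)
   else (tnth w j - tnth z j) / eta) | j < N].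

Let nth_kin z lam eta w k : (k < N)%N -> nth 0 (kin z lam eta w) k =
  if k == 0%N then (tco w - tco z) / lam
  else if (k <= d)%N
  then (nth 0 w k - nth 0 z k - (tco w - tco z) * nth 0 z (k + d)%N) / (lam * eta)
  else (nth 0 w k - nth 0 z k) / eta.
Proof.
move=> kN; rewrite -(tnth_nth 0 (kin z lam eta w) (Ordinal kN)) tnth_mktuple.
by rewrite !(tnth_nth 0).
Qed.

Lemma tco_kin z lam eta w : tco (kin z lam eta w) = (tco w - tco z) / lam.
Proof. by rewrite /tco nth_kin. Qed.

Lemma xco_kin z lam eta w i : (i < d)%N -> xco (kin z lam eta w) i =
  (xco w i - xco z i - (tco w - tco z) * vcoord z i) / (lam * eta).
Proof.
move=> id; rewrite /xco nth_kin /xidx; last by lia.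
rewrite ifT; last by lia.
by rewrite /vcoord /vidx (_ : 1 + i + d = 1 + d + i)%N //; lia.
Qed.

Lemma vcoord_kin z lam eta w i : (i < d)%N ->
  vcoord (kin z lam eta w) i = (vcoord w i - vcoord z i) / eta.
Proof.
move=> id; rewrite /vcoord nth_kin /vidx; last by lia.
by rewrite ifF //; lia.
Qed.

Lemma sm_tco : sm tco. Proof. exact: sm_coord. Qed.
Lemma sm_xco i : sm (xco ^~ i). Proof. exact: sm_coord. Qed.
Lemma sm_vcoord i : sm (fun z : pt R d => vcoord z i). Proof. exact: sm_coord. Qed.

Lemma sm_kin phi z lam eta : sm phi -> sm (fun w => phi (kin z lam eta w)).
Proof.
move=> sphi; apply: sm_comp sphi => k.
have sB (j : nat) : sm (fun w : pt R d => nth 0 w j - nth 0 z j).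
  by apply: sm_sub; [exact: sm_coord|exact: sm_cst].
have [kN|Nk] := ltnP k N; last first.
  apply: (sm_eq _ (sm_cst _ 0)) => w; by rewrite nth_default ?size_tuple.
move: k kN; apply: phase_index => [|i id|i id].
- apply: (sm_eq _ (sm_mul (sB tidx) (sm_cst _ lam^-1))) => w; exact/esym/tco_kin.
- apply: (sm_eq _ (sm_mul (sm_sub (sB (xidx i))
    (sm_mul (sB tidx) (sm_cst _ (vcoord z i)))) (sm_cst _ (lam * eta)^-1))) => w.
  exact/esym/xco_kin.
- apply: (sm_eq _ (sm_mul (sB (vidx d i)) (sm_cst _ eta^-1))) => w.
  exact/esym/vcoord_kin.
Qed.

Lemma tco_shift w k s : tco (Defs.shift w k s) = tco w + (if tidx == k then s else 0).
Proof. by rewrite /tco nth_shift. Qed.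

Lemma xco_shift w k s i : (i < d)%N ->
  xco (Defs.shift w k s) i = xco w i + (if xidx i == k then s else 0).
Proof. by move=> id; rewrite /xco nth_shift // /xidx; lia. Qed.

Lemma vcoord_shift w k s i : (i < d)%N ->
  vcoord (Defs.shift w k s) i = vcoord w i + (if vidx d i == k then s else 0).
Proof. by move=> id; rewrite /vcoord nth_shift // /vidx; lia. Qed.

Let is_derive_affine (a m s : R) : is_derive s 1 (fun t : R => a + t * m) m.
Proof.
have h := is_derive_mul (is_derive_id s (1 : R)) (is_derive_const m s).
apply: (is_derive_eq (is_derive_add (is_derive_const a s) h)).
by rewrite mul1r mulr0 addr0 add0r.
Qed.

Let partial_of_affine phi (L : pt R d -> pt R d) k w (M : nat -> R) : sm phi ->
  (forall j s, (j < N)%N ->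
    nth 0 (L (Defs.shift w k s)) j = nth 0 (L w) j + s * M j) ->
  partial k (fun w => phi (L w)) w = \sum_(j < N) M j * partial j phi (L w).
Proof.
move=> sphi LM; apply: is_derive_derive1.
rewrite -{2}(shift0 w k); apply: (sm_chain (c := fun s => L (Defs.shift w k s))) => // j jN.
by under eq_fun do rewrite LM //; exact: is_derive_affine.
Qed.

Lemma partial_t_kin phi z lam eta w : sm phi -> lam != 0 -> eta != 0 ->
  partial tidx (fun w => phi (kin z lam eta w)) w =
  lam^-1 * partial tidx phi (kin z lam eta w) -
  \sum_(i < d) vcoord z i / (lam * eta) * partial (xidx i) phi (kin z lam eta w).
Proof.
move=> sphi l0 e0.
pose M j := if j == tidx then lam^-1 else
  if (j <= d)%N then - (nth 0 z (j + d)%N / (lam * eta)) else 0.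
have Mx i : (i < d)%N -> M (xidx i) = - (vcoord z i / (lam * eta)).
  move=> id; rewrite /M (_ : (xidx i == tidx) = false) // ifT //.
  by rewrite /vcoord (_ : (xidx i + d)%N = vidx d i) // /vidx /xidx; lia.
have Mv i : M (vidx d i) = 0.
  by rewrite /M (_ : (vidx d i == tidx) = false) // ifF // /vidx; lia.
rewrite (partial_of_affine (M := M)) //; last first.
  move=> j s; move: j; apply: phase_index => [|i id|i id].
  - by rewrite -![nth 0 _ tidx]/(tco _) !tco_kin tco_shift eqxx /M /=; ring.
  - rewrite -![nth 0 _ (xidx i)]/(xco _ i) !xco_kin // tco_shift xco_shift // eqxx Mx //=.
    by rewrite addr0; field; rewrite l0 e0.
  - rewrite -![nth 0 _ (vidx d i)]/(vcoord _ i) !vcoord_kin // vcoord_shift // Mv.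
    by rewrite (_ : (vidx d i == tidx) = false) // addr0 mulr0 addr0.
rewrite (sum_phase (fun k => M k * partial k phi (kin z lam eta w))) -sumrN.
rewrite [X in _ + X]big1 ?addr0 => [|i _]; last by rewrite Mv mul0r.
by congr (_ + _); apply: eq_bigr => i _; rewrite Mx // mulNr.
Qed.

Lemma partial_x_kin phi z lam eta w i : (i < d)%N -> sm phi ->
  partial (xidx i) (fun w => phi (kin z lam eta w)) w =
  (lam * eta)^-1 * partial (xidx i) phi (kin z lam eta w).
Proof.
move=> id sphi.
rewrite (partial_of_affine (M := fun j => (j == xidx i)%:R / (lam * eta))) //; last first.
  move=> j s; move: j; apply: phase_index => [|j jd|j jd].
  - by rewrite -![nth 0 _ tidx]/(tco _) !tco_kin tco_shift /=; ring.
  - rewrite -![nth 0 _ (xidx j)]/(xco _ j) !xco_kin // tco_shift xco_shift //= addr0.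
    by case: eqP => _ /=; ring.
  - rewrite -![nth 0 _ (vidx d j)]/(vcoord _ j) !vcoord_kin // vcoord_shift //.
    have -> : (vidx d j == xidx i) = false by rewrite /vidx /xidx; lia.
    by rewrite addr0 mul0r mulr0 addr0.
have iN : (xidx i < N)%N by rewrite /xidx; lia.
rewrite (bigD1 (Ordinal iN)) //= eqxx mul1r big1 ?addr0 // => j.
by rewrite -val_eqE /= => /negPf ->; rewrite !mul0r.
Qed.

Lemma partial_v_kin phi z lam eta w i : (i < d)%N -> sm phi ->
  partial (vidx d i) (fun w => phi (kin z lam eta w)) w =
  eta^-1 * partial (vidx d i) phi (kin z lam eta w).
Proof.
move=> id sphi.
rewrite (partial_of_affine (M := fun j => (j == vidx d i)%:R / eta)) //; last first.
  move=> j s; move: j; apply: phase_index => [|j jd|j jd].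
  - by rewrite -![nth 0 _ tidx]/(tco _) !tco_kin tco_shift /=; ring.
  - rewrite -![nth 0 _ (xidx j)]/(xco _ j) !xco_kin // tco_shift xco_shift //=.
    have -> : (xidx j == vidx d i) = false by rewrite /vidx /xidx; lia.
    by rewrite !addr0 mul0r mulr0 addr0.
  - rewrite -![nth 0 _ (vidx d j)]/(vcoord _ j) !vcoord_kin // vcoord_shift //.
    by case: eqP => _ /=; ring.
have iN : (vidx d i < N)%N by rewrite /vidx; lia.
rewrite (bigD1 (Ordinal iN)) //= eqxx mul1r big1 ?addr0 // => j.
by rewrite -val_eqE /= => /negPf ->; rewrite !mul0r.
Qed.

Definition transport phi z : R :=
  partial tidx phi z + \sum_(i < d) vcoord z i * partial (xidx i) phi z.

Lemma sm_transport phi : sm phi -> sm (transport phi).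
Proof.
move=> sphi; apply: sm_add; first exact: sm_partial.
by apply: sm_sum => i; apply: sm_mul; [exact: sm_vcoord|exact: sm_partial].
Qed.

(** The transport field is invariant under left translations and homogeneous under dilations. The
    drift of the space coordinate contributes [- vcoord z], which turns the velocity [vcoord w] into
    the relative one, that is [eta] times the velocity of [kin z lam eta w]. *)
Lemma transport_kin phi z lam eta w : sm phi -> lam != 0 -> eta != 0 ->
  transport (fun w => phi (kin z lam eta w)) w =
  lam^-1 * transport phi (kin z lam eta w).
Proof.
move=> sphi l0 e0; rewrite /transport partial_t_kin // mulrDr -addrA.
congr (_ + _); rewrite mulr_sumr addrC -sumrB; apply: eq_bigr => i _.
rewrite partial_x_kin // vcoord_kin //.
by move: (partial _ _ _) => D; field; rewrite l0 e0.
Qed.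

(** The commutator of a velocity derivative with transport is the matching space derivative. This is
    the mechanism by which the equation controls the [x] direction. *)
Lemma partial_v_transport phi z i : (i < d)%N -> sm phi ->
  partial (vidx d i) (transport phi) z =
  transport (partial (vidx d i) phi) z + partial (xidx i) phi z.
Proof.
move=> id sphi; rewrite partialD; [|exact: sm_partial|]; last first.
  by apply: sm_sum => j; apply: sm_mul; [exact: sm_vcoord|exact: sm_partial].
rewrite partialC // /transport -addrA; congr (_ + _).
rewrite (partial_sum _ _ z (f := fun (j : 'I_d) z => vcoord z j * partial (xidx j) phi z)); last first.
  by move=> j; apply: sm_mul; [exact: sm_vcoord|exact: sm_partial].
rewrite (eq_bigr (fun j : 'I_d => (if j == Ordinal id then partial (xidx j) phi z else 0) +
    vcoord z j * partial (xidx j) (partial (vidx d i) phi) z)); last first.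
  move=> j _; rewrite (partialM _ _ (sm_vcoord j) (sm_partial _ sphi)) partialC //.
  congr (_ + _); rewrite partial_coord; last by rewrite /vidx; have := ltn_ord j; lia.
  have -> : (vidx d j == vidx d i) = (j == Ordinal id).
    by rewrite -val_eqE /= /vidx eqn_add2l.
  by case: eqP; rewrite ?mul1r ?mul0r.
by rewrite big_split /= -big_mkcond big_pred1_eq addrC.
Qed.

End kinetic_geometry.
Arguments sm_tco {R d}.
Arguments sm_xco {R d} i.
Arguments sm_vcoord {R d} i.

(** * The generator of the dilations as a transport derivative plus a velocity divergence *)

Section dilation_generator.
Context {R : realType} (d : nat) (a b : R).
Local Notation N := (1 + 2 * d)%N.
Implicit Types (z w : pt R d) (phi : pt R d -> R).

(** When [a (1 + d) + 2 b d = 1], this is the divergence of [phi] times the dilation field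
    [(a t, (a + b) x, b v)]: the zero-order coefficient is the trace of the field. *)
Definition generator phi z : R := phi z + a * (tco z * partial tidx phi z) +
  (a + b) * (\sum_(i < d) xco z i * partial (xidx i) phi z) +
  b * (\sum_(i < d) vcoord z i * partial (vidx d i) phi z).

(** The space component of [phi] times the dilation field after writing [d_t (t phi)] as transport
    of [t phi] minus [v . d_x (t phi)]; hence the correction by [a t v]. *)
Definition chi phi i z : R := ((a + b) * xco z i - a * (tco z * vcoord z i)) * phi z.

Definition tpot phi z : R :=
  a * (tco z * phi z) - \sum_(i < d) partial (vidx d i) (chi phi i) z.

Definition vpot phi (i : nat) z : R := b * (vcoord z i * phi z) + transport (chi phi i) z.

Lemma sm_generator phi : sm phi -> sm (generator phi).
Proof.
move=> sphi.
have s (f : nat -> pt R d -> R) (k : nat -> nat) : (forall i, sm (f i)) ->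
    sm (fun z => \sum_(i < d) f i z * partial (k i) phi z).
  by move=> sf; apply: sm_sum => i; apply: sm_mul => //; exact: sm_partial.
apply: sm_add; last first.
  apply: sm_mul; first exact: sm_cst.
  exact: (s (fun i z => vcoord z i) (vidx d) (@sm_vcoord R d)).
apply: sm_add; last first.
  apply: sm_mul; first exact: sm_cst.
  exact: (s (fun i z => xco z i) xidx (@sm_xco R d)).
apply: sm_add => //; apply: sm_mul; first exact: sm_cst.
by apply: sm_mul; [exact: sm_tco|exact: sm_partial].
Qed.

Lemma sm_chi phi i : sm phi -> sm (chi phi i).
Proof.
move=> sphi; apply: sm_mul => //; apply: sm_sub; apply: sm_mul; try exact: sm_cst.
  exact: sm_xco.
by apply: sm_mul; [exact: sm_tco|exact: sm_vcoord].
Qed.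

Lemma sm_tpot phi : sm phi -> sm (tpot phi).
Proof.
move=> sphi; apply: sm_sub; last by apply: sm_sum => i; apply: sm_partial; exact: sm_chi.
by apply: sm_mul; [exact: sm_cst|apply: sm_mul; [exact: sm_tco|]].
Qed.

Lemma sm_vpot phi i : sm phi -> sm (vpot phi i).
Proof.
move=> sphi; apply: sm_add; last by apply: sm_transport; exact: sm_chi.
by apply: sm_mul; [exact: sm_cst|apply: sm_mul; [exact: sm_vcoord|]].
Qed.

Let transportD phi psi z : sm phi -> sm psi ->
  transport (fun z => phi z + psi z) z = transport phi z + transport psi z.
Proof.
move=> sphi spsi; rewrite /transport partialD //.
under eq_bigr do rewrite partialD // mulrDr.
by rewrite big_split /= addrACA.
Qed.

Let transport_cstM c phi z : sm phi ->
  transport (fun z => c * phi z) z = c * transport phi z.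
Proof.
move=> sphi; rewrite /transport (partialM _ _ (sm_cst _ c) sphi) partial_cst mul0r add0r.
rewrite mulrDr mulr_sumr; congr (_ + _); apply: eq_bigr => i _.
rewrite (partialM _ _ (sm_cst _ c) sphi) partial_cst mul0r add0r.
by rewrite mulrCA.
Qed.

Let transport_tcoM phi z : sm phi ->
  transport (fun z => tco z * phi z) z = phi z + tco z * transport phi z.
Proof.
move=> sphi; rewrite /transport (partialM _ _ sm_tco sphi) partial_coord // eqxx mul1r.
rewrite mulrDr addrA mulr_sumr; congr (_ + _); apply: eq_bigr => i _.
rewrite (partialM _ _ sm_tco sphi) partial_coord // mul0r add0r.
by rewrite mulrCA.
Qed.

Let transport_sum (f : 'I_d -> pt R d -> R) z : (forall i, sm (f i)) ->
  transport (fun z => \sum_i f i z) z = \sum_i transport (f i) z.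
Proof.
move=> sf; rewrite /transport partial_sum // big_split /=; congr (_ + _).
rewrite exchange_big /=; apply: eq_bigr => i _.
by rewrite partial_sum // mulr_sumr.
Qed.

Let transportN phi z : sm phi -> transport (fun z => - phi z) z = - transport phi z.
Proof.
move=> sphi; rewrite -mulN1r -transport_cstM //.
by congr (transport _ z); apply/funext => w; rewrite mulN1r.
Qed.

(* The [x]-derivatives are absorbed through [d_x = [d_v, d_t + v . d_x]]. *)
Lemma generatorE phi z : sm phi -> a * (1 + d%:R) + b * (2 * d%:R) = 1 ->
  generator phi z = transport (tpot phi) z +
    \sum_(i < d) partial (vidx d i) (vpot phi i) z.
Proof.
move=> sphi abd.
have stp : sm (fun z => tco z * phi z) by apply: sm_mul => //; exact: sm_tco.
have satp : sm (fun z => a * (tco z * phi z)) by apply: sm_mul => //; exact: sm_cst.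
have spc i : sm (partial (vidx d i) (chi phi i)) by apply: sm_partial; exact: sm_chi.
rewrite transportD //; last by apply: sm_opp; apply: sm_sum.
rewrite transport_cstM // transport_tcoM // transportN; last by apply: sm_sum.
rewrite transport_sum // -addrA [X in _ + X]addrC -sumrB.
(* Each index contributes [a + b] from differentiating [x_i] and [b] from differentiating [v_i] to
   the zero-order term; the mixed derivatives of [chi] cancel through the commutator. *)
rewrite (eq_bigr (fun i : 'I_d => (a + 2 * b) * phi z +
   ((a + b) * (xco z i * partial (xidx i) phi z) + b * (vcoord z i * partial (vidx d i) phi z) -
    a * (tco z * (vcoord z i * partial (xidx i) phi z))))); last first.
  move=> i _; have id := ltn_ord i.
  have svp : sm (fun z => vcoord z i * phi z) by apply: sm_mul => //; exact: sm_vcoord.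
  rewrite partialD; [|by apply: sm_mul; [exact: sm_cst|]|by apply: sm_transport; exact: sm_chi].
  rewrite (partialM _ _ (sm_cst _ b) svp) partial_cst (partialM _ _ (sm_vcoord i) sphi).
  rewrite partial_coord ?eqxx; last by rewrite /vidx; lia.
  rewrite partial_v_transport //; last exact: sm_chi.
  have sc : sm (fun z => (a + b) * xco z i - a * (tco z * vcoord z i)).
    apply: sm_sub; apply: sm_mul; try exact: sm_cst; first exact: sm_xco.
    by apply: sm_mul; [exact: sm_tco|exact: sm_vcoord].
  rewrite [partial (xidx i) (chi phi i) z](partialM _ _ sc sphi).
  have -> : partial (xidx i) (fun z => (a + b) * xco z i - a * (tco z * vcoord z i)) z = a + b.
    rewrite partialB; first last.
    - by apply: sm_mul; [exact: sm_cst|apply: sm_mul; [exact: sm_tco|exact: sm_vcoord]].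
    - by apply: sm_mul; [exact: sm_cst|exact: sm_xco].
    rewrite (partialM _ _ (sm_cst _ (a + b)) (sm_xco i)) partial_cst partial_coord; last first.
      by rewrite /xidx; lia.
    rewrite (partialM _ _ (sm_cst _ a) (sm_mul sm_tco (sm_vcoord i))) partial_cst.
    rewrite (partialM _ _ sm_tco (sm_vcoord i)) !partial_coord ?eqxx //; last by rewrite /vidx; lia.
    rewrite (_ : (vidx d i == xidx i) = false); last by rewrite /vidx /xidx; lia.
    rewrite (_ : (tidx == xidx i) = false) // /=; ring.
  move: (partial (vidx d i) phi z) (partial (xidx i) phi z) => p1 p2.
  by move: (transport _ z) => p3 /=; ring.
rewrite big_split /= sumr_const card_ord sumrB big_split /= -!mulr_sumr.
rewrite /generator /transport -mulr_natr.
move: (partial tidx phi z) (\sum_(i < d) _ * _) => p1 s1.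
move: (\sum_(i < d) _ * _) (\sum_(i < d) _ * _) => s2 s3.
(* The zero-order terms add up to [a + d (a + 2 b)], which is the trace condition [abd] in another
   order. *)
rewrite -[X in X + _ + _ + _ = _]mul1r -{1}abd; ring.
Qed.

Section supports.
Variables (phi : pt R d -> R) (M : R).
Hypothesis phiM : supported M phi.

Lemma supported_mulr (f : pt R d -> R) : supported M (fun z => f z * phi z).
Proof. by move=> z /phiM ->; rewrite mulr0. Qed.

Lemma supported_transport : supported M (transport phi).
Proof.
move=> z zM; rewrite /transport (supported_partial _ phiM) // add0r big1 // => i _.
by rewrite (supported_partial _ phiM) // mulr0.
Qed.

End supports.

Lemma supported_tpot phi M : supported M phi -> supported M (tpot phi).
Proof.
move=> phiM z zM; rewrite /tpot phiM // !mulr0 sub0r big1 ?oppr0 // => i _.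
by rewrite (supported_partial _ (supported_mulr phiM _)).
Qed.

Lemma supported_vpot phi M i : supported M phi -> supported M (vpot phi i).
Proof.
move=> phiM z zM; rewrite /vpot phiM // !mulr0 add0r.
by rewrite (supported_transport (supported_mulr phiM _)).
Qed.

Lemma supported_generator phi M : supported M phi -> supported M (generator phi).
Proof.
move=> phiM z zM; rewrite /generator phiM // (supported_partial _ phiM) //.
rewrite !big1 ?mulr0 ?addr0 // => i _; by rewrite (supported_partial _ phiM) // mulr0.
Qed.

End dilation_generator.

(** * Kernels along the one-parameter family of dilations *)

Section scales.
Context {R : realType} (d : nat) (a b sig tau : R).
Hypotheses (sig0 : 0 < sig) (tau0 : 0 < tau).

(** The exponents [a], [b] fix how a ball of volume parameter [r] is shaped as [r] varies. The
    multipliers [sig], [tau] stay free until the end, where they balance the two norms. *)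
Definition lam r := sig * r `^ a.
Definition eta r := tau * r `^ b.

Lemma lam_gt0 r : 0 < r -> 0 < lam r.
Proof. by move=> r0; rewrite mulr_gt0 // powR_gt0. Qed.

Lemma eta_gt0 r : 0 < r -> 0 < eta r.
Proof. by move=> r0; rewrite mulr_gt0 // powR_gt0. Qed.

Definition kinr (z : pt R d) r w := kin z (lam r) (eta r) w.

Definition kernel (phi : pt R d -> R) z r w := r^-1 * phi (kinr z r w).

Lemma is_derive_powR_inv (c k r : R) : 0 < r -> c != 0 ->
  is_derive r 1 (fun r => (c * r `^ k)^-1) (- (k / r) * (c * r `^ k)^-1).
Proof.
move=> r0 c0.
have h := is_derive_mul (is_derive_const c r) (is_derive1_powR k r0).
have n0 : c * r `^ k != 0 by rewrite mulf_neq0 // gt_eqF // powR_gt0.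
have hV := is_deriveV (f := fun r : R => c * r `^ k) n0 h.
apply: (is_derive_eq hV).
rewrite /GRing.scale /= powRB ?(gt_eqF r0) ?implybT // powRr1 ?(ltW r0) //.
by field; rewrite c0 (gt_eqF r0) gt_eqF // powR_gt0.
Qed.

(** Each rescaled coordinate is homogeneous in [r] of degree [-a], [-(a + b)] or [-b], so
    differentiating reproduces the Euler field of the dilations; the prefactor [r^-1] supplies the
    zero-order term of [generator]. *)
Lemma is_derive_kernel (phi : pt R d -> R) z w (r : R) : 0 < r -> sm phi ->
  is_derive r 1 (fun r => kernel phi z r w) (- r^-1 ^+ 2 * generator a b phi (kinr z r w)).
Proof.
move=> r0 sphi.
have lD : is_derive r 1 (fun r => (lam r)^-1) (- (a / r) * (lam r)^-1).
  by apply: is_derive_powR_inv => //; rewrite gt_eqF.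
have eD : is_derive r 1 (fun r => (eta r)^-1) (- (b / r) * (eta r)^-1).
  by apply: is_derive_powR_inv => //; rewrite gt_eqF.
have leD : is_derive r 1 (fun r => (lam r * eta r)^-1) (- ((a + b) / r) * (lam r * eta r)^-1).
  have E : (fun r => (lam r * eta r)^-1) = (fun r => (lam r)^-1 * (eta r)^-1).
    by apply/funext => s; rewrite invfM.
  rewrite E; apply: (is_derive_eq (is_derive_mul lD eD)).
    rewrite (invfM (lam r)); move: (lam r)^-1 (eta r)^-1 => l e; ring.
have iD : is_derive r 1 (fun r : R => r^-1) (- r^-1 ^+ 2).
  have rn0 : id r != 0 by rewrite gt_eqF.
  apply: (is_derive_eq (is_deriveV (f := id) rn0 (is_derive_id r (1 : R)))).
    by rewrite /GRing.scale /= mulr1 exprVn.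
pose K := kinr z r w.
pose c' j := - ((if j == tidx then a else if (j <= d)%N then a + b else b) / r) * nth 0 K j.
have cD k : (k < 1 + 2 * d)%N -> is_derive r 1 (fun r => nth 0 (kinr z r w) k) (c' k).
  move: k; apply: phase_index => [|i id|i id].
  - rewrite /c' /= -/(tco K) tco_kin.
    have E : (fun r => nth 0 (kinr z r w) tidx) = fun r => (tco w - tco z) * (lam r)^-1.
      by apply/funext => s; rewrite -/(tco _) tco_kin.
    by rewrite E; apply: (is_derive_eq (is_derive_mul (is_derive_const _ _) lD)); ring.
  - rewrite /c' -[nth 0 K _]/(xco K i) xco_kin // (_ : (xidx i == tidx) = false) // ifT //.
    have E : (fun r => nth 0 (kinr z r w) (xidx i)) = fun r =>
        (xco w i - xco z i - (tco w - tco z) * vcoord z i) * (lam r * eta r)^-1.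
      by apply/funext => s; rewrite -[LHS]/(xco _ i) xco_kin.
    by rewrite E; apply: (is_derive_eq (is_derive_mul (is_derive_const _ _) leD)); ring.
  - rewrite /c' -[nth 0 K _]/(vcoord K i) vcoord_kin // (_ : (vidx d i == tidx) = false) // ifF; last by rewrite /vidx; lia.
    have E : (fun r => nth 0 (kinr z r w) (vidx d i)) = fun r =>
        (vcoord w i - vcoord z i) * (eta r)^-1.
      by apply/funext => s; rewrite -[LHS]/(vcoord _ i) vcoord_kin.
    by rewrite E; apply: (is_derive_eq (is_derive_mul (is_derive_const _ _) eD)); ring.
apply: (is_derive_eq (is_derive_mul iD (sm_chain sphi cD))).
rewrite (sum_phase d (fun k => c' k * partial k phi (kinr z r w))) -/K /generator.
have -> : \sum_(i < d) c' (xidx i) * partial (xidx i) phi K =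
    - ((a + b) / r) * \sum_(i < d) xco K i * partial (xidx i) phi K.
  rewrite mulr_sumr; apply: eq_bigr => i _.
  by rewrite /c' -[nth 0 K _]/(xco K i) (_ : (xidx i == tidx) = false) // ifT // mulrA.
have -> : \sum_(i < d) c' (vidx d i) * partial (vidx d i) phi K =
    - (b / r) * \sum_(i < d) vcoord K i * partial (vidx d i) phi K.
  rewrite mulr_sumr; apply: eq_bigr => i _.
  rewrite /c' -[nth 0 K _]/(vcoord K i) (_ : (vidx d i == tidx) = false) // ifF ?mulrA //.
  by rewrite /vidx; lia.
have -> : c' tidx = - (a / r) * tco K by [].
move: (partial tidx phi K) (\sum_(i < d) _ * _) => p1 s1.
by move: (\sum_(i < d) _ * _) => s2; ring.
Qed.

End scales.

(** * Triangular integrals and the volume of kinetic balls *)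

Section triangular.
Context {R : realType}.
Local Notation leb := (@lebesgue_measure R).

(** Covers integrands whose factors in [x] and [v] may depend on the time coordinate. Space sections
    of kinetic balls have centers that move with time, and their one-dimensional integrals are
    unaffected by the shift. *)
Lemma integral_mun_triangular n (u0 : R -> R) (u : R -> nat -> R -> R) :
  measurable_fun setT u0 -> (forall t j, measurable_fun setT (u t j)) ->
  (forall t, 0 <= u0 t) -> (forall t j s, 0 <= u t j s) ->
  measurable_fun setT (fun z : n.+1.-tuple R =>
    u0 (nth 0 z 0%N) * \prod_(j < n) u (nth 0 z 0%N) j (nth 0 z j.+1)) ->
  (\int[mun n.+1]_z (u0 (nth 0 z 0%N) * \prod_(j < n) u (nth 0 z 0%N) j (nth 0 z j.+1))%:E =
   \int[leb]_t ((u0 t)%:E * \prod_(j < n) \int[leb]_s (u t j s)%:E))%E.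
Proof.
move=> mu0 mu pu0 pu mF; have prod0 (t : R) (z : n.-tuple R) :
    0 <= \prod_(j < n) u t j (nth 0 z j) by apply: prodr_ge0 => j _.
rewrite ge0_integral_munS; last 2 first.
- exact/measurable_EFinP.
- by move=> z; rewrite lee_fin mulr_ge0 // prodr_ge0.
apply: eq_integral => t _ /=.
under eq_integral do rewrite EFinM.
rewrite ge0_integralZl_EFin //.
- by rewrite integral_mun_prod.
- by move=> z _; rewrite lee_fin.
- apply/measurable_EFinP; apply: measurable_prod => j _.
  exact: (measurableT_comp (mu t j) (measurable_nth j)).
Qed.

Definition near_ind (rho c s : R) : R := if `|s - c| <= rho then 1 else 0.

Lemma near_ind_ge0 rho c s : 0 <= near_ind rho c s.
Proof. by rewrite /near_ind; case: ifP. Qed.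

Lemma near_ind_le1 rho c s : near_ind rho c s <= 1.
Proof. by rewrite /near_ind; case: ifP. Qed.

Lemma measurable_near_ind d (T : measurableType d) (rho : R) (c s : T -> R) :
  measurable_fun setT c -> measurable_fun setT s ->
  measurable_fun setT (fun z => near_ind rho (c z) (s z)).
Proof.
move=> mc ms; apply: measurable_fun_ifT => //; apply: measurable_fun_ler => //.
by apply: measurableT_comp => //; exact: measurable_funB.
Qed.

Lemma integral_near_ind (rho c : R) : 0 <= rho ->
  (\int[leb]_s (near_ind rho c s)%:E = (2 * rho)%:E)%E.
Proof.
move=> r0; rewrite -(_ : c + rho - (c - rho) = 2 * rho); last by ring.
rewrite -integral_indic_itv; last by lra.
apply: eq_integral => s _; congr EFin; rewrite indicE /near_ind ler_distl.
case: ifP => [h|/negP h]; first by rewrite mem_set.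
by rewrite memNset.
Qed.

End triangular.

Lemma prod_phase (R : realType) (d : nat) (F : nat -> R) :
  \prod_(j < 2 * d) F j.+1 = (\prod_(i < d) F (xidx i)) * (\prod_(i < d) F (vidx d i)).
Proof.
rewrite (_ : 2 * d = d + d)%N; last by lia.
by rewrite big_split_ord /=.
Qed.

Section kinetic_balls.
Context {R : realType} (d : nat) (a b sig tau : R).
Local Notation N := (1 + 2 * d)%N.
Hypotheses (sig0 : 0 < sig) (tau0 : 0 < tau).
Hypothesis abd : a * (1 + d%:R) + b * (2 * d%:R) = 1.
Hypothesis sigtau : sig ^+ (1 + d) * tau ^+ (2 * d) = 1.
Local Notation lam := (lam a sig).
Local Notation eta := (eta b tau).
Local Notation kinr := (@kinr R d a b sig tau).

(** The identity that makes [r] a volume: the product of all side lengths is [r], by [abd] for the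
    exponents and [sigtau] for the multipliers. *)
Lemma lam_eta_volume r : 0 < r -> lam r * (lam r * eta r) ^+ d * eta r ^+ d = r.
Proof.
move=> r0; rewrite exprMn mulrA -exprS -mulrA -exprD addnn -mul2n.
have P c k n : (c * r `^ k) ^+ n = c ^+ n * r `^ (k * n%:R).
  by rewrite exprMn powRrM powR_mulrn // powR_ge0.
rewrite -add1n /lam /eta !P mulrACA sigtau mul1r -powRD; last first.
  by rewrite (gt_eqF r0) implybT.
by rewrite natrD natrM abd powRr1 // ltW.
Qed.

Lemma measurable_kinr r : measurable_fun setT (fun zw : pt R d * pt R d => kinr zw.1 r zw.2).
Proof.
have m1 k : measurable_fun setT (fun zw : pt R d * pt R d => nth 0 zw.1 k).
  exact: (measurableT_comp (measurable_nth k) measurable_fst).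
have m2 k : measurable_fun setT (fun zw : pt R d * pt R d => nth 0 zw.2 k).
  exact: (measurableT_comp (measurable_nth k) measurable_snd).
apply/measurable_fun_tnthP => j.
rewrite (_ : _ \o _ = fun zw : pt R d * pt R d => nth 0 (kinr zw.1 r zw.2) j); last first.
  by apply/funext => zw; rewrite -(tnth_nth 0).
have : (j < N)%N by exact: ltn_ord.
move: (nat_of_ord j); apply: phase_index => [|i id|i id].
- rewrite (_ : (fun _ => _) = fun zw : pt R d * pt R d => (tco zw.2 - tco zw.1) / lam r).
    by apply: measurable_funM => //; apply: measurable_funB; [exact: m2|exact: m1].
  by apply/funext => zw; rewrite -[LHS]/(tco _) tco_kin.
- rewrite (_ : (fun _ => _) = fun zw : pt R d * pt R d =>
      (xco zw.2 i - xco zw.1 i - (tco zw.2 - tco zw.1) * vcoord zw.1 i) / (lam r * eta r)).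
    apply: measurable_funM => //; apply: measurable_funB.
      by apply: measurable_funB; [exact: m2|exact: m1].
    by apply: measurable_funM; [apply: measurable_funB; [exact: m2|exact: m1]|exact: m1].
  by apply/funext => zw; rewrite -[LHS]/(xco _ i) xco_kin.
- rewrite (_ : (fun _ => _) = fun zw : pt R d * pt R d =>
      (vcoord zw.2 i - vcoord zw.1 i) / eta r).
    by apply: measurable_funM => //; apply: measurable_funB; [exact: m2|exact: m1].
  by apply/funext => zw; rewrite -[LHS]/(vcoord _ i) vcoord_kin.
Qed.

Definition kball r : set (pt R d * pt R d) :=
  [set zw | forall k, `|nth 0 (kinr zw.1 r zw.2) k| <= 2].

Lemma measurable_kball r : measurable (kball r).
Proof.
rewrite (_ : kball r = \bigcap_k [set zw | `|nth 0 (kinr zw.1 r zw.2) k| <= 2]); last first.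
  by apply/seteqP; split=> [zw h k _|zw h k]; exact: h.
apply: bigcapT_measurable => k.
have mk : measurable_fun setT (fun zw : pt R d * pt R d => `|nth 0 (kinr zw.1 r zw.2) k|).
  apply: measurableT_comp => //.
  exact: (measurableT_comp (measurable_nth k) (measurable_kinr r)).
have := mk measurableT `]-oo, 2]%classic (measurable_itv _).
by rewrite setTI; congr (measurable _); apply/seteqP; split => zw /=; rewrite in_itv.
Qed.

(** A sheared box whose space center [c] is a function of time. Half-widths are six times the scales
    rather than two, which leaves room to replace the velocity of one point by that of the other. *)
Let box r (t0 : R) (c : R -> nat -> R) (e : nat -> R) (z : pt R d) : R :=
  near_ind (6 * lam r) t0 (nth 0 z 0%N) *
  \prod_(j < 2 * d) (if (j < d)%N then near_ind (6 * (lam r * eta r)) (c (nth 0 z 0%N) j) (nth 0 z j.+1)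
    else near_ind (6 * eta r) (e (j - d)%N) (nth 0 z j.+1)).

Let box_phase r t0 c e z : box r t0 c e z =
  near_ind (6 * lam r) t0 (tco z) *
  ((\prod_(i < d) near_ind (6 * (lam r * eta r)) (c (tco z) i) (xco z i)) *
   \prod_(i < d) near_ind (6 * eta r) (e i) (vcoord z i)).
Proof.
rewrite /box (prod_phase d (fun j => if (j.-1 < d)%N then
  near_ind (6 * (lam r * eta r)) (c (nth 0 z 0%N) j.-1) (nth 0 z j)
    else near_ind (6 * eta r) (e (j.-1 - d)%N) (nth 0 z j))).
congr (_ * (_ * _)); apply: eq_bigr => i _; first by rewrite /= ltn_ord.
have -> : (vidx d i).-1 = (d + i)%N by rewrite /vidx; lia.
by rewrite ltnNge leq_addr /= addKn.
Qed.

Let measurable_box r t0 c e : (forall j, measurable_fun setT (c ^~ j)) ->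
  measurable_fun setT (box r t0 c e).
Proof.
move=> mc; apply: measurable_funM.
  by apply: measurable_near_ind => //; exact: measurable_nth.
apply: measurable_prod => j _; case: (j < d)%N.
  apply: measurable_near_ind; last exact: measurable_nth.
  exact: (measurableT_comp (mc j) (measurable_nth 0%N)).
by apply: measurable_near_ind => //; exact: measurable_nth.
Qed.

Let integral_box r t0 c e : 0 < r -> (forall j, measurable_fun setT (c ^~ j)) ->
  (\int[mun N]_z (box r t0 c e z)%:E = ((12 ^+ N) * r)%:E)%E.
Proof.
move=> r0 mc; have l0 := lam_gt0 a sig0 r0; have e0 := eta_gt0 b tau0 r0.
have le0 : 0 <= lam r * eta r by exact: mulr_ge0 (ltW l0) (ltW e0).
pose u t j s := if (j < d)%N then near_ind (6 * (lam r * eta r)) (c t j) s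
  else near_ind (6 * eta r) (e (j - d)%N) s.
have := @integral_mun_triangular R (2 * d) (near_ind (6 * lam r) t0) u.
rewrite /u => ->; first last.
- exact: measurable_box.
- by move=> t j s; case: ifP => _; exact: near_ind_ge0.
- by move=> t; exact: near_ind_ge0.
- by move=> t j; case: (j < d)%N; exact: measurable_near_ind.
- exact: measurable_near_ind.
have E t : (\prod_(j < 2 * d) \int[@lebesgue_measure R]_s (u t j s)%:E =
    (12 ^+ (2 * d) * ((lam r * eta r) ^+ d * eta r ^+ d))%:E)%E.
  rewrite (eq_bigr (fun j : 'I_(2 * d) => (if (j < d)%N then 12 * (lam r * eta r)
      else 12 * eta r)%:E)); last first.
    move=> j _; rewrite /u; case: ifP => _.
      rewrite integral_near_ind; first by congr EFin; ring.
      exact: (mulr_ge0 _ le0).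
    rewrite integral_near_ind; first by congr EFin; ring.
    exact: (mulr_ge0 _ (ltW e0)).
  rewrite prodEFin; congr EFin.
  rewrite (prod_phase d (fun j => if (j.-1 < d)%N then 12 * (lam r * eta r) else 12 * eta r)).
  rewrite (eq_bigr (fun=> 12 * (lam r * eta r))); last by move=> i _; rewrite /= ltn_ord.
  rewrite [X in _ * X](eq_bigr (fun=> 12 * eta r)); last first.
    move=> i _; have -> : (vidx d i).-1 = (d + i)%N by rewrite /vidx; lia.
    by rewrite ltnNge leq_addr.
  rewrite !prodr_const !card_ord !exprMn mul2n -addnn exprD; ring.
under eq_integral do rewrite E muleC.
rewrite ge0_integralZl_EFin //; first last.
- apply: mulr_ge0; first exact: exprn_ge0.
  by apply: mulr_ge0; apply: exprn_ge0 => //; exact: ltW.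
- by apply: measurable_EFin_line; exact: measurable_near_ind.
- by move=> t _; rewrite lee_fin near_ind_ge0.
rewrite integral_near_ind; last exact: (mulr_ge0 _ (ltW l0)).
rewrite -EFinM; congr EFin; rewrite -[in RHS](lam_eta_volume r0) exprD expr1; ring.
Qed.

Lemma kball_bounds r z w : 0 < r -> kball r (z, w) ->
  [/\ `|tco w - tco z| <= 2 * lam r,
    forall i, (i < d)%N -> `|xco w i - xco z i - (tco w - tco z) * vcoord z i| <= 2 * (lam r * eta r) &
    forall i, (i < d)%N -> `|vcoord w i - vcoord z i| <= 2 * eta r].
Proof.
move=> r0 h; have l0 := lam_gt0 a sig0 r0; have e0 := eta_gt0 b tau0 r0.
have D (x s : R) : 0 < s -> `|x / s| <= 2 -> `|x| <= 2 * s.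
  by move=> s0; rewrite normrM normfV (gtr0_norm s0) ler_pdivrMr.
split=> [|i id|i id]; apply: D => //.
- by have := h tidx; rewrite -[nth _ _ _]/(tco _) tco_kin.
- by rewrite mulr_gt0.
- by have := h (xidx i); rewrite -[nth _ _ _]/(xco _ i) xco_kin.
- by have := h (vidx d i); rewrite -[nth _ _ _]/(vcoord _ i) vcoord_kin.
Qed.

Let indic_le_box r t0 c e (z : pt R d) (B : bool) : (B -> box r t0 c e z = 1) ->
  (B%:R : R) <= box r t0 c e z.
Proof.
case: B => [->//|_]; rewrite mulr_ge0 ?near_ind_ge0 // prodr_ge0 // => j _.
by case: ifP => _; exact: near_ind_ge0.
Qed.

Let six (x y : R) : 0 < y -> x <= 2 * y -> x <= 6 * y.
Proof. lra. Qed.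

(** Both kinds of sections lie in a sheared box of measure [12^N r]. Fixing the center [z] this is
    immediate from the definition of the ball; fixing [w] requires reversing the roles of the two
    points. *)
Lemma kball_family : ball_family (mun N) (12 ^+ N) kball.
Proof.
move=> r r0; have l0 := lam_gt0 a sig0 r0; have e0 := eta_gt0 b tau0 r0.
have mB := measurable_kball r; split=> // [z|w].
- pose c t j := xco z j + (t - tco z) * vcoord z j.
  have mc j : measurable_fun setT (c ^~ j).
    by apply: measurable_funD => //; apply: measurable_funM => //; exact: measurable_funB.
  rewrite -(integral_box (tco z) (vcoord z) r0 mc).
  apply: ge0_le_integral => //.
  + apply/measurable_EFinP.
    exact: (measurableT_comp (measurable_indic mB) (pair1_measurable z)).
  + by apply/measurable_EFinP; exact: measurable_box.
  + move=> w _; rewrite lee_fin indicE; apply: indic_le_box => //.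
    rewrite inE => /(kball_bounds r0)[ht hx hv]; rewrite box_phase.
    rewrite {1}/near_ind ifT; last exact: six.
    rewrite !big1 ?mulr1 // => i _; rewrite /near_ind ifT //.
      by apply: six => //; exact: hv.
    rewrite /c opprD addrA; apply: six; first exact: mulr_gt0.
    exact: hx.
(* With [w] fixed the drift must use the velocity of [w]. The error [(t_w - t_z)(v_w - v_z)] is at
   most [4 * lam r * eta r], which added to the original [2 * lam r * eta r] gives the factor
   six. *)
- pose c t j := xco w j - (tco w - t) * vcoord w j.
  have mc j : measurable_fun setT (c ^~ j).
    by apply: measurable_funB => //; apply: measurable_funM => //; exact: measurable_funB.
  rewrite -(integral_box (tco w) (vcoord w) r0 mc).
  apply: ge0_le_integral => //.
  + apply/measurable_EFinP.
    exact: (measurableT_comp (measurable_indic mB) (pair2_measurable w)).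
  + by apply/measurable_EFinP; exact: measurable_box.
  + move=> z _; rewrite lee_fin indicE; apply: indic_le_box => //.
    rewrite inE => /(kball_bounds r0)[ht hx hv]; rewrite box_phase.
    rewrite {1}/near_ind ifT; last by rewrite distrC; exact: six.
    rewrite !big1 ?mulr1 // => i _; rewrite /near_ind ifT //.
      by rewrite distrC; apply: six => //; exact: hv.
    have id := ltn_ord i.
    have -> : xco z i - c (tco z) i = - (xco w i - xco z i - (tco w - tco z) * vcoord z i)
       + (tco w - tco z) * (vcoord w i - vcoord z i) by rewrite /c; ring.
    apply: (le_trans (ler_normD _ _)); rewrite normrN normrM.
    have h1 := hx i id.
    have h2 : `|tco w - tco z| * `|vcoord w i - vcoord z i| <= (2 * lam r) * (2 * eta r).
      by apply: ler_pM => //; exact: hv.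
    apply: (le_trans (lerD h1 h2)); rewrite le_eqVlt; apply/orP; left; apply/eqP.
    by move: (lam r) (eta r) => x y; ring.
Qed.

End kinetic_balls.

(** * Dominated weak convergence and pointwise bounds *)

Section weak_domination.
Context d (T : measurableType d) (R : realType) (mu : {measure set T -> \bar R}).
Variables (D : set T) (H : T -> \bar R).
Hypotheses (mD : measurable D) (mH : measurable_fun setT H) (H0 : forall z, (0 <= H z)%E)
  (HD : (\int[mu]_(z in D) H z < +oo)%E).

Lemma integrable_dominated A (h : T -> R) : measurable A -> measurable_fun setT h ->
  (forall z, (`|h z|%:E <= H z)%E) -> mu.-integrable (A `&` D) (EFin \o h).
Proof.
move=> mA mh hH; have mAD : measurable (A `&` D) by exact: measurableI.
have mHA : measurable_fun (A `&` D) H by exact: measurable_funTS.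
have iH : mu.-integrable (A `&` D) H.
  apply/integrableP; split=> //; apply: le_lt_trans HD.
  under eq_integral do rewrite gee0_abs //.
  by apply: ge0_subset_integral => //; exact: measurable_funTS.
apply: le_integrable iH => //.
  by apply/measurable_EFinP; exact: measurable_funTS.
by move=> z _; rewrite [leRHS]gee0_abs //; exact: hH.
Qed.

Let small_tail (F : (set T)^nat) e : (forall n, measurable (F n)) -> 0 < e ->
  exists n, (\int[mu]_(z in ((\bigcup_k F k) `\` \big[setU/set0]_(i < n) F i) `&` D) H z <= e%:E)%E.
Proof.
move=> mF e0; pose U := \bigcup_k F k; pose V n := \big[setU/set0]_(i < n) F i.
have mV n : measurable (V n) by apply: bigsetU_measurable.
have mU : measurable U by exact: bigcup_measurable.
have VU n : V n `<=` U.
  by rewrite /V; elim/big_ind : _ => [//|A B AU BU|i _]; [rewrite subUset|exact: bigcup_sup].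
have fin A : measurable A -> (\int[mu]_(z in A `&` D) H z)%E \is a fin_num.
  move=> mA; rewrite ge0_fin_numE; last exact: integral_ge0.
  apply: le_lt_trans HD; apply: ge0_subset_integral => //; first exact: measurableI.
  exact: measurable_funTS.
have cv : (\int[mu]_(z in V n `&` D) H z @[n --> \oo] --> \int[mu]_(z in U `&` D) H z)%E.
  have -> : U `&` D = \bigcup_n (V n `&` D).
    rewrite -setI_bigcupl; congr (_ `&` _); apply/seteqP; split=> [z [k _ Fz]|z [n _]]; last exact: VU.
    by exists k.+1 => //; rewrite /V big_ord_recr /=; right.
  apply: ge0_nondecreasing_set_cvg_integral => //.
  - move=> m n mn; apply/subsetPset; apply: setSI.
    by apply: subset_bigsetU.
  - by move=> n; exact: measurableI.
  - by move=> n; exact: measurable_funTS.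
move: cv; rewrite -(fineK (fin _ mU)).
move=> /fine_cvgP[_ /cvgrPdist_le /(_ e e0) [n _ /(_ n (leqnn n)) /= hn]].
exists n; rewrite -/U -/(V n).
have mUV : measurable (U `\` V n) by exact: measurableD.
have : (\int[mu]_(z in U `&` D) H z = \int[mu]_(z in V n `&` D) H z +
    \int[mu]_(z in (U `\` V n) `&` D) H z)%E.
  rewrite -ge0_integral_setU //; try exact: measurableI.
  - congr (integral _ _ _); rewrite -setIUl; congr (_ `&` _).
    by rewrite setDUK.
  - exact: measurable_funTS.
  - apply/disj_setPS => z [[Vz _] [[_ nVz] _]]; exact: (nVz Vz).
rewrite -(fineK (fin _ mU)) -(fineK (fin _ (mV n))) -(fineK (fin _ mUV)) -EFinD => -[E].
rewrite lee_fin; move: hn; rewrite E addrC addKr => hn; exact: le_trans (ler_norm _) hn.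
Qed.

(** The sets along which the integrals tend to zero form a Dynkin system. Complements and finite
    disjoint unions are linear; for countable unions the integral of the majorant [H] over the tail
    is small uniformly in [k]. Hence a generating class stable under intersection suffices. *)
Lemma weak_cvg0_induction (G : set (set T)) (g : nat -> T -> R) :
  (forall k, measurable_fun setT (g k)) -> (forall k z, (`|g k z|%:E <= H z)%E) ->
  @measurable _ T = <<s G >> -> setI_closed G ->
  let P A := (\int[mu]_(z in A `&` D) g k z)%R @[k --> \oo] --> (0 : R) in
  P setT -> G `<=` P -> forall A, measurable A -> P A.
Proof.
move=> mg gH GE GI P PT GP A mA.
have ig k B : measurable B -> mu.-integrable (B `&` D) (EFin \o g k).
  by move=> mB; exact: integrable_dominated.
have setU2 k B C : measurable B -> measurable C -> B `&` C = set0 ->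
    (\int[mu]_(z in (B `|` C) `&` D) g k z =
     \int[mu]_(z in B `&` D) g k z + \int[mu]_(z in C `&` D) g k z)%R.
  move=> mB mC BC; rewrite setIUl Rintegral_setU //; try exact: measurableI.
    by rewrite -setIUl; apply: ig; exact: measurableU.
  apply/disj_setPS => z [[Bz _] [Cz _]]; have : (B `&` C) z by []. by rewrite BC.
apply: (dynkin_induction GE GI PT GP) => [B mB PB|F mF tF PF|]; last by rewrite -GE.
  have E k : (\int[mu]_(z in ~` B `&` D) g k z = \int[mu]_(z in setT `&` D) g k z -
      \int[mu]_(z in B `&` D) g k z)%R.
    rewrite -(setUv B) setU2 // ?setICr //; last exact: measurableC.
    by rewrite addrC addKr.
  rewrite /P; under eq_fun do rewrite E.
  by have h := cvgB PT PB; rewrite subrr in h; exact: h.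
have PV n : P (\big[setU/set0]_(i < n) F i).
  elim: n => [|n IH].
    rewrite /P big_ord0; under eq_fun do rewrite set0I Rintegral_set0.
    exact: cvg_cst.
  have mV : measurable (\big[setU/set0]_(i < n) F i) by apply: bigsetU_measurable.
  rewrite /P big_ord_recr /=.
  have VF : \big[setU/set0]_(i < n) F i `&` F n = set0.
    rewrite big_distrl /=; apply: big1 => i _.
    by move/trivIsetP : tF => /(_ i n Logic.I Logic.I); apply; rewrite neq_ltn ltn_ord.
  under eq_fun do rewrite setU2 //.
  by have h := cvgD IH (PF n); rewrite addr0 in h; exact: h.
apply/cvgr0Pnorm_le => e e0; have e20 : 0 < e / 2 by rewrite divr_gt0.
have [n hn] := small_tail mF e20.
have /cvgr0Pnorm_le /(_ _ e20) := PV n.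
apply: filterS => k hk.
pose V := \big[setU/set0]_(i < n) F i; pose U := \bigcup_k F k.
have mV : measurable V by apply: bigsetU_measurable.
have mU : measurable U by exact: bigcup_measurable.
have VU : V `<=` U.
  by rewrite /V; elim/big_ind : _ => [//|A' B AU BU|i _]; [rewrite subUset|exact: bigcup_sup].
have UE : U = V `|` (U `\` V).
  by rewrite setDUK.
rewrite -/U UE setU2 //; last 2 first.
- exact: measurableD.
- by apply/seteqP; split=> [z [? [_]]|].
apply: (le_trans (ler_normD _ _)); rewrite (splitr e) lerD //.
have mUVD : measurable (U `\` V) by exact: measurableD.
apply: (le_trans (le_normr_Rintegral _ (ig k _ mUVD))); first exact: measurableI.
rewrite -lee_fin; apply: le_trans hn; rewrite /Rintegral fineK; last first.
  rewrite ge0_fin_numE; last by apply: integral_ge0 => z _; rewrite lee_fin.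
  by have /integrableP[_] := ig k _ mUVD.
apply: ge0_le_integral => //; first exact: measurableI.
- apply/measurable_EFinP; apply: measurableT_comp => //; exact: measurable_funTS.
- exact: measurable_funTS.
Qed.

End weak_domination.

Section weak_domination_ae.
Context d (T : measurableType d) (R : realType) (mu : {measure set T -> \bar R}).
Variables (D : set T) (F : T -> \bar R).
Hypotheses (mD : measurable D) (mF : measurable_fun setT F) (F0 : forall z, (0 <= F z)%E)
  (FD : (\int[mu]_(z in D) F z < +oo)%E).

(** Test on [E], the set where [f > F]. There [f_ k - f <= F - f < 0], while the integral of
    [f_ k - f] over [E] within [D] tends to zero; so the positive function [f - F] has nonpositive
    integral and the set is null. *)
Let one_sided (f : T -> R) (f_ : nat -> T -> R) :
  measurable_fun setT f -> (forall k, measurable_fun setT (f_ k)) ->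
  (\int[mu]_(z in D) (`|f z|)%:E < +oo)%E ->
  (forall k z, (`|f_ k z|%:E <= F z)%E) ->
  (forall A, measurable A ->
    (\int[mu]_(z in A `&` D) (f_ k z - f z))%R @[k --> \oo] --> (0 : R)) ->
  mu ([set z | (F z < (f z)%:E)%E] `&` D) = 0%E.
Proof.
move=> mf mf_ fD fF cv; set E := [set z | _].
have mE : measurable E.
  rewrite -[E]setTI; apply: emeasurable_fun_lt => //; exact/measurable_EFinP.
have mED : measurable (E `&` D) by exact: measurableI.
pose phi z := f z - fine (F z).
have phi0 z : E z -> 0 < phi z.
  move=> Ez; rewrite subr_gt0 -lte_fin fineK //.
  by rewrite ge0_fin_numE //; apply: lt_trans (ltry (f z)).
have mphi : measurable_fun setT phi.
  apply: measurable_funB => //; exact: measurableT_comp.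
have If : mu.-integrable (E `&` D) (EFin \o f).
  apply: (integrable_dominated (H := fun z => (`|f z|)%:E)) => //.
  by apply/measurable_EFinP; exact: measurableT_comp.
have If_ k : mu.-integrable (E `&` D) (EFin \o f_ k).
  exact: (integrable_dominated mD mF).
have IF : mu.-integrable (E `&` D) (EFin \o (fun z => fine (F z))).
  apply: (integrable_dominated mD mF) => //; first exact: measurableT_comp.
  by move=> z; rewrite ger0_norm ?fine_ge0 //; case: (F z) (F0 z) => //= r _; rewrite leey.
have Iphi : mu.-integrable (E `&` D) (EFin \o phi).
  by apply: (integrableB mED If IF).
have phile : (\int[mu]_(z in E `&` D) phi z <= 0)%R.
  have : (0 <= - (\int[mu]_(z in E `&` D) phi z))%R.
    have [cvE <-] : cvgn (fun k => \int[mu]_(z in E `&` D) (f_ k z - f z))%R /\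
        limn (fun k => \int[mu]_(z in E `&` D) (f_ k z - f z))%R = 0.
      by split; [apply/cvg_ex; exists 0; exact: cv|apply/cvg_lim => //; exact: cv].
    apply: limr_le => //; apply: nearW => k.
    have -> : (- (\int[mu]_(z in E `&` D) phi z) = \int[mu]_(z in E `&` D) (-1 * phi z))%R.
      by rewrite RintegralZl // mulN1r.
    apply: le_Rintegral => //.
    - exact: (integrableB mED (If_ k) If).
    - have := integrableZl mED (-1) Iphi; by [].
    - move=> z [Ez _]; rewrite mulN1r /phi opprB lerB // -lee_fin fineK.
        by apply: le_trans (fF k z); rewrite lee_fin ler_norm.
      by rewrite ge0_fin_numE //; apply: lt_trans (ltry (f z)).
  by rewrite oppr_ge0.
have : (\int[mu]_(z in E `&` D) `|(phi z)%:E| = 0)%E.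
  apply/eqP; rewrite eq_le integral_ge0 ?andbT //.
  rewrite (eq_integral (EFin \o phi)); last first.
    by move=> z; rewrite inE => -[Ez _]; rewrite /= ger0_norm // ltW // phi0.
  rewrite -[leLHS]fineK; first by rewrite lee_fin.
  exact: integrable_fin_num.
move/ae_eq_integral_abs => /(_ mED).
have mphiED : measurable_fun (E `&` D) (EFin \o phi).
  by apply/measurable_EFinP; exact: measurable_funTS.
move=> /(_ mphiED) [N [mN N0 sN]].
apply/eqP; rewrite eq_le measure_ge0 andbT -N0; apply: le_measure; rewrite ?inE //.
apply: subset_trans sN => z [Ez Dz] /= h.
by have := h (conj Ez Dz) => -[pz]; have := phi0 z Ez; rewrite pz ltxx.
Qed.

Lemma ae_le_of_weak_cvg (f : T -> R) (f_ : nat -> T -> R) :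
  measurable_fun setT f -> (forall k, measurable_fun setT (f_ k)) ->
  (\int[mu]_(z in D) (`|f z|)%:E < +oo)%E ->
  (forall k z, (`|f_ k z|%:E <= F z)%E) ->
  (forall A, measurable A ->
    (\int[mu]_(z in A `&` D) (f_ k z - f z))%R @[k --> \oo] --> (0 : R)) ->
  mu ([set z | (F z < `|f z|%:E)%E] `&` D) = 0%E.
Proof.
move=> mf mf_ fD fF cv.
have h1 := one_sided mf mf_ fD fF cv.
have h2 : mu ([set z | (F z < (- f z)%:E)%E] `&` D) = 0%E.
  apply: (one_sided (f_ := fun k z => - f_ k z)).
  - exact: measurableT_comp.
  - by move=> k; exact: measurableT_comp.
  - by under eq_integral do rewrite normrN.
  - by move=> k z; rewrite normrN.
  - move=> A mA; have cA := cvgN (cv A mA); rewrite oppr0 in cA.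
    have mAD : measurable (A `&` D) by exact: measurableI.
    have I k : mu.-integrable (A `&` D) (EFin \o (fun z => f_ k z - f z)).
      have Ik := integrable_dominated mD mF F0 FD mA (mf_ k) (fF k).
      have If : mu.-integrable (A `&` D) (EFin \o f).
        apply: (integrable_dominated (H := fun z => (`|f z|)%:E)) => //.
        by apply/measurable_EFinP; exact: measurableT_comp.
      exact: (integrableB mAD Ik If).
    have NE k : (\int[mu]_(z in A `&` D) (- f_ k z - - f z) =
        - (\int[mu]_(z in A `&` D) (f_ k z - f z)))%R.
      rewrite -mulN1r -RintegralZl //.
      by apply: eq_Rintegral => z _; rewrite mulN1r opprB opprK addrC.
    by under eq_fun do rewrite NE; exact: cA.
apply/eqP; rewrite eq_le measure_ge0 andbT.
have mE (g : T -> R) : measurable_fun setT g -> measurable [set z | (F z < (g z)%:E)%E].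
  by move=> mg; rewrite -[X in measurable X]setTI; apply: emeasurable_fun_lt => //; exact/measurable_EFinP.
rewrite -[X in (_ <= X)%E](adde0 0)%E -{1}h1 -h2.
apply: le_trans (measureU2 _ _ _); last 2 first.
- by apply: measurableI => //; exact: mE.
- by apply: measurableI => //; apply: mE; exact: measurableT_comp.
apply: le_measure; rewrite ?inE.
- by apply: measurableI => //; apply: mE; exact: measurableT_comp.
- by apply: measurableU; apply: measurableI => //; apply: mE => //; exact: measurableT_comp.
move=> z [/= Fz Dz]; have [f0|f0] := ger0P (f z).
  by left; split => //=; rewrite -(ger0_norm f0).
by right; split => //=; rewrite -(ltr0_norm f0).
Qed.

End weak_domination_ae.

(** * The mollifier and the mass of its kernel *)

Section mollifier.
Context {R : realType} (d : nat).
Local Notation N := (1 + 2 * d)%N.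

(* A product of bumps in the coordinates of the inverse of [z] for the kinetic
   group law, so that [kernel] is a triangular product in its first variable. *)
Definition phi0 (z : pt R d) : R := bump (- tco z) *
  ((\prod_(i < d) bump (- xco z i + tco z * vcoord z i)) *
   \prod_(i < d) bump (- vcoord z i)).

Lemma phi0_ge0 z : 0 <= phi0 z.
Proof.
by rewrite mulr_ge0 ?bump_ge0 // mulr_ge0 // prodr_ge0 // => i _; exact: bump_ge0.
Qed.

Lemma sm_phi0 : sm phi0.
Proof.
apply: sm_mul; first by apply: sm_bump; apply: sm_opp; exact: sm_tco.
apply: sm_mul; apply: sm_prod => i; apply: sm_bump.
  apply: sm_add; first by apply: sm_opp; exact: sm_xco.
  by apply: sm_mul; [exact: sm_tco|exact: sm_vcoord].
by apply: sm_opp; exact: sm_vcoord.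
Qed.

Let prod_eq0 (F : 'I_d -> R) i : F i = 0 -> \prod_(i < d) F i = 0.
Proof. by move=> Fi; rewrite (bigD1 i) //= Fi mul0r. Qed.

Lemma supported_phi0 : supported 2 phi0.
Proof.
move=> z [j]; rewrite (tnth_nth 0).
have [t1|t1] := ltP 1 `|tco z|; first by rewrite /phi0 bump_out ?mul0r ?normrN.
have [v1|nv] := pselect (exists i : 'I_d, 1 < `|vcoord z i|).
  move: v1 => [i v1] _; rewrite /phi0 [X in _ * (_ * X)](@prod_eq0 _ i _) ?mulr0 //.
  by rewrite bump_out // normrN.
have v1 (i : 'I_d) : `|vcoord z i| <= 1.
  by rewrite leNgt; apply/negP => h; apply: nv; exists i.
have : (j < N)%N by exact: ltn_ord.
move: (nat_of_ord j); apply: phase_index => [|i id|i id].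
- by rewrite -/(tco z) => h; move: t1; rewrite leNgt; rewrite (lt_trans _ h) // ltr1n.
- rewrite -[nth _ _ _]/(xco z i) => h.
  rewrite /phi0 [X in _ * (X * _)](@prod_eq0 _ (Ordinal id) _) ?mul0r ?mulr0 //.
  rewrite bump_out //=; have tv : `|tco z * vcoord z i| <= 1.
    by rewrite normrM -[leRHS]mulr1; apply: ler_pM => //; exact: (v1 (Ordinal id)).
  have := lerB_normD (- xco z i) (tco z * vcoord z i); rewrite normrN; lra.
- rewrite -[nth _ _ _]/(vcoord z i) => h; have := v1 (Ordinal id) => /=.
  by rewrite leNgt (lt_trans _ h) // ltr1n.
Qed.

End mollifier.

Section kernel.
Context {R : realType} (d : nat) (a b sig tau : R).
Local Notation N := (1 + 2 * d)%N.
Hypotheses (sig0 : 0 < sig) (tau0 : 0 < tau).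
Hypothesis abd : a * (1 + d%:R) + b * (2 * d%:R) = 1.
Hypothesis sigtau : sig ^+ (1 + d) * tau ^+ (2 * d) = 1.
Local Notation lam := (lam a sig).
Local Notation eta := (eta b tau).
Local Notation kinr := (@kinr R d a b sig tau).
Local Notation kball := (@kball R d a b sig tau).
Local Notation kernel := (@kernel R d a b sig tau).

Lemma supported_kinr (phi : pt R d -> R) z r w : supported 2 phi -> ~ kball r (z, w) ->
  phi (kinr z r w) = 0.
Proof.
move=> sphi nB; apply: sphi; apply: contra_notP nB => nE k.
rewrite -[nth _ _ _]/(nth 0 (kinr z r w) k).
have [kN|Nk] := ltnP k N; last by rewrite nth_default ?size_tuple // normr0.
rewrite -(tnth_nth 0 (kinr z r w) (Ordinal kN)) leNgt; apply/negP => h.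
by apply: nE; exists (Ordinal kN).
Qed.

Lemma measurable_kernel (phi : pt R d -> R) r : sm phi ->
  measurable_fun setT (fun zw : pt R d * pt R d => kernel phi zw.1 r zw.2).
Proof.
move=> sphi; have mk := measurableT_comp (measurable_sm sphi) (@measurable_kinr R d a b sig tau r).
exact: (measurable_funM (measurable_cst r^-1) mk).
Qed.

Lemma kernel_phi0_ge0 z r w : 0 < r -> 0 <= kernel (@phi0 R d) z r w.
Proof. by move=> r0; rewrite mulr_ge0 ?phi0_ge0 // invr_ge0 ltW. Qed.

(** The mass is taken in the center [z], with [w] fixed, since the kernel is later integrated
    against indicators in [z]. The shape of [phi0] makes each factor a bump in one coordinate of
    [z], centered at a point depending only on [w] and on the time of [z]. *)
Lemma integral_kernel_phi0 r w : 0 < r ->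
  (\int[mun N]_z (kernel (@phi0 R d) z r w)%:E = 1)%E.
Proof.
move=> r0; have l0 := lam_gt0 a sig0 r0; have e0 := eta_gt0 b tau0 r0.
have le0 : 0 < lam r * eta r by exact: mulr_gt0.
pose u0 t := (lam r)^-1 * bump ((t - tco w) / lam r).
pose u t j s := if (j < d)%N
  then (lam r * eta r)^-1 * bump ((s - (xco w j + (t - tco w) * vcoord w j)) / (lam r * eta r))
  else (eta r)^-1 * bump ((s - vcoord w (j - d)%N) / eta r).
have P (c : R) (F : 'I_d -> R) : c ^+ d * \prod_(i < d) F i = \prod_(i < d) (c * F i).
  by rewrite big_split /= prodr_const card_ord.
have E z : kernel (@phi0 R d) z r w =
    u0 (nth 0 z 0%N) * \prod_(j < 2 * d) u (nth 0 z 0%N) j (nth 0 z j.+1).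
  rewrite (prod_phase d (fun j => u (nth 0 z 0%N) j.-1 (nth 0 z j))).
  have -> : \prod_(i < d) u (nth 0 z 0%N) (xidx i).-1 (nth 0 z (xidx i)) =
     (lam r * eta r)^-1 ^+ d *
     \prod_(i < d) bump (- xco (kinr z r w) i + tco (kinr z r w) * vcoord (kinr z r w) i).
    rewrite P; apply: eq_bigr => i _.
    rewrite /u ltn_ord xco_kin // tco_kin vcoord_kin // -/(tco z) -/(xco z i).
    by congr (_ * bump _); field; rewrite !gt_eqF.
  have -> : \prod_(i < d) u (nth 0 z 0%N) (vidx d i).-1 (nth 0 z (vidx d i)) =
     (eta r)^-1 ^+ d * \prod_(i < d) bump (- vcoord (kinr z r w) i).
    rewrite P; apply: eq_bigr => i _.
    have -> : (vidx d i).-1 = (d + i)%N by rewrite /vidx; lia.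
    rewrite /u ltnNge leq_addr /= addKn vcoord_kin // -/(vcoord z i).
    by congr (_ * bump _); field; rewrite gt_eqF.
  rewrite /u0 -/(tco z) /kernel /phi0 tco_kin.
  (* The prefactor is distributed over the bumps by the volume identity, so that each becomes
     normalized. *)
  have -> : r^-1 = (lam r)^-1 * (lam r * eta r)^-1 ^+ d * (eta r)^-1 ^+ d.
    rewrite -{1}(lam_eta_volume abd sigtau r0).
    by move: (lam r) (eta r) (lam r * eta r) => x1 x3 x2; rewrite !invfM !exprVn.
  have -> : - ((tco w - tco z) / lam r) = (tco z - tco w) / lam r by ring.
  move: (bump _) (\prod_(i < d) _) (\prod_(i < d) _) => x1 x2 x3.
  ring.
under eq_integral do rewrite E.
have mu0 : measurable_fun setT u0.
  apply: measurable_funM => //; apply: (measurableT_comp measurable_bump).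
  by apply: measurable_funM => //; exact: measurable_funB.
have mu (t : R) j : measurable_fun setT (u t j).
  rewrite /u; case: (j < d)%N; apply: measurable_funM => //;
    apply: (measurableT_comp measurable_bump); apply: measurable_funM => //;
    exact: measurable_funB.
rewrite (integral_mun_triangular mu0 mu); last 3 first.
- by move=> t; rewrite mulr_ge0 ?bump_ge0 // invr_ge0 ltW.
- by move=> t j s; rewrite /u; case: ifP => _; rewrite mulr_ge0 ?bump_ge0 // invr_ge0 ltW.
- rewrite (_ : (fun z => _) = fun z => kernel (@phi0 R d) z r w); last first.
    by apply/funext => z; rewrite E.
  exact: (measurableT_comp (measurable_kernel r (@sm_phi0 R d)) (pair2_measurable w)).
rewrite -[RHS](integral_bump_affine (tco w) l0); apply: eq_integral => t _.
rewrite big1 ?mule1 // => j _; rewrite /u; case: (_ < d)%N; exact: integral_bump_affine.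
Qed.

Lemma measurable_kernel1 (phi : pt R d -> R) r z : sm phi ->
  measurable_fun setT (kernel phi z r).
Proof.
move=> sphi; exact: (measurableT_comp (measurable_kernel r sphi) (pair1_measurable z)).
Qed.

Lemma measurable_kernel2 (phi : pt R d -> R) r w : sm phi ->
  measurable_fun setT (fun z => kernel phi z r w).
Proof.
move=> sphi; exact: (measurableT_comp (measurable_kernel r sphi) (pair2_measurable w)).
Qed.

End kernel.

(** * Boxes in Euclidean coordinates and local integrability *)

Section boxes.
Context {R : realType} (n : nat).
Local Notation pt := (n.-tuple R).

Definition cbox (M : R) : set pt := [set z | forall k, `|nth 0 z k| <= M].

Definition obox (c e : nat -> R) : set pt :=
  [set z | forall k, (k < n)%N -> c k < nth 0 z k < e k].

Lemma measurable_cbox M : measurable (cbox M).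
Proof.
rewrite (_ : cbox M = \bigcap_k [set z : pt | `|nth 0 z k| <= M]); last first.
  by apply/seteqP; split=> [z h k _|z h k]; exact: h.
apply: bigcapT_measurable => k.
have mk : measurable_fun setT (fun z : pt => `|nth 0 z k|).
  by apply: measurableT_comp => //; exact: measurable_nth.
have := mk measurableT `]-oo, M]%classic (measurable_itv _).
by rewrite setTI; congr (measurable _); apply/seteqP; split => z /=; rewrite in_itv.
Qed.

Lemma measurable_obox c e : measurable (obox c e).
Proof.
rewrite (_ : obox c e = \bigcap_k [set z : pt | (k < n)%N -> c k < nth 0 z k < e k]); last first.
  by apply/seteqP; split=> [z h k _|z h k]; exact: h.
apply: bigcapT_measurable => k; have [kn|kn] := ltnP k n; last first.
  by rewrite (_ : [set _ | _] = setT) //; apply/seteqP; split.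
have := @measurable_nth R n k measurableT `]c k, e k[%classic (measurable_itv _).
rewrite setTI; congr (measurable _); apply/seteqP; split => z /=; rewrite in_itv //=.
exact.
Qed.

Lemma mun_cbox M : 0 <= M -> (mun n (cbox M) < +oo)%E.
Proof.
move=> M0; have mB := measurable_cbox M.
rewrite -[cbox M]setIT -(integral_indic (mun n) measurableT mB).
pose u (j : nat) (s : R) := near_ind M 0 s.
rewrite (_ : integral _ _ _ = \int[mun n]_z (\prod_(j < n) u j (nth 0 z j))%:E)%E.
  rewrite (integral_mun_prod n (u := u)).
  - rewrite (eq_bigr (fun=> (2 * M)%:E)) ?prodEFin ?ltry // => j _.
    exact: integral_near_ind.
  - by move=> j; exact: measurable_near_ind.
  - by move=> j x; exact: near_ind_ge0.
apply: eq_integral => z _; congr EFin; rewrite indicE /u.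
have [h|h] := pselect (cbox M z).
  by rewrite mem_set // big1 // => j _; rewrite /near_ind subr0 h.
rewrite memNset //; have [k [kn kM]] : exists k, (k < n)%N /\ M < `|nth 0 z k|.
  apply: contrapT => nE; apply: h => k; rewrite leNgt; apply/negP => kM; apply: nE.
  exists k; split=> //; rewrite ltnNge; apply/negP => nk.
  by move: kM; rewrite nth_default ?size_tuple // normr0 ltNge M0.
by rewrite (bigD1 (Ordinal kn)) //= /near_ind subr0 leNgt kM mul0r.
Qed.

Lemma mun_hyperplane k x : (k < n)%N -> mun n [set z : pt | nth 0 z k = x] = 0%E.
Proof.
move=> kn; pose u (j : nat) (s : R) : R := if j == k then near_ind 0 x s else 1.
have mu1 j : measurable_fun setT (u j).
  by rewrite /u; case: (j == k) => //; exact: measurable_near_ind.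
have mE : measurable [set z : pt | nth 0 z k = x].
  have := @measurable_nth R n k measurableT [set x] (measurable_set1 x).
  by rewrite setTI.
rewrite -[X in mun n X]setIT -(integral_indic (mun n) measurableT mE).
rewrite (_ : integral _ _ _ = \int[mun n]_z (\prod_(j < n) u j (nth 0 z j))%:E)%E.
  rewrite (integral_mun_prod n mu1); last first.
    by move=> j s; rewrite /u; case: ifP => // _; exact: near_ind_ge0.
  rewrite (bigD1 (Ordinal kn)) //= [X in (X * _)%E](_ : _ = 0%E) ?mul0e //.
  by rewrite /u eqxx integral_near_ind // mulr0.
apply: eq_integral => z _; congr EFin; rewrite (bigD1 (Ordinal kn)) //= big1.
  rewrite mulr1 /u eqxx indicE /near_ind normr_le0 subr_eq0.
  have [zx|/eqP zx] := eqVneq (nth 0 z k) x; first by rewrite mem_set.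
  by rewrite memNset.
by move=> j; rewrite -val_eqE /u /= => /negPf ->.
Qed.

Lemma locally_integrable (f : pt -> R) (p M : R) : 0 < p -> 0 <= M ->
  measurable_fun setT f -> 1 <= p ->
  (\int[mun n]_z (`|f z| `^ p)%:E < +oo)%E -> (\int[mun n]_(z in cbox M) (`|f z|)%:E < +oo)%E.
Proof.
move=> p0 M0 mf p1 fp; have mB := measurable_cbox M.
have mfp : measurable_fun setT (fun z => `|f z| `^ p).
  by apply: (measurableT_comp (measurable_powR _)); exact: measurableT_comp.
(* Pointwise [|f| <= 1 + |f|^p], and the box has finite measure. *)
apply: (@le_lt_trans _ _ (\int[mun n]_(z in cbox M) (1 + (`|f z| `^ p)%:E)))%E.
  apply: ge0_le_integral => //.
  - apply/measurable_EFinP; apply: measurableT_comp => //; exact: measurable_funTS.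
  - apply: emeasurable_funD => //; apply/measurable_EFinP; exact: measurable_funTS.
  - move=> z _; rewrite -EFinD lee_fin; have [h|h] := leP `|f z| 1.
      by apply: le_trans h _; rewrite lerDl powR_ge0.
    apply: (@le_trans _ _ (`|f z| `^ p)); last by rewrite lerDr.
    by rewrite -{1}[`|f z|]powRr1 //; apply: ler_powR => //; exact: ltW.
rewrite ge0_integralD //; last by apply/measurable_EFinP; exact: measurable_funTS.
rewrite integral_cst // mul1e lte_add_pinfty //; first exact: mun_cbox.
apply: le_lt_trans fp; apply: ge0_subset_integral => //; exact/measurable_EFinP.
Qed.

End boxes.

Lemma powR_small (R : realType) (c e : R) : 0 < c -> 0 < e ->
  exists2 r0 : R, 0 < r0 & forall r, 0 < r -> r <= r0 -> r `^ c <= e.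
Proof.
move=> c0 e0; exists (e `^ c^-1); first exact: powR_gt0.
move=> r r0 h.
rewrite -(@powRr1 _ e) ?(ltW e0) // -(mulVf (lt0r_neq0 c0)) powRrM.
by apply: ge0_ler_powR; rewrite ?nnegrE ?powR_ge0 ?(ltW c0) ?(ltW r0).
Qed.

(** * Kinetic balls compared with Euclidean boxes *)

Section kball_geometry.
Context {R : realType} (d : nat) (a b sig tau : R).
Local Notation N := (1 + 2 * d)%N.
Hypotheses (sig0 : 0 < sig) (tau0 : 0 < tau).
Hypotheses (a0 : 0 < a) (b0 : 0 < b).
Local Notation lam := (lam a sig).
Local Notation eta := (eta b tau).
Local Notation kinr := (@kinr R d a b sig tau).
Local Notation kball := (@kball R d a b sig tau).

(** A bound for the displacement of every coordinate inside a kinetic ball: the first three terms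
    cover time, velocity and the intrinsic space size, and the last is the drift accumulated at
    speed at most [V]. *)
Definition kspread V r := 2 * lam r + 2 * eta r + 2 * lam r * eta r + 2 * lam r * V.

Lemma kball_spread r V (z w : pt R d) : 0 < r -> 0 <= V ->
  (forall i, (i < d)%N -> `|vcoord z i| <= V) ->
  kball r (z, w) -> forall k, `|nth 0 w k - nth 0 z k| <= kspread V r.
Proof.
move=> r0 V0 zV /(kball_bounds sig0 tau0 r0)[ht hx hv] k.
have := lam_gt0 a sig0 r0; have := eta_gt0 b tau0 r0.
rewrite /kspread; move: (lam r) (eta r) ht hx hv => l e ht hx hv e0 l0.
have le0 : 0 < l * e by exact: mulr_gt0.
have lV0 : 0 <= l * V by apply: mulr_ge0 => //; exact: ltW.
have [kN|Nk] := ltnP k N; last first.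
  by rewrite !nth_default ?size_tuple // subrr normr0; lra.
move: k kN; apply: phase_index => [|i id|i id].
- by rewrite -![nth _ _ _]/(tco _); apply: le_trans ht _; lra.
- rewrite -![nth _ _ _]/(xco _ i).
  have -> : xco w i - xco z i = (xco w i - xco z i - (tco w - tco z) * vcoord z i)
    + (tco w - tco z) * vcoord z i by ring.
  apply: (le_trans (ler_normD _ _)); have h1 := hx i id.
  have : `|(tco w - tco z) * vcoord z i| <= (2 * l) * V.
    by rewrite normrM; apply: ler_pM => //; exact: zV.
  move: h1; move: `|_| `|_| => x y; lra.
- by rewrite -![nth _ _ _]/(vcoord _ i); apply: le_trans (hv i id) _; lra.
Qed.

Lemma kball_vcoord r V (z w : pt R d) : 0 < r ->
  (forall i, (i < d)%N -> `|vcoord w i| <= V) -> kball r (z, w) ->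
  forall i, (i < d)%N -> `|vcoord z i| <= V + 2 * eta r.
Proof.
move=> r0 wV /(kball_bounds sig0 tau0 r0)[_ _ hv] i id.
have -> : vcoord z i = vcoord w i - (vcoord w i - vcoord z i) by ring.
by apply: (le_trans (ler_normB _ _)); apply: lerD; [exact: wV|exact: hv].
Qed.

Lemma kspread_small V e : 0 <= V -> 0 < e -> exists2 r0, 0 < r0 &
  forall r, 0 < r -> r <= r0 -> kspread (V + 2 * eta r) r < e.
Proof.
(* If [lam r] and [eta r] are at most [s <= 1], then [kspread (V + 2 * eta r) r] is at most
   [s (10 + 2 V)], which is strictly below [s (20 + 2 V) <= e]. The velocity bound is
   [V + 2 * eta r] because the drift involves the center of the ball whereas [V] bounds the other
   point. *)
move=> V0 e0; pose s := Num.min 1 (e / (20 + 2 * V)).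
have D0 : 0 < 20 + 2 * V by lra.
have s0 : 0 < s by rewrite lt_min ltr01 divr_gt0.
have [r1 r10 h1] := powR_small a0 (divr_gt0 s0 sig0).
have [r2 r20 h2] := powR_small b0 (divr_gt0 s0 tau0).
exists (Num.min r1 r2); first by rewrite lt_min r10.
move=> r r0; rewrite le_min => /andP[rr1 rr2].
have := lam_gt0 a sig0 r0; have := eta_gt0 b tau0 r0.
have : lam r <= s by have := h1 r r0 rr1; rewrite ler_pdivlMr // mulrC.
have : eta r <= s by have := h2 r r0 rr2; rewrite ler_pdivlMr // mulrC.
have s1 : s <= 1 by rewrite ge_min lexx.
have sV : s * (20 + 2 * V) <= e by rewrite -ler_pdivlMr // ge_min lexx orbT.
rewrite /kspread; move: (lam r) (eta r) => l t ts ls t0 l0.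
have lt : l * t <= s by rewrite -[leRHS]mulr1; apply: ler_pM => //; lra.
have lV : l * V <= s * V by exact: ler_wpM2r.
nra.
Qed.

Lemma kspread_mono V W r : 0 < r -> r <= 1 -> 0 <= V -> V <= W -> kspread V r <= kspread W 1.
Proof.
move=> r0 r1 V0 VW; have := lam_gt0 a sig0 r0; have := eta_gt0 b tau0 r0.
have L c s : 0 < c -> 0 < s -> s * r `^ c <= s * 1 `^ c.
  move=> c0 s0; rewrite ler_pM2l //; apply: ge0_ler_powR => //; rewrite ?nnegrE ltW //.
have h1 : lam r <= lam 1 by exact: L.
have h2 : eta r <= eta 1 by exact: L.
rewrite /kspread; move: (lam r) (eta r) (lam 1) (eta 1) h1 h2 => l e l1 e1 h1 h2 e0 l0.
by apply: lerD; [apply: lerD; [apply: lerD|apply: ler_pM => //]|apply: ler_pM => //]; lra.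
Qed.

Lemma kball_cbox r M (z w : pt R d) : 0 < r -> 0 <= M -> cbox M z -> kball r (z, w) ->
  cbox (M + kspread M r) w.
Proof.
move=> r0 M0 zM zw k; have h := kball_spread r0 M0 (fun i _ => zM _) zw k.
have -> : nth 0 w k = nth 0 z k + (nth 0 w k - nth 0 z k) by ring.
by apply: (le_trans (ler_normD _ _)); apply: lerD; [exact: zM|exact: h].
Qed.

Lemma kball_mono r r' (z w : pt R d) : 0 < r -> r <= r' -> kball r (z, w) -> kball r' (z, w).
Proof.
move=> r0 rr h k; have r'0 : 0 < r' by apply: lt_le_trans rr.
have l0 := lam_gt0 a sig0 r0; have e0 := eta_gt0 b tau0 r0.
have l'0 := lam_gt0 a sig0 r'0; have e'0 := eta_gt0 b tau0 r'0.
have L c s : 0 < c -> 0 < s -> s * r `^ c <= s * r' `^ c.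
  move=> c0 s0; rewrite ler_pM2l //; apply: ge0_ler_powR => //; rewrite ?nnegrE ltW //.
have ll : lam r <= lam r' by exact: L.
have ee : eta r <= eta r' by exact: L.
have D (x s s' : R) : 0 < s -> s <= s' -> `|x / s| <= 2 -> `|x / s'| <= 2.
  move=> s0 ss; have s'0 : 0 < s' by exact: lt_le_trans ss.
  rewrite !normrM !normfV (gtr0_norm s0) (gtr0_norm s'0) !ler_pdivrMr // => hx.
  by apply: le_trans hx _; rewrite ler_pM2l.
have [kN|Nk] := ltnP k N; last by rewrite nth_default ?size_tuple // normr0.
move: k kN; apply: phase_index => [|i id|i id].
- by have := h tidx; rewrite -![nth _ _ _]/(tco _) !tco_kin; exact: D.
- have := h (xidx i); rewrite -![nth _ _ _]/(xco _ i) !xco_kin //; apply: D.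
    exact: mulr_gt0.
  by apply: ler_pM => //; exact: ltW.
- by have := h (vidx d i); rewrite -![nth _ _ _]/(vcoord _ i) !vcoord_kin //; exact: D.
Qed.

End kball_geometry.

(** * Mollification and its weak convergence on boxes *)

Section mollification.
Context {R : realType} (d : nat) (a b sig tau : R).
Local Notation N := (1 + 2 * d)%N.
Hypotheses (sig0 : 0 < sig) (tau0 : 0 < tau).
Hypotheses (a0 : 0 < a) (b0 : 0 < b).
Hypothesis abd : a * (1 + d%:R) + b * (2 * d%:R) = 1.
Hypothesis sigtau : sig ^+ (1 + d) * tau ^+ (2 * d) = 1.
Local Notation lam := (lam a sig).
Local Notation eta := (eta b tau).
Local Notation kball := (@kball R d a b sig tau).
Local Notation kernel := (@kernel R d a b sig tau (@phi0 R d)).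
Local Notation phi0 := (@phi0 R d).
Variable f : pt R d -> R.
Hypothesis mf : measurable_fun setT f.
Hypothesis locf : forall M, 0 <= M -> (\int[mun N]_(w in @cbox R N M) (`|f w|)%:E < +oo)%E.

Lemma cbox_exists (z : pt R d) : exists2 M, 0 <= M & cbox M z.
Proof.
exists (\sum_(j < N) `|nth 0 z j|); first exact: sumr_ge0.
move=> k; have [kN|Nk] := ltnP k N.
  by rewrite (bigD1 (Ordinal kN)) //= lerDl; apply: sumr_ge0.
by rewrite nth_default ?size_tuple // normr0; apply: sumr_ge0.
Qed.

Lemma kernel_out z r w : ~ kball r (z, w) -> kernel z r w = 0.
Proof. by move=> h; rewrite /kernel (supported_kinr (@supported_phi0 R d) h) mulr0. Qed.

Lemma integrable_mul_supported (h : pt R d -> R) z r C : 0 < r ->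
  measurable_fun setT h -> (forall w, `|h w| <= C) -> (forall w, ~ kball r (z, w) -> h w = 0) ->
  (mun N).-integrable setT (EFin \o (fun w => f w * h w)).
Proof.
move=> r0 mh hC hz; have [M M0 zM] := cbox_exists z.
have l0 := lam_gt0 a sig0 r0; have e0 := eta_gt0 b tau0 r0.
have S0 : 0 <= M + kspread a b sig tau M r.
  rewrite /kspread; move: (lam r) (eta r) l0 e0 => x y x0 y0.
  by rewrite !addr_ge0 ?mulr_ge0 // ltW.
have mB : measurable (@cbox R N (M + kspread a b sig tau M r)) by exact: measurable_cbox.
have C0 : 0 <= C by exact: le_trans (normr_ge0 _) (hC z).
apply/integrableP; split.
  by apply/measurable_EFinP; exact: measurable_funM.
apply: (@le_lt_trans _ _ (\int[mun N]_(w in @cbox R N (M + kspread a b sig tau M r)) (C%:E * `|f w|%:E)))%E.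
  rewrite [leRHS]integral_mkcond; apply: ge0_le_integral => //.
  - apply/measurable_EFinP; apply: measurableT_comp => //; exact: measurable_funM.
  - apply/(measurable_restrictT _ mB); apply/measurable_EFinP.
    apply: measurable_funM => //; apply: measurableT_comp => //; exact: measurable_funTS.
  - move=> w _; rewrite patchE /=; case: ifPn => [_|/negP nw].
      by rewrite -EFinM lee_fin normrM mulrC ler_wpM2r.
    rewrite hz ?mulr0 ?normr0 // => zw; apply: nw; rewrite inE.
    exact: (kball_cbox sig0 tau0 r0 M0 zM zw).
rewrite ge0_integralZl_EFin //; last first.
  apply/measurable_EFinP; apply: measurableT_comp => //; exact: measurable_funTS.
by rewrite lte_mul_pinfty // ?lee_fin //; exact: locf.
Qed.

Definition mollify r z : R := (\int[mun N]_w (f w * kernel z r w))%R.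

Lemma integrable_kernel r z : 0 < r ->
  (mun N).-integrable setT (EFin \o (fun w => f w * kernel z r w)).
Proof.
move=> r0; have [C C0 phiC] := supported_bounded (@sm_phi0 R d) (@supported_phi0 R d).
apply: (@integrable_mul_supported _ z r (r^-1 * C)) => //.
- exact: measurable_kernel1 (@sm_phi0 R d).
- by move=> w; rewrite normrM gtr0_norm ?invr_gt0 // ler_pM2l ?invr_gt0.
- exact: kernel_out.
Qed.

Lemma mollifyE r z : 0 < r -> ((mollify r z)%:E = \int[mun N]_w (f w * kernel z r w)%:E)%E.
Proof.
by move=> r0; rewrite fineK //; apply: integrable_fin_num => //; exact: integrable_kernel.
Qed.

Lemma measurable_mollify r : measurable_fun setT (mollify r).
Proof.
apply: measurableT_comp => //.
have m : measurable_fun setT (fun zw : pt R d * pt R d => (f zw.2 * kernel zw.1 r zw.2)%:E).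
  apply/measurable_EFinP; apply: measurable_funM.
    exact: (measurableT_comp mf measurable_snd).
  exact: (measurable_kernel a b sig tau r (@sm_phi0 R d)).
set F := fun zw : pt R d * pt R d => _ in m.
rewrite [X in measurable_fun _ X](_ : _ = fun z : pt R d =>
  (\int[mun N]_w F^\+ (z, w) - \int[mun N]_w F^\- (z, w))%E); last first.
  apply/funext => z; rewrite [LHS]integralE.
  by congr (_ - _)%E; apply: eq_integral => w _; rewrite ?funeposE ?funenegE.
have mp := measurable_fun_fubini_tonelli_F (m2 := mun N) (F^\+)%E (measurable_funepos m)
  (funepos_ge0 F).
have mn := measurable_fun_fubini_tonelli_F (m2 := mun N) (F^\-)%E (measurable_funeneg m)
  (funeneg_ge0 F).
exact: (emeasurable_funB mp mn).
Qed.

Section window.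
Variables (U : set (pt R d)) (M : R).
Hypotheses (mU : measurable U) (M0 : 0 <= M) (UM : U `<=` @cbox R N M).

Let M' := M + kspread a b sig tau (M + 2 * eta 1) 1.

Let e1 : 0 < eta 1. Proof. exact: eta_gt0. Qed.

Let MV : M <= M + 2 * eta 1. Proof. by rewrite lerDl mulr_ge0 // ltW. Qed.

Let M'M : M <= M'.
Proof.
have l1 : 0 < lam 1 by exact: lam_gt0.
rewrite lerDl /kspread; move: (lam 1) (eta 1) l1 e1 MV => x y x0 y0 _.
by rewrite !addr_ge0 ?mulr_ge0 ?addr_ge0 ?mulr_ge0 // ltW.
Qed.

Let M'0 : 0 <= M'. Proof. exact: le_trans M0 M'M. Qed.

(** The adjoint of mollification applied to the indicator of [U]. Weak convergence of [mollify] on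
    [U] is thereby reduced to pointwise convergence of [window] to the indicator. *)
Definition window r w : \bar R := (\int[mun N]_z (\1_U z * kernel z r w)%:E)%E.

Lemma window_ge0 r w : 0 < r -> (0 <= window r w)%E.
Proof.
move=> r0; apply: integral_ge0 => z _; rewrite lee_fin mulr_ge0 ?indicE //.
exact: kernel_phi0_ge0.
Qed.

Lemma measurable_window_integrand r :
  measurable_fun setT (fun zw : pt R d * pt R d => \1_U zw.1 * kernel zw.1 r zw.2).
Proof.
apply: measurable_funM; last exact: (measurable_kernel a b sig tau r (@sm_phi0 R d)).
exact: (measurableT_comp (measurable_indic mU) measurable_fst).
Qed.

Lemma window_le1 r w : 0 < r -> (window r w <= 1)%E.
Proof.
move=> r0; rewrite -(integral_kernel_phi0 sig0 tau0 abd sigtau w r0).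
apply: ge0_le_integral => //.
- by move=> z _; rewrite lee_fin mulr_ge0 ?indicE //; exact: kernel_phi0_ge0.
- apply/measurable_EFinP.
  exact: (measurableT_comp (measurable_window_integrand r) (pair2_measurable w)).
- by apply/measurable_EFinP; exact: (measurable_kernel2 a b sig tau r w (@sm_phi0 R d)).
- move=> z _; rewrite lee_fin ler_piMl ?indicE //; first exact: kernel_phi0_ge0.
  by case: (z \in U).
Qed.

Lemma windowE r w : 0 < r -> window r w = (fine (window r w))%:E.
Proof.
move=> r0; rewrite fineK // ge0_fin_numE ?window_ge0 //.
exact: le_lt_trans (window_le1 w r0) (ltry _).
Qed.

Lemma measurable_window r : 0 < r -> measurable_fun setT (window r).
Proof.
move=> r0.
apply: (measurable_fun_fubini_tonelli_G (m1 := mun N)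
  (fun zw => (\1_U zw.1 * kernel zw.1 r zw.2)%:E)).
- by apply/measurable_EFinP; exact: measurable_window_integrand.
- by move=> zw; rewrite lee_fin mulr_ge0 ?indicE //; exact: kernel_phi0_ge0.
Qed.

Lemma window_out r w : 0 < r -> r <= 1 -> ~ @cbox R N M' w -> window r w = 0%E.
Proof.
move=> r0 r1 nw; apply: integral0_eq => z _; congr EFin; rewrite indicE.
have [Uz|Uz] := pselect (U z); last by rewrite memNset // mul0r.
rewrite kernel_out ?mulr0 // => zw; apply: nw.
have := kball_cbox sig0 tau0 r0 M0 (UM Uz) zw => h k; apply: le_trans (h k) _.
by rewrite lerD2l; exact: kspread_mono.
Qed.

Lemma mollify_window r : 0 < r -> r <= 1 ->
  (mun N).-integrable U (EFin \o mollify r) /\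
  (\int[mun N]_(z in U) (mollify r z)%:E = \int[mun N]_w (f w * fine (window r w))%:E)%E.
Proof.
move=> r0 r1.
pose F (zw : pt R d * pt R d) := (\1_U zw.1 * (f zw.2 * kernel zw.1 r zw.2))%:E.
have mF : measurable_fun setT F.
  apply/measurable_EFinP; apply: measurable_funM.
    exact: (measurableT_comp (measurable_indic mU) measurable_fst).
  apply: measurable_funM; last exact: (measurable_kernel a b sig tau r (@sm_phi0 R d)).
  exact: (measurableT_comp mf measurable_snd).
have mw w : measurable_fun setT (fun z => \1_U z * kernel z r w).
  exact: (measurableT_comp (measurable_window_integrand r) (pair2_measurable w)).
have w0 z w : 0 <= \1_U z * kernel z r w.
  by rewrite mulr_ge0 ?indicE //; exact: kernel_phi0_ge0.
have Fw w : (\int[mun N]_z F (z, w) = (f w * fine (window r w))%:E)%E.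
  rewrite EFinM -windowE // /window -integralZl //; first by apply: eq_integral => z _; rewrite -EFinM; congr EFin; rewrite /= mulrCA.
  apply/integrableP; split; first exact/measurable_EFinP.
  under eq_integral do rewrite gee0_abs ?lee_fin //.
  by apply: le_lt_trans (window_le1 w r0) (ltry _).
have IF : (mun N \x mun N)%E.-integrable setT F.
  apply/integrable21ltyP => //.
  apply: (@le_lt_trans _ _ (\int[mun N]_(w in @cbox R N M') `|f w|%:E))%E; last exact: locf.
  have mB : measurable (@cbox R N M') by exact: measurable_cbox.
  rewrite [leRHS]integral_mkcond; apply: ge0_le_integral => //.
  - by move=> w _; apply: integral_ge0.
  - apply: (measurable_fun_fubini_tonelli_G (m1 := mun N) (fun zw => `|F zw|)%E) => //.
    exact: measurableT_comp.
  - apply/(measurable_restrictT _ mB); apply/measurable_EFinP.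
    apply: measurableT_comp => //; exact: measurable_funTS.
  - move=> w _; rewrite patchE.
    have -> : (\int[mun N]_z `|F (z, w)| = `|f w|%:E * window r w)%E.
      rewrite /window -ge0_integralZl_EFin //; last 2 first.
      - by move=> z _; rewrite lee_fin.
      - by apply/measurable_EFinP.
      apply: eq_integral => z _; rewrite -EFinM /F /= mulrCA normrM; congr (_ * _)%:E.
      exact: ger0_norm.
    have [wB|wB] := boolP (w \in @cbox R N M').
      apply: (@le_trans _ _ (`|f w|%:E * 1)%E); last by rewrite mule1.
      by apply: lee_wpmul2l; [rewrite lee_fin|exact: window_le1].
    by rewrite window_out ?mule0 // => h; move/negP: wB; apply; rewrite inE.
have FU z : (\int[mun N]_w F (z, w))%E = ((EFin \o mollify r) \_ U) z.
  rewrite patchE /F; have [Uz|Uz] := boolP (z \in U).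
    by rewrite /= mollifyE //; apply: eq_integral => w _; rewrite indicE Uz mul1r.
  by rewrite integral0_eq // => w _; rewrite indicE (negbTE Uz) mul0r.
split.
  apply/(integrable_mkcond _ mU).
  by apply: eq_integrable (integrable_fubini_F IF) => // z _; exact: FU.
under [RHS]eq_integral do rewrite -Fw.
rewrite -(Fubini IF) integral_mkcond; apply: eq_integral => z _.
by rewrite -FU.
Qed.

Lemma integrable_window r : 0 < r -> r <= 1 ->
  (mun N).-integrable setT (EFin \o (fun w => f w * fine (window r w))).
Proof.
move=> r0 r1; have mB : measurable (@cbox R N M') by exact: measurable_cbox.
have mfw : measurable_fun setT (fun w => f w * fine (window r w)).
  by apply: measurable_funM => //; apply: measurableT_comp => //; exact: measurable_window.
apply/integrableP; split; first exact/measurable_EFinP.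
apply: (@le_lt_trans _ _ (\int[mun N]_(w in @cbox R N M') `|f w|%:E))%E; last exact: locf.
rewrite [leRHS]integral_mkcond; apply: ge0_le_integral => //.
- by apply/measurable_EFinP; exact: measurableT_comp.
- apply/(measurable_restrictT _ mB); apply/measurable_EFinP.
  apply: measurableT_comp => //; exact: measurable_funTS.
- move=> w _; rewrite patchE; have [wB|wB] := boolP (w \in @cbox R N M').
    rewrite /= lee_fin normrM ler_piMr // ger0_norm ?fine_ge0 ?window_ge0 //.
    by rewrite -lee_fin -windowE // window_le1.
  by rewrite /= window_out ?mulr0 ?normr0 // => h; move/negP: wB; apply; rewrite inE.
Qed.

Lemma window_inside (r : R) (w : pt R d) (V e : R) : 0 < r -> 0 <= V ->
  (forall i, (i < d)%N -> `|vcoord w i| <= V) -> kspread a b sig tau (V + 2 * eta r) r < e ->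
  (forall z : pt R d, (forall k, `|nth 0 w k - nth 0 z k| < e) -> U z) -> window r w = 1%E.
Proof.
move=> r0 V0 wV re wU; rewrite -(integral_kernel_phi0 sig0 tau0 abd sigtau w r0).
apply: eq_integral => z _; congr EFin; rewrite indicE.
have [zw|zw] := pselect (kball r (z, w)); last by rewrite kernel_out // mulr0.
rewrite mem_set ?mul1r //; apply: wU => k; apply: le_lt_trans re.
have e0 := eta_gt0 b tau0 r0.
apply: (kball_spread sig0 tau0 r0 _ _ zw k).
  by rewrite addr_ge0 // mulr_ge0 // ltW.
exact: (kball_vcoord sig0 tau0 r0 wV zw).
Qed.

Lemma window_outside (r : R) (w : pt R d) (V e : R) : 0 < r -> 0 <= V ->
  (forall i, (i < d)%N -> `|vcoord w i| <= V) -> kspread a b sig tau (V + 2 * eta r) r < e ->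
  (forall z : pt R d, (forall k, `|nth 0 w k - nth 0 z k| < e) -> ~ U z) -> window r w = 0%E.
Proof.
move=> r0 V0 wV re wU; apply: integral0_eq => z _; congr EFin; rewrite indicE.
have [zw|zw] := pselect (kball r (z, w)); last by rewrite kernel_out // mulr0.
rewrite memNset ?mul0r //; apply: wU => k; apply: le_lt_trans re.
have e0 := eta_gt0 b tau0 r0.
apply: (kball_spread sig0 tau0 r0 _ _ zw k).
  by rewrite addr_ge0 // mulr_ge0 // ltW.
exact: (kball_vcoord sig0 tau0 r0 wV zw).
Qed.

End window.

(** By Fubini the integral of [mollify] over the box is that of [f] times the window. The windows
    lie between 0 and 1, vanish outside a fixed larger box, and are eventually equal to the
    indicator off the faces, so dominated convergence applies with majorant [|f|] on that larger
    box. *)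
Lemma mollify_weak_cvg c e M (rho : nat -> R) : 0 <= M -> obox c e `<=` @cbox R N M ->
  (forall k, 0 < rho k) -> (forall k, rho k <= 1) -> rho k @[k --> \oo] --> (0 : R) ->
  (\int[mun N]_(z in obox c e) (mollify (rho k) z - f z))%R @[k --> \oo] --> (0 : R).
Proof.
move=> M0 UM r0 r1 rcv; set U := @obox R N c e.
have mU : measurable U by exact: measurable_obox.
have small_rho s : 0 < s -> \forall k \near \oo, rho k <= s.
  move=> s0; have /cvgr0Pnorm_le /(_ s s0) := rcv.
  by apply: filterS => k; rewrite ger0_norm // ltW.
pose f_ k w := (f w * (fine (window U (rho k) w) - \1_U w))%:E.
set M' := M + kspread a b sig tau (M + 2 * eta 1) 1.
have eta1 : 0 < eta 1 by exact: eta_gt0.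
have lam1 : 0 < lam 1 by exact: lam_gt0.
have MM' : M <= M'.
  rewrite lerDl /kspread; move: (lam 1) (eta 1) lam1 eta1 => x y x0 y0.
  by rewrite !addr_ge0 ?mulr_ge0 ?addr_ge0 ?mulr_ge0 // ltW.
have mB : measurable (@cbox R N M') by exact: measurable_cbox.
have mabsf : measurable_fun setT (fun w => `|f w|%:E).
  by apply/measurable_EFinP; exact: measurableT_comp.
have mf_ k : measurable_fun setT (f_ k).
  apply/measurable_EFinP; apply: measurable_funM => //; apply: measurable_funB => //.
  by apply: measurableT_comp => //; exact: measurable_window.
pose g := ((fun w => `|f w|%:E) \_ (@cbox R N M') : pt R d -> \bar R).
have g0 w : (0 <= g w)%E by rewrite /g patchE; case: (w \in _).
have ig : (mun N).-integrable setT g.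
  apply/integrableP; split.
    by apply/(measurable_restrictT _ mB); exact: measurable_funTS.
  under eq_integral do rewrite gee0_abs //.
  by rewrite -integral_mkcond; apply: locf; exact: le_trans MM'.
have f_g k w : (`|f_ k w| <= g w)%E.
  have w0 := window_ge0 U w (r0 k).
  have w1 := window_le1 mU w (r0 k).
  rewrite /g patchE; have [wB|wB] := boolP (w \in @cbox R N M').
    rewrite /= lee_fin normrM ler_piMr // indicE.
    have : 0 <= fine (window U (rho k) w) by exact: fine_ge0.
    have : fine (window U (rho k) w) <= 1 by rewrite -lee_fin -windowE.
    by case: (w \in U) => h1 h2; rewrite ler_norml; apply/andP; split; rewrite /=; lra.
  have nw : ~ @cbox R N M' w by move=> h; move/negP: wB; apply; rewrite inE.
  rewrite /f_ (window_out M0 UM (r0 k) (r1 k)) // indicE memNset; last first.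
    by move=> Uw; apply: nw => j; apply: le_trans (UM _ Uw j) MM'.
  by rewrite subr0 mulr0 abse0.
have cv : {ae mun N, forall w, setT w -> f_ k w @[k --> \oo] --> (cst 0 w : \bar R)}%E.
  (* The exceptional set consists of the hyperplanes carrying the faces of the box. Any other point
     has positive distance to the faces, and once the balls are smaller than that distance its
     window is exactly 0 or 1. *)
  pose E := \bigcup_k [set w : pt R d | (k < N)%N /\ (nth 0 w k = c k \/ nth 0 w k = e k)].
  apply: (@negligibleS _ _ _ (mun N) E); last first.
    apply: negligible_bigcup => k; have [kN|kN] := ltnP k N; last first.
      by apply: negligibleS (negligible_set0 _) => w [].
    have mH x : measurable [set z : pt R d | nth 0 z k = x].
      by have := @measurable_nth R N k measurableT [set x] (measurable_set1 x); rewrite setTI.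
    have H x := (negligibleP _ (mH x)).2 (mun_hyperplane x kN).
    by apply: negligibleS (negligibleU (H (c k)) (H (e k))) => w [_].
  move=> w nP; apply: contrapT => nE; apply: nP => _.
  have [W W0 wW] := cbox_exists w.
  have wV i : (i < d)%N -> `|vcoord w i| <= W by move=> _; exact: wW.
  apply: cvg_near_cst; have [Uw|Uw] := pselect (U w).
    pose s := \big[Num.min/1]_(k < N) Num.min (nth 0 w k - c k) (e k - nth 0 w k).
    have s0 : 0 < s.
      apply: lt_bigmin => // k _; rewrite lt_min !subr_gt0.
      by have /andP[-> ->] := Uw k (ltn_ord k).
    have [r' r'0 hr'] := kspread_small sig0 tau0 a0 b0 W0 s0.
    apply: filterS (small_rho r' r'0) => k hk.
    rewrite /f_ (window_inside (r0 k) W0 wV (hr' _ (r0 k) hk)).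
      by rewrite indicE mem_set // subrr mulr0.
    move=> z wz j jN; have := wz j; rewrite ltr_norml => /andP[h1 h2].
    have : s <= Num.min (nth 0 w j - c j) (e j - nth 0 w j).
      exact: (bigmin_le 1 (Ordinal jN) (fun k : 'I_N => Num.min (nth 0 w k - c k) (e k - nth 0 w k))).
    rewrite le_min => /andP[h3 h4]; apply/andP; split; lra.
  have [s s0 hs] : exists2 s, 0 < s & forall z : pt R d,
      (forall k, `|nth 0 w k - nth 0 z k| < s) -> ~ U z.
    have [k [kN hk]] : exists k, (k < N)%N /\ ~~ (c k < nth 0 w k < e k).
      apply: contrapT => nk; apply: Uw => k kN; apply: contrapT => /negP h.
      by apply: nk; exists k.
    have wc : nth 0 w k <> c k by move=> h; apply: nE; exists k => //; split=> //; left.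
    have we : nth 0 w k <> e k by move=> h; apply: nE; exists k => //; split=> //; right.
    move: hk; rewrite negb_and -!leNgt => /orP[h|h].
      exists (c k - nth 0 w k); first by rewrite subr_gt0 lt_neqAle h andbT; exact/eqP.
      by move=> z wz Uz; have := wz k; have /andP[h1 _] := Uz k kN; rewrite ltr_norml => /andP[]; lra.
    exists (nth 0 w k - e k); first by rewrite subr_gt0 lt_neqAle h andbT eq_sym; exact/eqP.
    by move=> z wz Uz; have := wz k; have /andP[_ h1] := Uz k kN; rewrite ltr_norml => /andP[]; lra.
  have [r' r'0 hr'] := kspread_small sig0 tau0 a0 b0 W0 s0.
  apply: filterS (small_rho r' r'0) => k hk.
  rewrite /f_ (window_outside (r0 k) W0 wV (hr' _ (r0 k) hk) hs).
  by rewrite indicE memNset // subrr mulr0.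
have [_ _ lim] := dominated_convergence measurableT mf_ (measurable_cst _) cv ig
  (aeW (mun N) (fun w => fun k _ => f_g k w)).
move: lim; rewrite integral0 => /fine_cvgP[_]; apply: cvg_trans; apply: near_eq_cvg.
apply: nearW => k /=; rewrite /Rintegral; congr fine.
have [im E] := mollify_window mU M0 UM (r0 k) (r1 k).
have iU : (mun N).-integrable U (EFin \o f).
  apply/integrableP; split; first by apply/measurable_EFinP; exact: measurable_funTS.
  apply: le_lt_trans (locf M0); apply: ge0_subset_integral => //.
    exact: measurable_cbox.
  exact: measurable_funTS.
under [RHS]eq_integral do rewrite EFinB.
rewrite integralB_EFin //= E.
have iU1 : (mun N).-integrable setT (EFin \o (fun w => f w * \1_U w)).
  have := (integrable_mkcond (EFin \o f) mU).1 iU.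
  apply: eq_integrable => // w _; rewrite patchE /= indicE.
  by case: (w \in U); rewrite ?mulr1 ?mulr0.
have -> : (\int[mun N]_(z in U) (f z)%:E = \int[mun N]_z (f z * \1_U z)%:E)%E.
  rewrite integral_mkcond; apply: eq_integral => w _; rewrite patchE /= indicE.
  by case: (w \in U); rewrite ?mulr1 ?mulr0.
rewrite -integralB_EFin //; last exact: (integrable_window mU M0 UM).
by apply: eq_integral => w _; rewrite /f_ mulrBr EFinB.
Qed.

End mollification.

(** * A generating class for the Borel sets of tuples *)

Section quadrants.
Context {R : realType} (n : nat).
Local Notation pt := (n.-tuple R).

(** Chosen because it is stable under intersection, generates the Borel sets, and meets every open
    box in an open box, so that weak convergence is available on it. *)
Definition quadrants : set (set pt) :=
  [set A | exists c : nat -> R, A = [set z : pt | forall k, (k < n)%N -> nth 0 z k < c k]].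

Lemma setI_closed_quadrants : setI_closed quadrants.
Proof.
move=> _ _ [c ->] [e ->]; exists (fun k => Num.min (c k) (e k)).
apply/seteqP; split=> [z [h1 h2] k kn|z h]; first by rewrite lt_min h1 ?h2.
by split=> k kn; have := h k kn; rewrite lt_min => /andP[].
Qed.

Lemma measurable_quadrants : @measurable _ pt = <<s quadrants >>.
Proof.
apply/seteqP; split=> [A mA|]; last first.
  apply: smallest_sub; first exact: sigma_algebra_measurable.
  move=> _ [c ->].
  rewrite (_ : [set _ | _] = \bigcap_k [set z : pt | (k < n)%N -> nth 0 z k < c k]); last first.
    by apply/seteqP; split=> [z h k _|z h k]; exact: h.
  apply: bigcapT_measurable => k; have [kn|kn] := ltnP k n; last first.
    by rewrite (_ : [set _ | _] = setT) //; apply/seteqP; split.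
  have := @measurable_nth R n k measurableT `]-oo, c k[%classic (measurable_itv _).
  rewrite setTI; congr (measurable _); apply/seteqP; split => z /=; rewrite in_itv //=.
  exact.
have mid : measurable_fun setT (id : g_sigma_algebraType quadrants -> pt).
  apply/measurable_fun_tnthP => i.
  apply: (measurability _ (RGenInftyO.measurableE R)) => _ [_ [x ->] <-].
  rewrite setTI.
  pose Q m := [set z : pt | forall k, (k < n)%N -> nth 0 z k < (if k == i then x else m%:R)].
  rewrite (_ : _ @^-1` _ = \bigcup_m Q m).
    apply: (@bigcup_measurable _ (g_sigma_algebraType quadrants)) => m _.
    by apply: sub_sigma_algebra; exists (fun k : nat => if k == i then x else m%:R).
  apply/seteqP; split=> [z /=|z [m _ h]].
    rewrite in_itv /= => zx; pose m := (Num.truncn (\sum_(j < n) `|nth 0 z j|)).+1.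
    exists m => // k kn; case: eqP => [->|_]; first by rewrite -tnth_nth.
    apply: le_lt_trans (truncnS_gt _); apply: le_trans (ler_norm _) _.
    by rewrite (bigD1 (Ordinal kn)) //= lerDl sumr_ge0.
  by rewrite /= in_itv /= (tnth_nth 0); have := h i (ltn_ord i); rewrite eqxx.
by have := mid measurableT A mA; rewrite setTI preimage_id.
Qed.

End quadrants.

(** * From bounds on mollifications to almost everywhere bounds *)

Section ae_bound.
Context {R : realType} (d : nat) (a b sig tau : R).
Local Notation N := (1 + 2 * d)%N.
Hypotheses (sig0 : 0 < sig) (tau0 : 0 < tau).
Hypotheses (a0 : 0 < a) (b0 : 0 < b).
Hypothesis abd : a * (1 + d%:R) + b * (2 * d%:R) = 1.
Hypothesis sigtau : sig ^+ (1 + d) * tau ^+ (2 * d) = 1.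
Variables (f : pt R d -> R) (F : pt R d -> \bar R) (rho : nat -> R).
Hypothesis mf : measurable_fun setT f.
Hypothesis locf : forall M, 0 <= M -> (\int[mun N]_(w in @cbox R N M) (`|f w|)%:E < +oo)%E.
Hypothesis mF : measurable_fun setT F.
Hypothesis F0 : forall z, (0 <= F z)%E.
Hypothesis locF : forall M, 0 <= M -> (\int[mun N]_(w in @cbox R N M) F w < +oo)%E.
Hypotheses (r0 : forall k, 0 < rho k) (r1 : forall k, rho k <= 1).
Hypothesis rcv : rho k @[k --> \oo] --> (0 : R).
Hypothesis fF : forall k z, (`|mollify a b sig tau f (rho k) z|%:E <= F z)%E.

(** On each of the boxes [D m], which exhaust the space, weak convergence passes from boxes to all
    measurable sets by the Dynkin argument with majorant [F + |f|]; then [ae_le_of_weak_cvg]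
    compares [|f|] with [F]. *)
Lemma le_of_mollify_le : mun N [set z | (F z < `|f z|%:E)%E] = 0%E.
Proof.
have mE : measurable [set z | (F z < `|f z|%:E)%E].
  rewrite -[X in measurable X]setTI; apply: emeasurable_fun_lt => //.
  by apply/measurable_EFinP; exact: measurableT_comp.
pose D (m : nat) : set (pt R d) := obox (fun=> - m%:R) (fun=> m%:R).
have mD m : measurable (D m) by exact: measurable_obox.
have DB m : D m `<=` @cbox R N m%:R.
  move=> z h k; have [kN|kN] := ltnP k N; last by rewrite nth_default ?size_tuple // normr0.
  by have /andP[h1 h2] := h k kN; rewrite ler_norml !ltW.
apply/(negligibleP _ mE).
apply: (@negligibleS _ _ _ (mun N) (\bigcup_m ([set z | (F z < `|f z|%:E)%E] `&` D m))).
  move=> z Ez; have [M M0 zM] := cbox_exists z.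
  exists (Num.truncn M).+1 => //; split=> // k kN; rewrite -ltr_norml.
  exact: le_lt_trans (zM k) (truncnS_gt _).
apply: negligible_bigcup => m; apply/negligibleP; first exact: measurableI.
have sub_fin (h : pt R d -> \bar R) : measurable_fun setT h -> (forall z, (0 <= h z)%E) ->
    (forall M, 0 <= M -> (\int[mun N]_(w in @cbox R N M) h w < +oo)%E) ->
    (\int[mun N]_(w in D m) h w < +oo)%E.
  move=> mh h0 lh; apply: le_lt_trans (lh m%:R (ler0n _ _)).
  apply: ge0_subset_integral => //; first exact: measurable_cbox.
  exact: measurable_funTS.
have mabsf : measurable_fun setT (fun w => `|f w|%:E).
  by apply/measurable_EFinP; exact: measurableT_comp.
have fD : (\int[mun N]_(w in D m) `|f w|%:E < +oo)%E.
  by apply: sub_fin => // z; rewrite lee_fin.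
have FD : (\int[mun N]_(w in D m) F w < +oo)%E by exact: sub_fin.
have mm k : measurable_fun setT (mollify a b sig tau f (rho k)) by exact: measurable_mollify.
apply: (ae_le_of_weak_cvg (mD m) mF F0 FD mf mm fD fF).
have mH : measurable_fun setT (fun z => F z + `|f z|%:E)%E by exact: emeasurable_funD.
have H0 z : (0 <= F z + `|f z|%:E)%E by rewrite adde_ge0.
have HD : (\int[mun N]_(z in D m) (F z + `|f z|%:E) < +oo)%E.
  rewrite ge0_integralD //; try exact: measurable_funTS.
  by rewrite lte_add_pinfty.
apply: (weak_cvg0_induction (mD m) mH H0 HD (G := @quadrants R N)).
- by move=> k; exact: measurable_funB.
- move=> k z; apply: (@le_trans _ _ (`|mollify a b sig tau f (rho k) z|%:E + `|f z|%:E)%E).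
    by rewrite -EFinD lee_fin ler_normB.
  exact: leeD.
- exact: measurable_quadrants.
- exact: setI_closed_quadrants.
- rewrite setTI; exact: (mollify_weak_cvg sig0 tau0 a0 b0 abd sigtau mf locf (ler0n _ m) (DB m) r0 r1 rcv).
- move=> _ [c ->].
  have E : [set z : pt R d | forall k, (k < N)%N -> nth 0 z k < c k] `&` D m =
      obox (fun=> - m%:R) (fun k => Num.min (c k) m%:R).
    apply/seteqP; split=> [z [h1 h2] k kN|z h].
      by have /andP[-> ?] := h2 k kN; rewrite lt_min h1.
    split=> k kN; have /andP[h1] := h k kN; rewrite lt_min => /andP[h2 h3] //.
    by rewrite h1.
  rewrite E.
  apply: (mollify_weak_cvg sig0 tau0 a0 b0 abd sigtau mf locf (ler0n _ m) _ r0 r1 rcv).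
  apply: subset_trans (DB m) => z; rewrite -E; by case.
Qed.

End ae_bound.

(** * Estimates from the equation and the weak gradient at one scale *)

Lemma potential_bounds (R : realType) (d : nat) (a b : R) (phi : pt R d -> R) :
  sm phi -> supported 2 phi -> exists2 K : R, 0 < K & forall z,
    [/\ `|phi z| <= K, `|generator a b phi z| <= K,
      forall i, (i < d)%N -> `|partial (vidx d i) (tpot a b phi) z| <= K &
      forall i, (i < d)%N -> `|vpot a b phi i z| <= K].
Proof.
move=> sphi phi2.
(* The sum of the squares of all quantities involved is again in the class and has the same support,
   so one bound [C] on it controls them all; from [x^2 <= C] follows [|x| <= 1 + C]. *)
pose psi z := phi z * phi z + generator a b phi z * generator a b phi z +
  \sum_(i < d) (partial (vidx d i) (tpot a b phi) z * partial (vidx d i) (tpot a b phi) z +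
    vpot a b phi i z * vpot a b phi i z).
have sg := sm_generator a b sphi.
have st i := sm_partial (vidx d i) (sm_tpot a b sphi).
have sv i := sm_vpot a b i sphi.
have spsi : sm psi.
  apply: sm_add; first by apply: sm_add; exact: sm_mul.
  by apply: sm_sum => i; apply: sm_add; exact: sm_mul.
have psi2 : supported 2 psi.
  move=> z z2; rewrite /psi phi2 // (supported_generator a b phi2) // !mulr0 !add0r.
  apply: big1 => i _; rewrite (supported_partial _ (supported_tpot a b phi2)) //.
  by rewrite (supported_vpot a b _ phi2) // !mulr0 addr0.
have [C C0 psiC] := supported_bounded spsi psi2.
exists (1 + C) => [|z]; first by rewrite ltr_pwDl.
have key (x : R) : x * x <= psi z -> `|x| <= 1 + C.
  move=> h; have := le_trans h (le_trans (ler_norm _) (psiC z)).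
  by move=> h'; rewrite ler_norml; apply/andP; split; nra.
have s0 (i : 'I_d) : 0 <= partial (vidx d i) (tpot a b phi) z * partial (vidx d i) (tpot a b phi) z +
    vpot a b phi i z * vpot a b phi i z by rewrite addr_ge0 // -expr2 sqr_ge0.
have S0 : 0 <= \sum_(i < d) (partial (vidx d i) (tpot a b phi) z *
    partial (vidx d i) (tpot a b phi) z + vpot a b phi i z * vpot a b phi i z).
  exact: sumr_ge0.
have Si (i : 'I_d) : partial (vidx d i) (tpot a b phi) z * partial (vidx d i) (tpot a b phi) z +
    vpot a b phi i z * vpot a b phi i z <= psi z.
  rewrite /psi (bigD1 i) //=.
  have : 0 <= \sum_(j < d | j != i) (partial (vidx d j) (tpot a b phi) z *
    partial (vidx d j) (tpot a b phi) z + vpot a b phi j z * vpot a b phi j z).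
    exact: sumr_ge0.
  have := sqr_ge0 (phi z); have := sqr_ge0 (generator a b phi z); rewrite !expr2.
  by move: (phi z * _) (generator a b phi z * _) (_ + _) (\sum_(j < d | _) _) => *; lra.
have := sqr_ge0 (phi z); have := sqr_ge0 (generator a b phi z); rewrite !expr2 => g2 p2.
split.
- apply: key; rewrite /psi; move: S0 g2 p2.
  by move: (\sum_(i < d) _) (phi z * _) (generator a b phi z * _) => *; lra.
- apply: key; rewrite /psi; move: S0 g2 p2.
  by move: (\sum_(i < d) _) (phi z * _) (generator a b phi z * _) => *; lra.
- move=> i id; apply: key; apply: le_trans (Si (Ordinal id)); rewrite lerDl.
  by rewrite -expr2 sqr_ge0.
- move=> i id; apply: key; apply: le_trans (Si (Ordinal id)); rewrite lerDr.
  by rewrite -expr2 sqr_ge0.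
Qed.

Lemma vnorm_ge0 (R : realType) d (G : 'I_d -> pt R d -> R) z : 0 <= vnorm G z.
Proof. exact: sqrtr_ge0. Qed.

Lemma ler_vnorm (R : realType) d (G : 'I_d -> pt R d -> R) i z : `|G i z| <= vnorm G z.
Proof.
rewrite -sqrtr_sqr ler_wsqrtr // (bigD1 i) //= lerDl.
by apply: sumr_ge0 => j _; exact: sqr_ge0.
Qed.

Lemma measurable_vnorm (R : realType) d (G : 'I_d -> pt R d -> R) :
  (forall i, measurable_fun setT (G i)) -> measurable_fun setT (vnorm G).
Proof.
move=> mG; have -> : vnorm G = fun z => (\sum_(i < d) G i z ^+ 2) `^ 2^-1.
  by apply/funext => z; rewrite powR12_sqrt //; apply: sumr_ge0 => i _; exact: sqr_ge0.
apply: (measurableT_comp (measurable_powR _)).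
by apply: measurable_sum => i; exact: measurable_funX.
Qed.

Section kinetic_estimate.
Context {R : realType} (d : nat) (a b sig tau : R).
Local Notation N := (1 + 2 * d)%N.
Hypotheses (sig0 : 0 < sig) (tau0 : 0 < tau).
Hypotheses (a0 : 0 < a) (b0 : 0 < b).
Local Notation lam := (lam a sig).
Local Notation eta := (eta b tau).
Local Notation kinr := (@kinr R d a b sig tau).
Local Notation kball := (@kball R d a b sig tau).
Local Notation avg := (avg (mun N)).
Variables (f : pt R d -> R) (G S0 : 'I_d -> pt R d -> R).
Hypothesis mf : measurable_fun setT f.
Hypothesis locf : forall M, 0 <= M -> (\int[mun N]_(w in @cbox R N M) (`|f w|)%:E < +oo)%E.
Hypothesis mG : forall i, measurable_fun setT (G i).
Hypothesis mS : forall i, measurable_fun setT (S0 i).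
Hypothesis fG : is_weak_vgrad f G.
Hypothesis fS : kinetic_eq f S0.

Lemma test_fun_kinr (psi : pt R d -> R) z r : 0 < r -> sm psi -> supported 2 psi ->
  test_fun (fun w => psi (kinr z r w)).
Proof.
move=> r0 spsi psi2; have [M M0 zM] := cbox_exists z.
apply: (@sm_test_fun _ _ (M + kspread a b sig tau M r)); first exact: sm_kin.
move=> w [j wj]; apply: (supported_kinr psi2) => zw.
have := kball_cbox sig0 tau0 r0 M0 zM zw j; rewrite -(tnth_nth 0).
by rewrite leNgt wj.
Qed.

Lemma integrable_kinr (psi : pt R d -> R) z r : 0 < r -> sm psi -> supported 2 psi ->
  (mun N).-integrable setT (EFin \o (fun w => f w * psi (kinr z r w))).
Proof.
move=> r0 spsi psi2; have [C C0 psiC] := supported_bounded spsi psi2.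
apply: (@integrable_mul_supported R d a b sig tau sig0 tau0 f mf locf _ z r C) => //.
  by apply: measurable_sm; exact: sm_kin.
by move=> w; exact: supported_kinr.
Qed.

Let abse_integral_le (F H : pt R d -> R) : measurable_fun setT F -> measurable_fun setT H ->
  (forall w, `|F w| <= H w) ->
  (`|\int[mun N]_w (F w)%:E| <= \int[mun N]_w (H w)%:E)%E.
Proof.
move=> mF mH FH; apply: (le_trans (le_abse_integral _ _ _)) => //.
  exact/measurable_EFinP.
apply: ge0_le_integral => //; last by move=> w _; rewrite lee_fin FH.
- by apply/measurable_EFinP; exact: measurableT_comp.
- exact/measurable_EFinP.
Qed.

Let measurable_kball1 r z : measurable_fun setT (fun w => \1_(kball r) (z, w) : R).
Proof.
exact: (measurableT_comp (measurable_indic (measurable_kball a b sig tau r)) (pair1_measurable z)).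
Qed.

Let indic_out (K : R) (psi : pt R d -> R) z r w : supported 2 psi ->
  (forall z, `|psi z| <= K) -> `|psi (kinr z r w)| <= K * \1_(kball r) (z, w).
Proof.
move=> psi2 psiK; rewrite indicE; have [zw|zw] := pselect (kball r (z, w)).
  by rewrite mem_set // mulr1.
by rewrite memNset // mulr0 (supported_kinr psi2 zw) normr0.
Qed.

(** The rescaled potential is a test function, and pulling the transport derivative out of the
    rescaling costs [lam r]. The kinetic equation then moves it to a velocity derivative against
    [S0], which gains [1 / eta r]. *)
Lemma transport_estimate psi K z r : 0 < r -> 0 <= K -> sm psi -> supported 2 psi ->
  (forall i z, (i < d)%N -> `|partial (vidx d i) psi z| <= K) ->
  (`|\int[mun N]_w (f w * transport psi (kinr z r w))%:E| <=
   (d%:R * K * (lam r / eta r))%:E * avg (kball r) (vnorm S0) z)%E.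
Proof.
move=> r0 K0 spsi psi2 psiK; have l0 := lam_gt0 a sig0 r0; have e0 := eta_gt0 b tau0 r0.
have st := sm_transport spsi.
have mB := measurable_kball a b sig tau r.
have E := fS (test_fun_kinr z r0 spsi psi2).
have mtr : measurable_fun setT (fun w => transport psi (kinr z r w)).
  by apply: measurable_sm; exact: sm_kin.
have mp i : measurable_fun setT (fun w => partial (vidx d i) psi (kinr z r w)).
  by apply: measurable_sm; apply: sm_kin; exact: sm_partial.
have EL : (fun w => f w * (partial tidx (fun w => psi (kinr z r w)) w +
    \sum_(i < d) vcoord w i * partial (xidx i) (fun w => psi (kinr z r w)) w)) =
    (fun w => (lam r)^-1 * (f w * transport psi (kinr z r w))).
  apply/funext => w; rewrite mulrCA; congr (_ * _).
  rewrite -[LHS]/(transport (fun w => psi (kin z (lam r) (eta r) w)) w).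
  by rewrite transport_kin // lt0r_neq0.
have ER : (fun w => \sum_(i < d) S0 i w * partial (vidx d i) (fun w => psi (kinr z r w)) w) =
    (fun w => (eta r)^-1 * \sum_(i < d) S0 i w * partial (vidx d i) psi (kinr z r w)).
  apply/funext => w; rewrite mulr_sumr; apply: eq_bigr => i _.
  by rewrite partial_v_kin // mulrCA.
move: E; rewrite EL ER !iintSE; last 2 first.
- apply: measurable_funM => //; apply: measurable_sum => i; exact: measurable_funM.
- by apply: measurable_funM => //; exact: measurable_funM.
under eq_integral do rewrite EFinM.
rewrite integralZl //; last by apply: integrable_kinr => //; exact: supported_transport.
move=> E.
have -> : (\int[mun N]_w (f w * transport psi (kinr z r w))%:E =
    (lam r)%:E * \int[mun N]_w ((eta r)^-1 *
      \sum_(i < d) S0 i w * partial (vidx d i) psi (kinr z r w))%:E)%E.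
  by rewrite -E muleA -EFinM mulfV ?mul1e // lt0r_neq0.
rewrite abseM gee0_abs ?lee_fin ?(ltW l0) //.
apply: (@le_trans _ _ ((lam r)%:E * \int[mun N]_w ((eta r)^-1 * (d%:R * K) *
    (vnorm S0 w * \1_(kball r) (z, w)))%:E)%E).
  apply: lee_wpmul2l; first by rewrite lee_fin ltW.
  apply: abse_integral_le.
  - by apply: measurable_funM => //; apply: measurable_sum => i; exact: measurable_funM.
  - apply: measurable_funM => //; apply: measurable_funM => //; exact: measurable_vnorm.
  move=> w; rewrite normrM gtr0_norm ?invr_gt0 // -!mulrA ler_pM2l ?invr_gt0 //.
  apply: (le_trans (ler_norm_sum _ _ _)).
  rewrite mulr_natl; have -> : K * (vnorm S0 w * \1_(kball r) (z, w)) *+ d =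
      \sum_(i < d) K * (vnorm S0 w * \1_(kball r) (z, w)) by rewrite sumr_const card_ord.
  apply: ler_sum => i _; rewrite normrM mulrCA; apply: ler_pM => //; first exact: ler_vnorm.
  by apply: indic_out => //; [exact: supported_partial|move=> w'; exact: psiK].
under eq_integral do rewrite EFinM.
rewrite ge0_integralZl_EFin //; last 3 first.
- by move=> w _; rewrite lee_fin mulr_ge0 ?vnorm_ge0.
- by apply/measurable_EFinP; apply: measurable_funM => //; exact: measurable_vnorm.
- by rewrite !mulr_ge0 // invr_ge0 ltW.
rewrite muleA -EFinM le_eqVlt; apply/orP; left; apply/eqP; congr (_%:E * _)%E.
by move: (lam r) (eta r) => x y; ring.
Qed.

(** A velocity derivative of the rescaled potential is [1 / eta r] times the derivative of the
    potential, so integrating by parts through the weak gradient costs exactly [eta r]. *)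
Lemma vpotential_estimate psi K z r i : (i < d)%N -> 0 < r -> 0 <= K -> sm psi -> supported 2 psi ->
  (forall z, `|psi z| <= K) ->
  (`|\int[mun N]_w (f w * partial (vidx d i) psi (kinr z r w))%:E| <=
   (K * eta r)%:E * avg (kball r) (vnorm G) z)%E.
Proof.
move=> id r0 K0 spsi psi2 psiK; have e0 := eta_gt0 b tau0 r0.
have mB := measurable_kball a b sig tau r.
have E := fG (test_fun_kinr z r0 spsi psi2) (Ordinal id).
have mp : measurable_fun setT (fun w => partial (vidx d i) psi (kinr z r w)).
  by apply: measurable_sm; apply: sm_kin; exact: sm_partial.
have mpsi : measurable_fun setT (fun w => psi (kinr z r w)).
  by apply: measurable_sm; apply: sm_kin.
have EL : (fun w => f w * partial (vidx d (Ordinal id)) (fun w => psi (kinr z r w)) w) =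
    (fun w => (eta r)^-1 * (f w * partial (vidx d i) psi (kinr z r w))).
  apply/funext => w; rewrite mulrCA; congr (_ * _); exact: partial_v_kin.
move: E; rewrite EL !iintSE; last 2 first.
- exact: measurable_funM.
- by apply: measurable_funM => //; exact: measurable_funM.
under eq_integral do rewrite EFinM.
rewrite integralZl //; last by apply: integrable_kinr; [|exact: sm_partial|exact: supported_partial].
move=> E.
have -> : (\int[mun N]_w (f w * partial (vidx d i) psi (kinr z r w))%:E =
    (eta r)%:E * - \int[mun N]_w (G (Ordinal id) w * psi (kinr z r w))%:E)%E.
  by rewrite -E muleA -EFinM mulfV ?mul1e // lt0r_neq0.
rewrite abseM gee0_abs ?lee_fin ?(ltW e0) // abseN.
apply: (@le_trans _ _ ((eta r)%:E * \int[mun N]_w (K *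
    (vnorm G w * \1_(kball r) (z, w)))%:E)%E).
  apply: lee_wpmul2l; first by rewrite lee_fin ltW.
  apply: abse_integral_le.
  - exact: measurable_funM.
  - apply: measurable_funM => //; apply: measurable_funM => //; exact: measurable_vnorm.
  move=> w; rewrite normrM mulrCA; apply: ler_pM => //; first exact: ler_vnorm.
  exact: indic_out.
under eq_integral do rewrite EFinM.
rewrite ge0_integralZl_EFin //; last 2 first.
- by move=> w _; rewrite lee_fin mulr_ge0 ?vnorm_ge0.
- by apply/measurable_EFinP; apply: measurable_funM => //; exact: measurable_vnorm.
by rewrite muleA -EFinM (mulrC K).
Qed.

End kinetic_estimate.

Lemma avg_subset d (T : measurableType d) (R : realType)
  (mu : {sigma_finite_measure set T -> \bar R}) (B B' : set (T * T)) (g : T -> R) z :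
  measurable B -> measurable B' -> measurable_fun setT g -> (forall y, 0 <= g y) ->
  (forall y, B (z, y) -> B' (z, y)) -> (avg mu B g z <= avg mu B' g z)%E.
Proof.
move=> mB mB' mg g0 BB'; apply: ge0_le_integral => //.
- by move=> y _; rewrite lee_fin mulr_ge0.
- exact: measurable_avg_integrand1.
- exact: measurable_avg_integrand1.
- move=> y _; rewrite lee_fin ler_wpM2l // !indicE.
  have [By|By] := pselect (B (z, y)); last by rewrite memNset.
  by rewrite !mem_set //; exact: BB'.
Qed.

(** * Derivative of the mollification in the scale *)

Section scale_derivative.
Context {R : realType} (d : nat) (a b sig tau : R).
Local Notation N := (1 + 2 * d)%N.
Hypotheses (sig0 : 0 < sig) (tau0 : 0 < tau).
Hypotheses (a0 : 0 < a) (b0 : 0 < b) (ba : b < a).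
Hypothesis abd : a * (1 + d%:R) + b * (2 * d%:R) = 1.
Local Notation lam := (lam a sig).
Local Notation eta := (eta b tau).
Local Notation kinr := (@kinr R d a b sig tau).
Local Notation kball := (@kball R d a b sig tau).
Local Notation kernel := (@kernel R d a b sig tau (@phi0 R d)).
Local Notation gen := (@generator R d a b (@phi0 R d)).
Local Notation avg := (avg (mun N)).
Variable K : R.
Hypotheses (K0 : 0 < K) (KB : forall z,
    [/\ `|@phi0 R d z| <= K, `|gen z| <= K,
      forall i, (i < d)%N -> `|partial (vidx d i) (tpot a b (@phi0 R d)) z| <= K &
      forall i, (i < d)%N -> `|vpot a b (@phi0 R d) i z| <= K]).
Variable f : pt R d -> R.
Hypothesis mf : measurable_fun setT f.
Hypothesis locf : forall M, 0 <= M -> (\int[mun N]_(w in @cbox R N M) (`|f w|)%:E < +oo)%E.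
Local Notation mollify := (mollify a b sig tau f).

Let Ps := @sm_phi0 R d.
Let P2 := @supported_phi0 R d.

Lemma measurable_generator_kinr z r : measurable_fun setT (fun w => gen (kinr z r w)).
Proof. by apply: measurable_sm; apply: sm_kin; exact: sm_generator. Qed.

Lemma integrable_generator z r : 0 < r ->
  (mun N).-integrable setT (EFin \o (fun w => f w * gen (kinr z r w))).
Proof.
move=> r0; have sg := sm_generator a b Ps; have g2 := supported_generator a b P2.
exact: (integrable_kinr a b sig0 tau0 mf locf z r0 sg g2).
Qed.

Lemma is_derive_mollify z (r : R) : 0 < r -> is_derive r 1 (fun r => mollify r z)
  (- r^-1 ^+ 2 * (\int[mun N]_w (f w * gen (kinr z r w)))%R).
Proof.
move=> r0.
pose h (s : R) (w : pt R d) := f w * kernel z s w.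
(* A majorant for scales between [r / 2] and [2 r]: the factor [s^-2] is largest at the lower end,
   and all supports lie in the ball at the upper end because kinetic balls increase with the
   scale. *)
pose H (w : pt R d) := `|f w| * ((r / 2)^-1 ^+ 2 * K * \1_(kball (r * 2)) (z, w)).
have I s : `]r / 2, r * 2[%classic s -> r / 2 < s < r * 2 by rewrite /= in_itv.
have s0 s : `]r / 2, r * 2[%classic s -> 0 < s.
  by move=> /I /andP[h1 _]; apply: lt_trans h1; rewrite divr_gt0.
have r2 : 0 < r / 2 by rewrite divr_gt0.
have Ir : `]r / 2, r * 2[%classic r.
  by rewrite /= in_itv /= ltr_pdivrMr // ltr_pMr // ltr1n.
have inth s : `]r / 2, r * 2[%classic s -> (mun N).-integrable setT (EFin \o h s).
  by move=> /s0 ?; exact: (integrable_kernel a b sig0 tau0 mf locf).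
have dh (s : R) (w : pt R d) : 0 < s -> is_derive s 1 (h ^~ w) (f w * (- s^-1 ^+ 2 * gen (kinr z s w))).
  move=> sp; have kD := is_derive_kernel a b sig0 tau0 z w sp Ps.
  apply: (is_derive_eq (is_derive_mul (is_derive_const (f w) s) kD)).
  by rewrite mul0r add0r.
have derh (s : R) (w : pt R d) : `]r / 2, r * 2[%classic s -> setT w -> derivable (h ^~ w) s 1.
  by move=> /s0 sp _; exact: is_derive_derivable (dh s w sp).
have d1h (s : R) (w : pt R d) : 0 < s -> partial1of2 h s w = f w * (- s^-1 ^+ 2 * gen (kinr z s w)).
  by move=> sp; rewrite /partial1of2 -(is_derive_derive1 (dh s w sp)).
have H0 w : 0 <= H w by rewrite mulr_ge0 // mulr_ge0 // mulr_ge0 ?sqr_ge0 // ltW.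
have mB : measurable (kball (r * 2)) by exact: measurable_kball.
have intH : (mun N).-integrable setT (EFin \o H).
  have mabs : measurable_fun setT (fun w => `|f w|) by exact: measurableT_comp.
  have locabs M : 0 <= M -> (\int[mun N]_(w in @cbox R N M) (`| `|f w| |)%:E < +oo)%E.
    by move=> M0; under eq_integral do rewrite normr_id; exact: locf.
  have r20 : 0 < r * 2 by rewrite mulr_gt0.
  have m1 : measurable_fun setT (fun w => \1_(kball (r * 2)) (z, w) : R).
    exact: (measurableT_comp (measurable_indic mB) (pair1_measurable z)).
  apply: (integrable_mul_supported (a := a) (b := b) sig0 tau0 mabs locabs (z := z) (r := r * 2)
    (h := fun w => (r / 2)^-1 ^+ 2 * K * \1_(kball (r * 2)) (z, w)) (C := (r / 2)^-1 ^+ 2 * K)) => //.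
  - exact: (measurable_funM (measurable_cst _) m1).
  - move=> w; rewrite ger0_norm; last by rewrite mulr_ge0 // mulr_ge0 ?sqr_ge0 // ltW.
    by rewrite ler_piMr ?indicE //; [rewrite mulr_ge0 ?sqr_ge0 // ltW|case: (_ \in _)].
  - by move=> w zw; rewrite indicE memNset // mulr0.
have ubH (s : R) (w : pt R d) : `]r / 2, r * 2[%classic s -> setT w -> `|partial1of2 h s w| <= H w.
  move=> Is _; have sp := s0 s Is; have /andP[sl sr] := I s Is.
  rewrite d1h // normrM /H ler_wpM2l // normrM normrN (ger0_norm (sqr_ge0 _)).
  rewrite indicE; have [zw|zw] := pselect (kball (r * 2) (z, w)); last first.
    have zw' : ~ kball s (z, w).
      by move=> zw'; apply: zw; exact: (kball_mono sig0 tau0 a0 b0 sp (ltW sr) zw').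
    have -> : gen (kinr z s w) = 0 by exact: (supported_kinr (supported_generator a b P2) zw').
    by rewrite memNset // normr0 !mulr0.
  rewrite mem_set // mulr1; apply: ler_pM; rewrite ?sqr_ge0 //; last by have [_ h1 _ _] := KB (kinr z s w); exact: h1.
  have si : s^-1 <= (r / 2)^-1 by rewrite lef_pV2 ?posrE // ltW.
  have i0 : 0 <= s^-1 by rewrite invr_ge0 ltW.
  by rewrite !expr2; exact: ler_pM.
have der := derivable_under_integral measurableT Ir inth derh H0 intH ubH.
have E := differentiation_under_integral measurableT Ir inth derh H0 intH ubH.
apply: (DeriveDef der).
rewrite -derive1E E /Rintegral.
under eq_integral do rewrite d1h //.
under eq_integral do rewrite mulrCA EFinM.
rewrite integralZl //; last exact: integrable_generator.
rewrite -[X in fine (_ * X)]fineK; last first.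
  by apply: integrable_fin_num => //; exact: integrable_generator.
by rewrite -EFinM.
Qed.

Variables (G S0 : 'I_d -> pt R d -> R).
Hypothesis mG : forall i, measurable_fun setT (G i).
Hypothesis mS : forall i, measurable_fun setT (S0 i).
Hypothesis fG : is_weak_vgrad f G.
Hypothesis fS : kinetic_eq f S0.

(** The decomposition [generatorE] splits the integral into a transport term, paid for by [S0], and
    [d] velocity derivatives, paid for by the gradient. *)
Lemma generator_estimate z r : 0 < r ->
  (`|\int[mun N]_w (f w * gen (kinr z r w))%:E| <=
   (d%:R * K)%:E * ((lam r / eta r)%:E * avg (kball r) (vnorm S0) z +
    (eta r)%:E * avg (kball r) (vnorm G) z))%E.
Proof.
move=> r0; have K0' := ltW K0; have l0 := lam_gt0 a sig0 r0; have e0 := eta_gt0 b tau0 r0.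
have st := sm_tpot a b Ps; have t2 := supported_tpot a b P2.
have sv i := sm_vpot a b i Ps; have v2 i := supported_vpot a b i P2.
have it := integrable_kinr a b sig0 tau0 mf locf z r0 (sm_transport st) (supported_transport t2).
have iv (i : 'I_d) := integrable_kinr a b sig0 tau0 mf locf z r0
  (sm_partial (vidx d i) (sv i)) (supported_partial (vidx d i) (v2 i)).
have A1 : (0 <= avg (kball r) (vnorm S0) z)%E by apply: avg_ge0 => w; exact: vnorm_ge0.
have A2 : (0 <= avg (kball r) (vnorm G) z)%E by apply: avg_ge0 => w; exact: vnorm_ge0.
have -> : (\int[mun N]_w (f w * gen (kinr z r w))%:E =
    \int[mun N]_w (f w * transport (tpot a b (@phi0 R d)) (kinr z r w))%:E +
    \sum_(i < d) \int[mun N]_w (f w * partial (vidx d i) (vpot a b (@phi0 R d) i) (kinr z r w))%:E)%E.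
  rewrite -integral_sum // -integralD //; last by apply: integrable_sum => // i _; exact: iv.
  apply: eq_integral => w _; rewrite generatorE // mulrDr mulr_sumr EFinD; congr (_ + _)%E.
  by rewrite sumEFin.
apply: (le_trans (lee_abs_add _ _)); rewrite ge0_muleDr; last 2 first.
- by rewrite mule_ge0 // lee_fin divr_ge0 // ltW.
- by rewrite mule_ge0 // lee_fin ltW.
rewrite !muleA -!EFinM; apply: leeD.
  apply: (transport_estimate a b sig0 tau0 mf locf mS fS) => // i w id.
  by have [_ _ h _] := KB w; exact: h.
apply: (le_trans (lee_abs_sum _ _ _)).
apply: (@le_trans _ _ (\sum_(i < d) ((K * eta r)%:E * avg (kball r) (vnorm G) z))%E).
  apply: lee_sum => i _; apply: (vpotential_estimate a b sig0 tau0 mf locf mG fG) => // w.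
  by have [_ _ _ h] := KB w; exact: h.
rewrite -ge0_sume_distrl; last by move=> i _; rewrite lee_fin mulr_ge0 // ltW.
rewrite sumEFin sumr_const card_ord le_eqVlt; apply/orP; left; apply/eqP.
by congr (_%:E * _)%E; move: (eta r) => x; rewrite -(mulr_natl (K * x)) mulrA.
Qed.

(** Mean value theorem between [r / 2] and [r]. The derivative carries [c^-2], the interval has
    length [r / 2], and [lam c / eta c] is a multiple of [c^(a-b)]; monotonicity in the scale
    replaces the intermediate [c] by [r] everywhere, which uses [b < a]. *)
Lemma mollify_increment z r : 0 < r ->
  (`|mollify r z - mollify (r / 2) z|%:E <=
   (2 * d%:R * K * (sig / tau))%:E * ((r `^ (a - b - 1))%:E * avg (kball r) (vnorm S0) z) +
   (2 * d%:R * K * tau)%:E * ((r `^ (b - 1))%:E * avg (kball r) (vnorm G) z))%E.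
Proof.
move=> r0; have r20 : 0 < r / 2 by rewrite divr_gt0.
have rr : r / 2 < r by rewrite ltr_pdivrMr // ltr_pMr // ltr1n.
have A1 c : (0 <= avg (kball c) (vnorm S0) z)%E by apply: avg_ge0 => w; exact: vnorm_ge0.
have A2 c : (0 <= avg (kball c) (vnorm G) z)%E by apply: avg_ge0 => w; exact: vnorm_ge0.
pose D (s : R) := - s^-1 ^+ 2 * (\int[mun N]_w (f w * gen (kinr z s w)))%R.
have dD (s : R) : 0 < s -> is_derive s 1 (fun s => mollify s z) (D s).
  exact: is_derive_mollify.
have [s | | c] := @MVT R (fun s => mollify s z) D (r / 2) r rr.
- by rewrite in_itv => /andP[s1 _]; apply: dD; exact: lt_trans s1.
- apply: continuous_in_subspaceT => s; rewrite inE /= in_itv /= => /andP[s1 _].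
  exact: (is_derive_continuous (dD s (lt_le_trans r20 s1))).
rewrite in_itv => /andP[c1 c2] ->; have c0 : 0 < c by exact: lt_trans c1.
have intE : ((\int[mun N]_w (f w * gen (kinr z c w)))%R%:E =
    \int[mun N]_w (f w * gen (kinr z c w))%:E)%E.
  by rewrite fineK //; apply: integrable_fin_num => //; exact: integrable_generator.
have -> : r - r / 2 = r / 2 by lra.
rewrite /D mulrAC normrM EFinM.
have cr : `|- c^-1 ^+ 2 * (r / 2)| <= 2 * r^-1.
  rewrite normrM normrN (ger0_norm (sqr_ge0 _)) (gtr0_norm r20).
  apply: (@le_trans _ _ ((r / 2)^-1 ^+ 2 * (r / 2))).
    rewrite ler_pM2r // !expr2; have si : c^-1 <= (r / 2)^-1 by rewrite lef_pV2 ?posrE // ltW.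
    by apply: ler_pM => //; rewrite invr_ge0 ltW.
  by rewrite le_eqVlt; apply/orP; left; apply/eqP; field; exact: lt0r_neq0.
have gE := generator_estimate z c0; rewrite -intE in gE.
have c2' := ltW c2.
have lc0 := lam_gt0 a sig0 c0; have ec0 := eta_gt0 b tau0 c0.
have lec : 0 <= lam c / eta c by exact: (divr_ge0 (ltW lc0) (ltW ec0)).
have leE : lam c / eta c = sig / tau * c `^ (a - b).
  by rewrite powRB ?(gt_eqF c0) ?implybT // /lam /eta -mulf_div.
have st0 : 0 < sig / tau by rewrite divr_gt0.
have ab0 : 0 <= a - b by rewrite subr_ge0 ltW.
have pw e : 0 <= e -> c `^ e <= r `^ e.
  by move=> e0; apply: (ge0_ler_powR e0); rewrite ?nnegrE ?(ltW c0) ?(ltW r0).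
have sub (H : 'I_d -> pt R d -> R) : (forall i, measurable_fun setT (H i)) ->
    (avg (kball c) (vnorm H) z <= avg (kball r) (vnorm H) z)%E.
  move=> mH; apply: avg_subset; [exact: measurable_kball|exact: measurable_kball| | |].
  - exact: measurable_vnorm.
  - by move=> w; exact: vnorm_ge0.
  - by move=> w; exact: (kball_mono sig0 tau0 a0 b0 c0 c2').
have leS : ((lam c / eta c)%:E * avg (kball c) (vnorm S0) z <=
    (sig / tau * r `^ (a - b))%:E * avg (kball r) (vnorm S0) z)%E.
  apply: lee_pmul; [by rewrite lee_fin|exact: A1| |exact: sub].
  by rewrite leE lee_fin (ler_pM2l st0); exact: pw.
have leG : ((eta c)%:E * avg (kball c) (vnorm G) z <=
    (tau * r `^ b)%:E * avg (kball r) (vnorm G) z)%E.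
  apply: lee_pmul; [by rewrite lee_fin; exact: ltW|exact: A2| |exact: sub].
  by rewrite lee_fin (ler_pM2l tau0); exact: pw (ltW b0).
apply: (@le_trans _ _ ((2 * r^-1)%:E * ((d%:R * K)%:E * (
   (sig / tau * r `^ (a - b))%:E * avg (kball r) (vnorm S0) z +
   (tau * r `^ b)%:E * avg (kball r) (vnorm G) z)))%E).
  apply: lee_pmul; [by rewrite lee_fin normr_ge0|by rewrite lee_fin normr_ge0|by rewrite lee_fin| ].
  apply: (le_trans gE); apply: lee_wpmul2l; last exact: leeD.
  by rewrite lee_fin (mulr_ge0 _ (ltW K0)).
have p1 c' : r^-1 * r `^ c' = r `^ (c' - 1).
  by rewrite powRB ?(gt_eqF r0) ?implybT // powRr1 ?(ltW r0) // mulrC.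
have S1 : 0 <= sig / tau * r `^ (a - b) by rewrite mulr_ge0 ?powR_ge0 // divr_ge0 // ltW.
have T1 : 0 <= tau * r `^ b by rewrite mulr_ge0 ?powR_ge0 // ltW.
rewrite muleA -EFinM ge0_muleDr; last 2 first.
- by rewrite mule_ge0.
- by rewrite mule_ge0.
rewrite !muleA -!EFinM -!p1 le_eqVlt; apply/orP; left; apply/eqP.
by congr (_%:E * _ + _%:E * _)%E; ring.
Qed.

End scale_derivative.

(** Passing from [n] to [n.+1] keeps all scales and adds one at each end. *)
Lemma fsum_nondecreasing d (T : measurableType d) (R : realType)
  (mu : {sigma_finite_measure set T -> \bar R}) (B : R -> set (T * T)) b n (g : T -> R) z :
  (forall y, 0 <= g y) -> (fsum mu B b n g z <= fsum mu B b n.+1 g z)%E.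
Proof.
move=> g0.
have pos e (r : R) : (0 <= (r `^ e)%:E * avg mu (B r) g z)%E.
  by rewrite mule_ge0 ?avg_ge0 // lee_fin powR_ge0.
rewrite /fsum mulnS big_ord_recl big_ord_recr /=.
have -> : (\sum_(i < 2 * n) (@dyad R n.+1 (fintype.bump 0 i) `^ (b - 1))%:E * avg mu (B (dyad n.+1 (fintype.bump 0 i))) g z =
  \sum_(i < 2 * n) (@dyad R n i `^ (b - 1))%:E * avg mu (B (dyad n i)) g z)%E.
  apply: eq_bigr => i _; have -> // : dyad n.+1 (fintype.bump 0 i) = dyad n i :> R.
  by rewrite /dyad /fintype.bump leq0n add1n !exprS invfM mulrACA mulfV ?mul1r // pnatr_eq0.
by rewrite addeCA leeDl // adde_ge0.
Qed.

(** * Telescoping over dyadic scales *)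

Section telescoping.
Context {R : realType} (d : nat) (a b sig tau : R).
Local Notation N := (1 + 2 * d)%N.
Hypotheses (sig0 : 0 < sig) (tau0 : 0 < tau).
Hypotheses (a0 : 0 < a) (b0 : 0 < b) (ba : b < a).
Hypothesis abd : a * (1 + d%:R) + b * (2 * d%:R) = 1.
Hypothesis sigtau : sig ^+ (1 + d) * tau ^+ (2 * d) = 1.
Local Notation kinr := (@kinr R d a b sig tau).
Local Notation kball := (@kball R d a b sig tau).
Local Notation kernel := (@kernel R d a b sig tau (@phi0 R d)).
Local Notation gen := (@generator R d a b (@phi0 R d)).
Local Notation avg := (avg (mun N)).
Variable K : R.
Hypotheses (K0 : 0 < K) (KB : forall z,
    [/\ `|@phi0 R d z| <= K, `|gen z| <= K,
      forall i, (i < d)%N -> `|partial (vidx d i) (tpot a b (@phi0 R d)) z| <= K &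
      forall i, (i < d)%N -> `|vpot a b (@phi0 R d) i z| <= K]).
Variable f : pt R d -> R.
Hypothesis mf : measurable_fun setT f.
Hypothesis f2 : (\int[mun N]_z (`|f z| `^ 2)%:E < +oo)%E.
Local Notation mollify := (mollify a b sig tau f).

Lemma locf2 M : 0 <= M -> (\int[mun N]_(w in @cbox R N M) (`|f w|)%:E < +oo)%E.
Proof. by move=> M0; apply: (locally_integrable (p := 2)) => //; rewrite ler1n. Qed.

Variables (G S0 : 'I_d -> pt R d -> R).
Hypothesis mG : forall i, measurable_fun setT (G i).
Hypothesis mS : forall i, measurable_fun setT (S0 i).
Hypothesis fG : is_weak_vgrad f G.
Hypothesis fS : kinetic_eq f S0.

(** The sum over the dyadic window of the right-hand sides of [mollify_increment]: two discrete
    Riesz potentials, of orders [a - b] and [b]. *)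
Definition telesum n z : \bar R :=
  ((2 * d%:R * K * (sig / tau))%:E * fsum (mun N) kball (a - b) n (vnorm S0) z +
   (2 * d%:R * K * tau)%:E * fsum (mun N) kball b n (vnorm G) z)%E.

Let cS : 0 <= 2 * d%:R * K * (sig / tau).
Proof. by rewrite (mulr_ge0 _ (divr_ge0 (ltW sig0) (ltW tau0))) // mulr_ge0 // ltW. Qed.

Let cG : 0 <= 2 * d%:R * K * tau.
Proof. by rewrite (mulr_ge0 _ (ltW tau0)) // mulr_ge0 // ltW. Qed.

Let fS0 c n z : (0 <= fsum (mun N) kball c n (vnorm S0) z)%E.
Proof. by apply: fsum_ge0 => w; exact: vnorm_ge0. Qed.

Let fG0 c n z : (0 <= fsum (mun N) kball c n (vnorm G) z)%E.
Proof. by apply: fsum_ge0 => w; exact: vnorm_ge0. Qed.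

Lemma telesum_ge0 n z : (0 <= telesum n z)%E.
Proof. by apply: adde_ge0; apply: mule_ge0. Qed.

Lemma telesum_nondecreasing n z : (telesum n z <= telesum n.+1 z)%E.
Proof.
by apply: leeD; apply: lee_wpmul2l => //; apply: fsum_nondecreasing => w; exact: vnorm_ge0.
Qed.

Lemma measurable_telesum n : measurable_fun setT (telesum n).
Proof.
apply: emeasurable_funD; apply: measurable_funeM; apply: (measurable_fsum (kball_family sig0 tau0 abd sigtau)).
- exact: measurable_vnorm.
- by move=> w; exact: vnorm_ge0.
- exact: measurable_vnorm.
- by move=> w; exact: vnorm_ge0.
Qed.

Let D n z (j : nat) : \bar R :=
  ((2 * d%:R * K * (sig / tau))%:E * ((dyad n j `^ (a - b - 1))%:E * avg (kball (dyad n j)) (vnorm S0) z) +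
   (2 * d%:R * K * tau)%:E * ((dyad n j `^ (b - 1))%:E * avg (kball (dyad n j)) (vnorm G) z))%E.

Let telesumE n z : telesum n z = (\sum_(j < 2 * n) D n z j)%E.
Proof.
rewrite /telesum /fsum !ge0_sume_distrr //; last 2 first.
- by move=> j _; rewrite mule_ge0 ?lee_fin ?powR_ge0 // avg_ge0 // => w; exact: vnorm_ge0.
- by move=> j _; rewrite mule_ge0 ?lee_fin ?powR_ge0 // avg_ge0 // => w; exact: vnorm_ge0.
by rewrite -big_split.
Qed.

Let D0 n z j : (0 <= D n z j)%E.
Proof.
have A1 c : (0 <= avg (kball c) (vnorm S0) z)%E by apply: avg_ge0 => w; exact: vnorm_ge0.
have A2 c : (0 <= avg (kball c) (vnorm G) z)%E by apply: avg_ge0 => w; exact: vnorm_ge0.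
by rewrite adde_ge0 // mule_ge0 ?lee_fin // mule_ge0 ?lee_fin ?powR_ge0.
Qed.

Lemma mollify_telescope n z m : (m <= 2 * n)%N ->
  (`|mollify (dyad n (2 * n - m) / 2) z|%:E <=
   `|mollify (dyad n (2 * n) / 2) z|%:E + \sum_(2 * n - m <= j < 2 * n) D n z j)%E.
Proof.
elim: m => [|m IH] mn; first by rewrite subn0 big_geq // adde0.
have := IH (ltnW mn); rewrite -(subnSK mn).
set i := (2 * n - m.+1)%N => IH'.
have i2 : (i < 2 * n)%N by rewrite ltn_subrL (leq_ltn_trans _ mn).
rewrite big_ltn // addeCA; have := mollify_increment sig0 tau0 a0 b0 ba abd K0 KB mf locf2 mG mS fG fS z (@dyad_gt0 R n i).
rewrite -/(D n z i) => inc.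
have hd : dyad n i.+1 / 2 = dyad n i :> R by rewrite dyadS mulrC mulKf // pnatr_eq0.
rewrite hd in IH'; apply: (le_trans _ (leeD inc IH')).
rewrite -EFinD lee_fin; move: (mollify (dyad n i) z) (mollify (dyad n i / 2) z) => x y.
by rewrite -{1}(subKr x y) [leRHS]addrC; exact: ler_normB.
Qed.

(** The [L^2] bound on ball integrals, applied to [|f| / X], gives order [r^(1/2)] against the
    prefactor [r^-1]. This removes the boundary term of the telescoping at large scales. *)
Lemma mollify_decay (X r : R) z : 0 < X -> (\int[mun N]_z (`|f z| `^ 2)%:E <= (X ^+ 2)%:E)%E ->
  0 < r -> `|mollify r z| <= K * X * (12 ^+ N + 1) * r^-1 `^ 2^-1.
Proof.
move=> X0 fX r0; have BC := kball_family sig0 tau0 abd sigtau.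
have mabs : measurable_fun setT (fun w => `|f w|) by exact: measurableT_comp.
have mg : measurable_fun setT (fun w => X^-1 * `|f w|) by exact: measurable_funM.
have g0 w : 0 <= X^-1 * `|f w| by rewrite mulr_ge0 // invr_ge0 ltW.
have g1 : (\int[mun N]_w ((X^-1 * `|f w|) `^ 2)%:E <= 1)%E.
  have iX : 0 <= X^-1 by rewrite invr_ge0 ltW.
  under eq_integral do rewrite powRM // EFinM.
  rewrite ge0_integralZl_EFin ?powR_ge0 //; last first.
    by apply/measurable_EFinP; exact: (measurableT_comp (measurable_powR _)).
  apply: (@le_trans _ _ ((X^-1 `^ 2)%:E * (X ^+ 2)%:E)%E).
    by apply: lee_wpmul2l; rewrite ?lee_fin ?powR_ge0.
  rewrite -EFinM lee_fin powR_mulrn // -exprMn mulVf ?expr1n //.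
  exact: lt0r_neq0.
have p12 : (1 : R) < 2 by rewrite ltr1n.
have := avg_le_Lp BC z r0 p12 mg g0 g1.
have [mB _ _] := BC r r0.
rewrite avgZ //; last by rewrite invr_ge0 ltW.
move=> h.
have h' : (avg (kball r) (fun w => `|f w|%R) z <= (X * ((12 ^+ N + 1) * r `^ (1 - 2^-1)))%:E)%E.
  set A := avg _ _ _ in h *; have -> : A = (X%:E * (X^-1%:E * A))%E.
    by rewrite muleA -EFinM mulfV ?mul1e // lt0r_neq0.
  rewrite (EFinM X).
  by apply: lee_wpmul2l; [rewrite lee_fin ltW|exact: h].
rewrite -lee_fin -abse_EFin (mollifyE a b sig0 tau0 mf locf2) //.
have mk : measurable_fun setT (fun w => f w * kernel z r w).
  by apply: measurable_funM => //; exact: measurable_kernel1 (@sm_phi0 R d).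
apply: (le_trans (le_abse_integral _ _ _)) => //; first exact/measurable_EFinP.
apply: (@le_trans _ _ ((r^-1 * K)%:E * avg (kball r) (fun w => `|f w|%R) z)%E).
  have rK : 0 <= r^-1 * K by rewrite (mulr_ge0 _ (ltW K0)) // invr_ge0 ltW.
  have m1 := measurable_avg_integrand1 z mB mabs.
  rewrite -(ge0_integralZl_EFin) //.
  apply: ge0_le_integral => //.
  - by apply/measurable_EFinP; exact: measurableT_comp.
  - exact: measurable_funeM.
  - move=> w _; rewrite -EFinM /= lee_fin normrM [leRHS]mulrCA ler_wpM2l // indicE.
    have [zw|zw] := pselect (kball r (z, w)).
      rewrite mem_set // mulr1 normrM gtr0_norm ?invr_gt0 // ler_pM2l ?invr_gt0 //.
      by have [h1 _ _ _] := KB (kinr z r w); exact: h1.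
    by rewrite memNset // mulr0 kernel_out // normr0.
apply: (@le_trans _ _ ((r^-1 * K)%:E * (X * ((12 ^+ N + 1) * r `^ (1 - 2^-1)))%:E)%E).
  by apply: lee_wpmul2l; [rewrite lee_fin (mulr_ge0 _ (ltW K0)) // invr_ge0 ltW|exact: h'].
rewrite -EFinM lee_fin le_eqVlt; apply/orP; left; apply/eqP.
have s0 : r `^ 2^-1 != 0 by rewrite gt_eqF // powR_gt0.
have -> : r^-1 `^ 2^-1 = (r `^ 2^-1)^-1.
  apply: (mulIf s0); rewrite mulVf // -powRM ?invr_ge0 ?(ltW r0) //.
  by rewrite mulVf ?powR1 // lt0r_neq0.
rewrite powRB ?(gt_eqF r0) ?implybT // powRr1 ?(ltW r0) //.
by move: (r `^ 2^-1) s0 => s s0; field; rewrite s0 lt0r_neq0.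
Qed.

Definition telesup z : \bar R := ereal_sup (range (telesum ^~ z)).

(** Telescope from the scale [2^-k / 2] up to [2^n / 2] and let [n] grow: the increments are part of
    [telesum n], and the coarsest mollification is arbitrarily small. *)
Lemma mollify_le_telesup k z : (`|mollify ((2 ^+ k)^-1 / 2) z|%:E <= telesup z)%E.
Proof.
have [X X0 fX] : exists2 X : R, 0 < X & (\int[mun N]_z (`|f z| `^ 2)%:E <= (X ^+ 2)%:E)%E.
  have f20 : (0 <= \int[mun N]_z (`|f z| `^ 2)%:E)%E.
    by apply: integral_ge0 => w _; rewrite lee_fin powR_ge0.
  exists (1 + fine (\int[mun N]_z (`|f z| `^ 2)%:E)); first by rewrite ltr_pwDl ?fine_ge0.
  rewrite -[leLHS]fineK ?ge0_fin_numE // lee_fin; have := fine_ge0 f20.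
  by move: (fine _) => y y0; nra.
set Q := K * X * (12 ^+ N + 1).
have Q0 : 0 < Q by rewrite !mulr_gt0 // ltr_pwDr // exprn_ge0.
apply/lee_addgt0Pr => e e0.
(* Choice of the coarsest scale: [Q] times the inverse square root of [2^n / 2] must not exceed [e],
   and [n >= k] keeps the starting scale inside the dyadic window. *)
have [s0 s00 hs] := @powR_small R 2^-1 (e / Q) ltac:(by rewrite invr_gt0) (divr_gt0 e0 Q0).
have [n kn ns] : exists2 n, (k <= n)%N & (2 ^+ n / 2)^-1 <= s0.
  exists (maxn k (Num.truncn (2 / s0)).+1); first exact: leq_maxl.
  set n := maxn _ _.
  have : 2 / s0 < 2 ^+ n.
    apply: (lt_le_trans (truncnS_gt _)); apply: (@le_trans _ _ n%:R).
      by rewrite ler_nat leq_maxr.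
    by rewrite -natrX ler_nat ltnW // ltn_expl.
  by rewrite ltr_pdivrMr // invf_div ler_pdivrMr ?exprn_gt0 // mulrC => /ltW.
have n2k : (n - k <= 2 * n)%N by rewrite (leq_trans (leq_subr _ _)) // leq_pmull.
have := @mollify_telescope n z (2 * n - (n - k)) (leq_subr _ _).
rewrite subKn //.
have -> : dyad n (n - k) = (2 ^+ k)^-1 :> R.
  by rewrite /dyad -{2}(subnK kn) exprD invfM mulVKf // expf_neq0 // pnatr_eq0.
have -> : dyad n (2 * n) = 2 ^+ n :> R.
  by rewrite /dyad mul2n -addnn exprD mulfK // expf_neq0.
move=> h; apply: (le_trans h); rewrite addeC; apply: leeD.
  apply: (@le_trans _ _ (telesum n z)); last by apply: ereal_sup_ubound; exists n.
  rewrite telesumE -(big_mkord xpredT (D n z)) [X in (_ <= X)%E](big_cat_nat _ n2k) //=.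
  by rewrite leeDr // sume_ge0.
have p0 : 0 < 2 ^+ n / 2 :> R by rewrite divr_gt0 // exprn_gt0.
rewrite lee_fin; apply: (le_trans (mollify_decay z X0 fX p0)); rewrite -/Q.
have := hs (2 ^+ n / 2)^-1 ltac:(by rewrite invr_gt0) ns.
by rewrite ler_pdivlMr // mulrC.
Qed.

End telescoping.

(** * Supremum over the dyadic windows and the integrated estimate *)

Lemma ge0_le_poweR (R : realType) (q : R) (x y : \bar R) : 0 <= q -> (0 <= x)%E -> (x <= y)%E ->
  (x `^ q <= y `^ q)%E.
Proof.
move=> q0 x0 xy; apply: gt0_ler_poweR => //; rewrite in_itv /= ?x0 ?leey //.
by rewrite (le_trans x0 xy).
Qed.

Lemma poweRD_le (R : realType) (q : R) (x y : \bar R) : 0 <= q -> (0 <= x)%E -> (0 <= y)%E ->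
  ((x + y) `^ q <= (2 `^ q)%:E * (x `^ q + y `^ q))%E.
Proof.
move=> q0; wlog : x y / (x <= y)%E => [H x0 y0|xy x0 y0].
  have [xy|/ltW yx] := leP x y; first exact: H.
  by rewrite addeC [X in (_ * X)%E]addeC; exact: H.
apply: (@le_trans _ _ ((2%:E * y) `^ q)%E).
  apply: ge0_le_poweR => //; first by rewrite adde_ge0.
  have -> : (2%:E * y = y + y)%E by rewrite -mule2n -mule_natl.
  exact: leeD.
rewrite poweRM ?lee_fin // poweR_EFin; apply: lee_wpmul2l; first by rewrite lee_fin powR_ge0.
by rewrite leeDr // poweR_ge0.
Qed.

Section monotone_sup.
Context d (T : measurableType d) (R : realType) (mu : {measure set T -> \bar R}).
Variables (U : nat -> T -> \bar R) (q C : R).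
Hypotheses (mU : forall n, measurable_fun setT (U n)) (U0 : forall n z, (0 <= U n z)%E)
  (UU : forall n z, (U n z <= U n.+1 z)%E) (q1 : 1 <= q)
  (UC : forall n, (\int[mu]_z (U n z `^ q) <= C%:E)%E).

Let q0 : 0 < q. Proof. exact: lt_le_trans q1. Qed.

Let homoU z : {homo U ^~ z : n m / (n <= m)%N >-> (n <= m)%E}.
Proof. by apply: (homo_leq (r := fun x y : \bar R => (x <= y)%E)) => // y x w; exact: le_trans. Qed.

Let U_cvg z : U n z @[n --> \oo] --> ereal_sup (range (U ^~ z)).
Proof. exact: ereal_nondecreasing_cvgn (@homoU z). Qed.

Lemma measurable_sup : measurable_fun setT (fun z => ereal_sup (range (U ^~ z))).
Proof. by apply: (emeasurable_fun_cvg _ _ mU) => z _; exact: U_cvg. Qed.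

Lemma sup_ge0 z : (0 <= ereal_sup (range (U ^~ z)))%E.
Proof. by apply: le_trans (U0 0 z) _; apply: ereal_sup_ubound; exists 0%N. Qed.

(** Since [U <= 1 + U^q], the integrals over a set of finite measure are bounded uniformly in [n],
    and monotone convergence passes the bound to the supremum. This supplies the local integrability
    required of a majorant. *)
Lemma integral_sup_lty D : measurable D -> (mu D < +oo)%E ->
  (\int[mu]_(z in D) ereal_sup (range (U ^~ z)) < +oo)%E.
Proof.
move=> mD muD; apply: (@le_lt_trans _ _ (mu D + C%:E)%E); last by rewrite lte_add_pinfty ?ltry.
under eq_integral => z _ do rewrite -(cvg_lim (@ereal_hausdorff R) (@U_cvg z)).
rewrite monotone_convergence //; last by move=> n; exact: measurable_funTS.
have mUq n : measurable_fun setT (fun z => U n z `^ q)%E.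
  exact: (measurableT_comp (measurable_poweR _)).
apply: lime_le.
  apply: ereal_nondecreasing_is_cvgn => n m nm; apply: ge0_le_integral => //.
  - exact: measurable_funTS.
  - exact: measurable_funTS.
  - by move=> z _; exact: homoU.
apply: nearW => n.
apply: (@le_trans _ _ (\int[mu]_(z in D) (1 + U n z `^ q))%E).
  apply: ge0_le_integral => //.
  - exact: measurable_funTS.
  - by apply: emeasurable_funD => //; exact: measurable_funTS.
  - move=> z _; have [h|h] := leP (U n z) 1%E.
      by apply: le_trans h _; rewrite leeDl // poweR_ge0.
    apply: (@le_trans _ _ (U n z `^ q)%E); last by rewrite leeDr.
    move: h (U0 n z); case: (U n z) => [x| |] //=; last by rewrite gt_eqF.
    rewrite lte_fin lee_fin => x1 x0; rewrite -{1}(powRr1 x0).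
    by apply: ler_powR => //; exact: ltW.
rewrite ge0_integralD //; [|by move=> z _; exact: poweR_ge0|exact: measurable_funTS].
rewrite integral_cst // mul1e; apply: leeD => //; apply: le_trans (UC n).
by apply: ge0_subset_integral => // z _; exact: poweR_ge0.
Qed.

Lemma integral_le_sup (f : T -> R) : measurable_fun setT f ->
  mu [set z | (ereal_sup (range (U ^~ z)) < `|f z|%:E)%E] = 0%E ->
  (\int[mu]_z (`|f z| `^ q)%:E <= (2 `^ q * C)%:E)%E.
Proof.
move=> mf; set E := [set z | _] => E0.
have mE : measurable E.
  rewrite -[E]setTI; apply: emeasurable_fun_lt => //; first exact: measurable_sup.
  by apply/measurable_EFinP; exact: measurableT_comp.
(* Halving [|f|] creates a strict inequality with the supremum wherever [f] is nonzero, so some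
   [U n], and all later ones, already exceed [|f| / 2]. Fatou then applies; the loss is the factor
   [2^q]. *)
pose h z : \bar R := ((`|f z| / 2) `^ q * \1_(~` E) z)%:E.
have mfq : measurable_fun setT (fun z => `|f z| `^ q).
  by apply: (measurableT_comp (measurable_powR _)); exact: measurableT_comp.
have mf2 : measurable_fun setT (fun z => (`|f z| / 2) `^ q).
  apply: (measurableT_comp (measurable_powR _)); apply: measurable_funM => //.
  exact: measurableT_comp.
have mh : measurable_fun setT h.
  apply/measurable_EFinP; apply: measurable_funM => //.
  by apply: measurable_indic; exact: measurableC.
have h0 z : (0 <= h z)%E by rewrite lee_fin mulr_ge0 ?powR_ge0.
have hC : (\int[mu]_z h z <= C%:E)%E.
  apply: (@integral_le_of_eventually _ _ _ mu h (fun n z => U n z `^ q)%E) => //.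
  - by move=> n; exact: (measurableT_comp (measurable_poweR _)).
  - by move=> n z; exact: poweR_ge0.
  move=> z; have [Ez|Ez] := pselect (E z).
    by exists 0%N => n _; rewrite /h indicE memNset ?mulr0 ?poweR_ge0 // => h; exact: h.
  have fU : (`|f z|%:E <= ereal_sup (range (U ^~ z)))%E by rewrite leNgt; exact/negP.
  have [f0|f0] := eqVneq (f z) 0.
    by exists 0%N => n _; rewrite /h f0 normr0 mul0r powR0 ?mul0r ?poweR_ge0 // gt_eqF.
  have nf0 : 0 < `|f z| by rewrite normr_gt0.
  have f2 : ((`|f z| / 2)%:E < ereal_sup (range (U ^~ z)))%E.
    by apply: lt_le_trans fU; rewrite lte_fin ltr_pdivrMr // ltr_pMr // ltr1n.
  have [_ [n0 _ <-] hn0] := ereal_sup_gt f2; exists n0 => n nn.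
  rewrite /h indicE mem_set // mulr1 -poweR_EFin; apply: ge0_le_poweR.
  - exact: ltW.
  - by rewrite lee_fin divr_ge0.
  - by apply: le_trans (ltW hn0) _; exact: homoU.
have E2 : (\int[mu]_z h z = \int[mu]_z ((`|f z| / 2) `^ q)%:E)%E.
  apply: ge0_ae_eq_integral => //; first exact/measurable_EFinP.
  exists E; split=> // z /=; apply: contra_notP => nE _.
  by rewrite /h indicE mem_set ?mulr1.
have -> : (\int[mu]_z (`|f z| `^ q)%:E = (2 `^ q)%:E * \int[mu]_z ((`|f z| / 2) `^ q)%:E)%E.
  rewrite -ge0_integralZl_EFin ?powR_ge0 //; last exact/measurable_EFinP.
  apply: eq_integral => z _; rewrite -EFinM -powRM ?divr_ge0 //.
  by rewrite mulrC divfK.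
by rewrite -E2 EFinM; apply: lee_wpmul2l => //; rewrite lee_fin powR_ge0.
Qed.

End monotone_sup.

(** The point is the uniformity of [C] in [sig] and [tau]: the ball constant [12^N], the bound [K]
    on the potentials and the Hardy-Littlewood-Sobolev constants depend only on [d] and the
    exponents, so the two scales can be optimized afterwards. *)
Lemma kinetic_integral_le (R : realType) (d : nat) (a b p mu q : R) :
  1 < p -> p < q -> 1 < mu -> mu < q ->
  b = p^-1 - q^-1 -> a - b = mu^-1 - q^-1 ->
  a * (1 + d%:R) + b * (2 * d%:R) = 1 ->
  exists2 C : R, 0 <= C &
  forall (sig tau X Y : R) (f : pt R d -> R) (G S0 : 'I_d -> pt R d -> R),
    0 < sig -> 0 < tau -> sig ^+ (1 + d) * tau ^+ (2 * d) = 1 -> 0 < X -> 0 < Y ->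
    measurable_fun setT f -> (\int[mun (1 + 2 * d)]_z (`|f z| `^ 2)%:E < +oo)%E ->
    (forall i, measurable_fun setT (G i)) ->
    (\int[mun (1 + 2 * d)]_z (vnorm G z `^ p)%:E <= (X `^ p)%:E)%E ->
    (forall i, measurable_fun setT (S0 i)) ->
    (\int[mun (1 + 2 * d)]_z (vnorm S0 z `^ mu)%:E <= (Y `^ mu)%:E)%E ->
    is_weak_vgrad f G -> kinetic_eq f S0 ->
    (\int[mun (1 + 2 * d)]_z (`|f z| `^ q)%:E <=
      (C * ((sig / tau * Y) `^ q + (tau * X) `^ q))%:E)%E.
Proof.
move=> p1 pq mu1 muq hb hab abd.
have p0 : 0 < p by exact: lt_trans p1.
have mu0 : 0 < mu by exact: lt_trans mu1.
have q1 : 1 <= q by rewrite ltW // (lt_trans p1).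
have q0 : 0 < q by exact: lt_le_trans q1.
have b0 : 0 < b by rewrite hb subr_gt0 ltf_pV2.
have ba : b < a by rewrite -subr_gt0 hab subr_gt0 ltf_pV2.
have a0 : 0 < a by exact: lt_trans ba.
have [K K0 KB] := potential_bounds a b (@sm_phi0 R d) (@supported_phi0 R d).
pose C0 : R := 12 ^+ (1 + 2 * d).
have C00 : 0 < C0 by rewrite exprn_gt0.
pose hS := hls_cst C0 mu q; pose hG := hls_cst C0 p q.
have hS0 : 0 <= hS by exact: hls_cst_ge0.
have hG0 : 0 <= hG by exact: hls_cst_ge0.
pose c1 := 2 * d%:R * K.
have c10 : 0 <= c1 by rewrite !mulr_ge0 // ltW.
(* One factor [2^q] comes from splitting the power of the sum of the two potentials, the other from
   passing to the supremum in [integral_le_sup]. *)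
exists (2 `^ q * (2 `^ q * c1 `^ q * (hS + hG))).
  by rewrite !mulr_ge0 ?powR_ge0 // addr_ge0.
move=> sig tau X Y f G S0 sig0 tau0 sigtau X0 Y0 mf f2 mG GX mS SY fG fS.
have BC := kball_family sig0 tau0 abd sigtau.
have vG0 z : 0 <= vnorm G z by exact: vnorm_ge0.
have vS0 z : 0 <= vnorm S0 z by exact: vnorm_ge0.
have mvG := measurable_vnorm mG; have mvS := measurable_vnorm mS.
pose U n := telesum a b sig tau K G S0 n.
have mU n : measurable_fun setT (U n) by exact: measurable_telesum.
have U0 n z : (0 <= U n z)%E by exact: telesum_ge0.
have UU n z : (U n z <= U n.+1 z)%E by exact: telesum_nondecreasing.
have sgt : 0 <= sig / tau by rewrite divr_ge0 // ltW.
have st0 : 0 <= c1 * (sig / tau) by rewrite mulr_ge0.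
have t0 : 0 <= c1 * tau by rewrite mulr_ge0 // ltW.
pose B := 2 `^ q * c1 `^ q * (hS + hG) * ((sig / tau * Y) `^ q + (tau * X) `^ q).
have UC n : (\int[mun (1 + 2 * d)]_z (U n z `^ q) <= B%:E)%E.
  pose FS := fsum (mun (1 + 2 * d)) (@kball R d a b sig tau) (a - b) n (vnorm S0).
  pose FG := fsum (mun (1 + 2 * d)) (@kball R d a b sig tau) b n (vnorm G).
  have FS0 z : (0 <= FS z)%E by exact: fsum_ge0.
  have FG0 z : (0 <= FG z)%E by exact: fsum_ge0.
  have mFS : measurable_fun setT (fun z => FS z `^ q)%E.
    by apply: (measurableT_comp (measurable_poweR _)); exact: (measurable_fsum BC).
  have mFG : measurable_fun setT (fun z => FG z `^ q)%E.
    by apply: (measurableT_comp (measurable_poweR _)); exact: (measurable_fsum BC).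
  have IS : (\int[mun (1 + 2 * d)]_z (FS z `^ q) <= (hS * Y `^ q)%:E)%E.
    by rewrite /FS hab; exact: integral_fsum_le.
  have IG : (\int[mun (1 + 2 * d)]_z (FG z `^ q) <= (hG * X `^ q)%:E)%E.
    by rewrite /FG hb; rewrite hb in BC; exact: (integral_fsum_le C00 p1 pq BC).
  pose cS := 2 `^ q * (c1 * (sig / tau)) `^ q; pose cG := 2 `^ q * (c1 * tau) `^ q.
  have cS0 : 0 <= cS by rewrite mulr_ge0 ?powR_ge0.
  have cG0 : 0 <= cG by rewrite mulr_ge0 ?powR_ge0.
  apply: (@le_trans _ _ (\int[mun (1 + 2 * d)]_z (cS%:E * FS z `^ q + cG%:E * FG z `^ q))%E).
    apply: ge0_le_integral => //.
    - by move=> z _; exact: poweR_ge0.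
    - exact: (measurableT_comp (measurable_poweR _)).
    - by apply: emeasurable_funD; exact: measurable_funeM.
    - move=> z _; rewrite /U /telesum -/c1 -/(FS z) -/(FG z).
      have x0 : (0 <= (c1 * (sig / tau))%:E * FS z)%E by rewrite mule_ge0.
      have y0 : (0 <= (c1 * tau)%:E * FG z)%E by rewrite mule_ge0.
      apply: (le_trans (poweRD_le (ltW q0) x0 y0)).
      rewrite !poweRM ?lee_fin // !poweR_EFin ge0_muleDr ?mule_ge0 ?lee_fin ?powR_ge0 ?poweR_ge0 //.
      by rewrite !muleA -!EFinM.
  rewrite ge0_integralD //; last 4 first.
  - by move=> z _; rewrite mule_ge0 ?poweR_ge0.
  - exact: measurable_funeM.
  - by move=> z _; rewrite mule_ge0 ?poweR_ge0.
  - exact: measurable_funeM.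
  rewrite !ge0_integralZl_EFin //; try by move=> z _; exact: poweR_ge0.
  apply: (@le_trans _ _ (cS%:E * (hS * Y `^ q)%:E + cG%:E * (hG * X `^ q)%:E)%E).
    by apply: leeD; apply: lee_wpmul2l.
  rewrite -!EFinM -EFinD lee_fin /cS /cG /B.
  have sY : (sig / tau * Y) `^ q = (sig / tau) `^ q * Y `^ q.
    by rewrite powRM // ltW.
  have tX : (tau * X) `^ q = tau `^ q * X `^ q by rewrite powRM // ltW.
  have cs : (c1 * (sig / tau)) `^ q = c1 `^ q * (sig / tau) `^ q.
    by rewrite powRM.
  have ct : (c1 * tau) `^ q = c1 `^ q * tau `^ q by rewrite powRM // ltW.
  rewrite sY tX cs ct.
  have A0 : 0 <= 2 `^ q * c1 `^ q by rewrite mulr_ge0 ?powR_ge0.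
  have P1 : 0 <= (sig / tau) `^ q * Y `^ q by rewrite mulr_ge0 ?powR_ge0.
  have P2 : 0 <= tau `^ q * X `^ q by rewrite mulr_ge0 ?powR_ge0.
  have Q1 := mulr_ge0 (mulr_ge0 A0 hG0) P1.
  have Q2 := mulr_ge0 (mulr_ge0 A0 hS0) P2.
  move: Q1 Q2; move: (2 `^ q) (c1 `^ q) ((sig / tau) `^ q) (Y `^ q) (tau `^ q) (X `^ q).
  by clear; move: hS hG => h1 h2 x1 x2 x3 x4 x5 x6 Q1 Q2; lra.
have locf M : 0 <= M -> (\int[mun (1 + 2 * d)]_(w in @cbox R (1 + 2 * d) M) (`|f w|)%:E < +oo)%E.
  exact: locf2.
have locU M : 0 <= M -> (\int[mun (1 + 2 * d)]_(w in @cbox R (1 + 2 * d) M)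
    telesup a b sig tau K G S0 w < +oo)%E.
  move=> M0; apply: (integral_sup_lty mU U0 UU q1 UC); first exact: measurable_cbox.
  exact: mun_cbox.
have r0 k : 0 < (2 ^+ k)^-1 / 2 :> R by rewrite divr_gt0 // invr_gt0 exprn_gt0.
have r1 k : (2 ^+ k)^-1 / 2 <= 1 :> R.
  have k1 : 1 <= 2 ^+ k :> R by rewrite exprn_ege1 // ler1n.
  have k2 : (2 ^+ k)^-1 <= 1 :> R by rewrite invf_le1 ?exprn_gt0.
  rewrite ler_pdivrMr // mul1r; apply: (le_trans k2); exact: ler1n.
have rcv : (2 ^+ k)^-1 / 2 @[k --> \oo] --> (0 : R).
  have h1 : `|2^-1 : R| < 1 by rewrite ger0_norm ?invr_ge0 // invf_lt1 // ltr1n.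
  rewrite (_ : (fun k => _) = geometric (2^-1 : R) 2^-1); first exact: cvg_geometric.
  by apply/funext => k; rewrite /= exprVn mulrC.
have E0 := le_of_mollify_le sig0 tau0 a0 b0 abd sigtau mf locf (measurable_sup mU UU)
  (sup_ge0 U0) locU r0 r1 rcv
  (mollify_le_telesup sig0 tau0 a0 b0 ba abd sigtau K0 KB mf f2 mG mS fG fS).
have := integral_le_sup mU UU q1 UC mf E0.
move=> h; apply: (le_trans h).
by rewrite lee_fin /B le_eqVlt; apply/orP; left; apply/eqP; rewrite -!mulrA.
Qed.

(** * Norms, choice of the scales, and conclusion *)

Section norm_power.
Context {R : realType} (n : nat).

Lemma Lnormn_ge0 (p : R) (f : n.-tuple R -> R) : (0 <= Lnormn p f)%E.
Proof. exact: poweR_ge0. Qed.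

Lemma poweRVK (p : R) (x : \bar R) : 0 < p -> (0 <= x)%E -> ((x `^ p^-1) `^ p = x)%E.
Proof.
by move=> p0 x0; rewrite -poweRrM mulVf ?poweRe1 // lt0r_neq0.
Qed.

Lemma integral_le_Lnormn (p X : R) (f : n.-tuple R -> R) : 0 < p -> measurable_fun setT f ->
  (Lnormn p f <= X%:E)%E -> (\int[mun n]_z (`|f z| `^ p)%:E <= (X `^ p)%:E)%E.
Proof.
move=> p0 mf fX; have I0 : (0 <= \int[mun n]_z (`|f z| `^ p)%:E)%E.
  by apply: integral_ge0 => z _; rewrite lee_fin powR_ge0.
rewrite -(poweRVK p0 I0) -poweR_EFin; apply: ge0_le_poweR; first exact: ltW.
  exact: poweR_ge0.
by rewrite -LnormnE.
Qed.

Lemma Lnormn_le (p X : R) (f : n.-tuple R -> R) : 0 < p -> 0 <= X -> measurable_fun setT f ->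
  (\int[mun n]_z (`|f z| `^ p)%:E <= (X `^ p)%:E)%E -> (Lnormn p f <= X%:E)%E.
Proof.
move=> p0 X0 mf fX; rewrite LnormnE //.
have -> : (X%:E = (X `^ p)%:E `^ p^-1)%E.
  by rewrite poweR_EFin -powRrM mulfV ?powRr1 // lt0r_neq0.
apply: ge0_le_poweR => //; first by rewrite invr_ge0 ltW.
by apply: integral_ge0 => z _; rewrite lee_fin powR_ge0.
Qed.

End norm_power.

(* The time and velocity scales balancing the two contributions. *)
Lemma optimal_scales (R : realType) (d : nat) (X Y : R) : 0 < X -> 0 < Y ->
  let t := (3 * d + 1)%:R / (4 * d + 2)%:R in
  let s := (d + 1)%:R / (4 * d + 2)%:R in
  exists sig tau : R, [/\ 0 < sig, 0 < tau, sig ^+ (1 + d) * tau ^+ (2 * d) = 1,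
    tau * X = X `^ t * Y `^ s & sig / tau * Y = X `^ t * Y `^ s].
Proof.
move=> X0 Y0 t s; have XY0 : 0 < Y / X by rewrite divr_gt0.
have D0 : (4 * d + 2)%:R != 0 :> R by rewrite pnatr_eq0 addn2.
have ts : t + s = 1.
  rewrite /t /s -mulrDl -natrD; have -> : (3 * d + 1 + (d + 1) = 4 * d + 2)%N by clear; lia.
  by rewrite mulfV.
(* With both scales powers of [Y / X], the volume constraint reads [u (1 + d) + 2 d s = 0] and
   equality of the two contributions reads [2 s - u = 1]; this pair of exponents solves both. *)
pose u := - ((2 * d)%:R / (4 * d + 2)%:R) : R.
exists ((Y / X) `^ u), ((Y / X) `^ s).
have XV c : (Y / X) `^ c = Y `^ c * X `^ (- c).
  rewrite powRM ?invr_ge0 ?ltW //; congr (_ * _).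
  by rewrite -(powR_inv1 (ltW X0)) -powRrM mulN1r.
have XD x c e : 0 < x -> (x : R) `^ c * x `^ e = x `^ (c + e).
  by move=> x0; rewrite powRD // (gt_eqF x0) implybT.
have us : u - s = - t.
  rewrite /u /s /t -opprD -mulrDl -natrD; congr (- (_%:R / _)); clear; lia.
split; [exact: powR_gt0|exact: powR_gt0| | | ].
- rewrite -!powR_mulrn ?powR_ge0 // -!powRrM XD //.
  have -> : u * (1 + d)%:R + s * (2 * d)%:R = 0.
    rewrite /u /s (addnC 1%N); move: (2 * d)%:R (d + 1)%:R ((4 * d + 2)%:R^-1) => x y z.
    by ring.
  by rewrite powRr0.
- rewrite XV -mulrA -{2}(powRr1 (ltW X0)) XD // mulrC; congr (_ `^ _ * _).
  by rewrite -ts; ring.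
- rewrite -powRN XD // us XV opprK mulrAC -{2}(powRr1 (ltW Y0)) XD // mulrC.
  by congr (_ * _ `^ _); rewrite -ts; ring.
Qed.

Theorem theorem1p2 (R : realType) (d : nat) (p mu q : R) :
  1 < p -> 1 < mu ->
  q^-1 = (4 * d + 2)%:R^-1 * ((3 * d + 1)%:R / p + (d + 1)%:R / mu - 1) ->
  Num.max 2 (Num.max p mu) < q ->
  exists2 C : R, 0 < C &
    forall (f : pt R d -> R) (G S0 : 'I_d -> pt R d -> R),
      memLp 2 f ->
      (forall i, measurable_fun [set: pt R d] (G i)) ->
      memLp p (vnorm G) ->
      is_weak_vgrad f G ->
      (forall i, measurable_fun [set: pt R d] (S0 i)) ->
      memLp mu (vnorm S0) ->
      kinetic_eq f S0 ->
      (Lnormn q f <=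
        C%:E * (Lnormn p (vnorm G)) `^ ((3 * d + 1)%:R / (4 * d + 2)%:R)
             * (Lnormn mu (vnorm S0)) `^ ((d + 1)%:R / (4 * d + 2)%:R))%E.
Proof.
move=> p1 mu1 qE; rewrite !gt_max => /and3P[q2 pq muq].
have p0 : 0 < p by exact: lt_trans p1.
have mu0 : 0 < mu by exact: lt_trans mu1.
have q0 : 0 < q by exact: lt_trans pq.
(* These are the orders of the two Riesz potentials that map [L^p] and [L^mu] into [L^q]. *)
pose b := p^-1 - q^-1; pose a := mu^-1 - q^-1 + b.
have hab : a - b = mu^-1 - q^-1 by rewrite /a addrK.
(* The volume relation is the definition of [q] in disguise: collecting terms gives
   [(3d+1)/p + (d+1)/mu - (4d+2)/q = 1]. *)
have abd : a * (1 + d%:R) + b * (2 * d%:R) = 1.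
  have D0 : (4 * d + 2)%:R != 0 :> R by rewrite pnatr_eq0 addn2.
  have : (4 * d + 2)%:R * q^-1 = (3 * d + 1)%:R / p + (d + 1)%:R / mu - 1.
    by rewrite qE mulrA mulfV ?mul1r.
  have e3 : (3 * d + 1)%:R = 3 * d%:R + 1 :> R by rewrite natrD natrM.
  have e4 : (4 * d + 2)%:R = 4 * d%:R + 2 :> R by rewrite natrD natrM.
  have e1 : (d + 1)%:R = d%:R + 1 :> R by rewrite natrD.
  rewrite /a /b e3 e4 e1; move: p^-1 mu^-1 q^-1 d%:R => x y z w h.
  have -> : (y - z + (x - z)) * (1 + w) + (x - z) * (2 * w) =
    ((3 * w + 1) * x + (w + 1) * y - 1) - (4 * w + 2) * z + 1 by ring.
  by rewrite -h subrr add0r.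
have [C C0 main] := kinetic_integral_le p1 pq mu1 muq (erefl b) hab abd.
set t := (3 * d + 1)%:R / (4 * d + 2)%:R; set s := (d + 1)%:R / (4 * d + 2)%:R.
have t0 : 0 < t by rewrite divr_gt0 // ltr0n ?addn1 ?addn2.
have s0 : 0 < s by rewrite divr_gt0 // ltr0n ?addn1 ?addn2.
(* After balancing, the two contributions are equal, hence the factor 2; adding 1 to [C] makes the
   constant positive. *)
pose C' := (2 * (C + 1)) `^ q^-1.
have C'0 : 0 < C' by rewrite powR_gt0 // mulr_gt0 // ltr_wpDl.
exists C' => // f G S0 [mf f2] mG [mvG GX] fG mS [mvS SY] fS.
have f2' : (\int[mun (1 + 2 * d)]_z (`|f z| `^ 2)%:E < +oo)%E.
  by move: f2; rewrite LnormnE // => /lty_poweRy; apply; rewrite invr_eq0.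
pose x := fine (Lnormn p (vnorm G)); pose y := fine (Lnormn mu (vnorm S0)).
have xE : Lnormn p (vnorm G) = x%:E by rewrite fineK // ge0_fin_numE // Lnormn_ge0.
have yE : Lnormn mu (vnorm S0) = y%:E by rewrite fineK // ge0_fin_numE // Lnormn_ge0.
have x0 : 0 <= x by rewrite -lee_fin -xE Lnormn_ge0.
have y0 : 0 <= y by rewrite -lee_fin -yE Lnormn_ge0.
(* Stated for positive upper bounds of the norms rather than the norms themselves, because the
   optimal scales exist only for positive [X] and [Y]. *)
have bound X Y : 0 < X -> 0 < Y -> x <= X -> y <= Y ->
    (Lnormn q f <= (C' * (X `^ t * Y `^ s))%:E)%E.
  move=> X0 Y0 xX yY.
  have [sig [tau [sig0 tau0 sigtau tX sY]]] := optimal_scales d X0 Y0.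
  have P0 : 0 <= X `^ t * Y `^ s by rewrite mulr_ge0 ?powR_ge0.
  have vI (r Z : R) (H : 'I_d -> pt R d -> R) : 0 < r -> measurable_fun setT (vnorm H) ->
      (Lnormn r (vnorm H) <= Z%:E)%E ->
      (\int[mun (1 + 2 * d)]_z (vnorm H z `^ r)%:E <= (Z `^ r)%:E)%E.
    move=> r0 mvH HZ; have := integral_le_Lnormn r0 mvH HZ.
    by under eq_integral do rewrite ger0_norm ?vnorm_ge0 //.
  apply: Lnormn_le => //; first by rewrite mulr_ge0 // ltW.
  have IG : (\int[mun (1 + 2 * d)]_z (vnorm G z `^ p)%:E <= (X `^ p)%:E)%E.
    by apply: vI => //; rewrite xE lee_fin.
  have IS : (\int[mun (1 + 2 * d)]_z (vnorm S0 z `^ mu)%:E <= (Y `^ mu)%:E)%E.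
    by apply: vI => //; rewrite yE lee_fin.
  apply: (le_trans (main sig tau X Y f G S0 sig0 tau0 sigtau X0 Y0 mf f2' mG IG mS IS fG fS)).
  have C'q : C' `^ q = 2 * (C + 1).
    by rewrite -powRrM mulVf ?lt0r_neq0 // powRr1 // mulr_ge0 // addr_ge0.
  rewrite tX sY -/t -/s lee_fin (powRM _ (ltW C'0) P0) C'q.
  have := mulr_ge0 C0 (powR_ge0 (X `^ t * Y `^ s) q).
  by have := powR_ge0 (X `^ t * Y `^ s) q; move: (_ `^ q) => w h1 h2; clear -h1 h2; lra.
rewrite xE yE !poweR_EFin -!EFinM -mulrA.
have small Z r e : 0 < r -> 0 < e -> 0 < Z -> exists2 w : R, 0 < w & C' * (Z * w `^ r) <= e.
  move=> r0 e0 Z0; have CZ : 0 < C' * Z by rewrite mulr_gt0.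
  have [w w0 hw] := powR_small r0 (divr_gt0 e0 CZ).
  by exists w => //; have := hw w w0 (lexx _); rewrite ler_pdivlMr // mulrC mulrA.
have y1 : 0 < y + 1 by rewrite ltr_wpDl.
have x1 : 0 < x + 1 by rewrite ltr_wpDl.
(* If one of the two norms vanishes, replace it by a small positive [w] and the other by its value
   plus one; letting [w] tend to zero shows that the norm of [f] vanishes. *)
have [x00|xn0] := eqVneq x 0.
  rewrite x00 powR0 ?(gt_eqF t0) // mul0r mulr0.
  apply/lee_addgt0Pr => e e0; rewrite add0e.
  have [w w0 hw] := small ((y + 1) `^ s) t e t0 e0 (powR_gt0 _ y1).
  apply: le_trans (bound w (y + 1) w0 y1 _ _) _; rewrite ?x00 ?(ltW w0) ?lerDl //.
  by rewrite lee_fin (mulrC (w `^ t)).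
have [y00|yn0] := eqVneq y 0.
  rewrite y00 powR0 ?(gt_eqF s0) // !mulr0.
  apply/lee_addgt0Pr => e e0; rewrite add0e.
  have [w w0 hw] := small ((x + 1) `^ t) s e s0 e0 (powR_gt0 _ x1).
  apply: le_trans (bound (x + 1) w x1 w0 _ _) _; rewrite ?y00 ?(ltW w0) ?lerDl //.
by apply: bound => //; rewrite lt0r ?xn0 ?yn0.
Qed.
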